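(* Let $d, j \in \mathbb{N}$ and let $f$ be a probability density function on $\mathbb{R}^d$. Suppose there exists $\beta > d$ such that $f(x) = \Theta(|x|^{-\beta})$ as $|x| \to \infty$, i.e. such that for some finite positive $C$ we have $$ C^{-1} |x|^{-\beta} < f(x) < C |x|^{-\beta} \quad \text{for all } x \in \mathbb{R}^d \text{ with } |x| \ge C. $$ Suppose also that $I_{1-\alpha/d}(f) < \infty$ for some $\alpha \in (0,d)$. Then, for this $\alpha$, as $n \to \infty$, $$ n^{-1} S_{n,\alpha} \to \omega_d^{-\alpha/d} \left( \frac{\Gamma(j+\alpha/d)}{\Gamma(j)} \right) I_{1-\alpha/d}(f) $$ with convergence in $L^1$.
   Context: $\mathbb{N} = \{1,2,\ldots\}$; $|\cdot|$ is the Euclidean norm. For a finite set $\mathcal{X} \subset \mathbb{R}^d$ and $x \in \mathcal{X}$, $D(x,\mathcal{X}) = D_j(x,\mathcal{X})$ denotes the Euclidean distance from $x$ to its $j$th nearest neighbor in $\mathcal{X} \setminus \{x\}$ if $\mathrm{card}(\mathcal{X}) > j$, and $D(x,\mathcal{X}) := 0$ if $\mathrm{card}(\mathcal{X}) \le j$. $(X_i)_{i \in \mathbb{N}}$ is a sequence of independent random vectors in $\mathbb{R}^d$ with common density $f$, $\mathcal{X}_n := \{X_1,\ldots,X_n\}$, and $$S_{n,\alpha} := \sum_{i=1}^n (n^{1/d} D(X_i,\mathcal{X}_n))^{\alpha}.$$ $\omega_d := \pi^{d/2}/\Gamma(1+d/2)$ is the volume of the unit ball in $\mathbb{R}^d$.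 For $\rho > 0$, $I_\rho(f) := \int_{\mathbb{R}^d} f(y)^\rho\, dy$. *)

(* Defs.v *)
From HB Require Import structures.
From mathcomp Require Import all_boot all_order all_algebra finmap.
From mathcomp Require Import all_classical all_reals all_analysis.

Set Implicit Arguments.
Unset Strict Implicit.
Unset Printing Implicit Defensive.
Import Order.TTheory GRing.Theory Num.Theory.
Import numFieldNormedType.Exports.

Local Open Scope classical_set_scope.
Local Open Scope ring_scope.

(* R^d is [d.-tuple R], whose library sigma-algebra is the product of the Borel
   sigma-algebras of the coordinates, that is, the Borel sigma-algebra of R^d. *)

Section euclidean.
Context {R : realType} {d : nat}.
Implicit Types x y : d.-tuple R.

Definition enorm x : R := Num.sqrt (\sum_(i < d) tnth x i ^+ 2).

Definition edist x y : R := enorm [tuple tnth x i - tnth y i | i < d].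

End euclidean.

Section lebesgue_tuple.
Context {R : realType}.

Definition tuple_cons d (p : R * d.-tuple R) : d.+1.-tuple R :=
  [tuple of p.1 :: p.2].

Fixpoint lebesgue_tuple (d : nat) : set (d.-tuple R) -> \bar R :=
  if d is d'.+1
  then pushforward (lebesgue_measure \x @lebesgue_tuple d')%E (@tuple_cons d')
  else dirac [tuple].

Lemma measurable_tuple_cons d : measurable_fun setT (@tuple_cons d).
Proof. exact: measurable_cons. Qed.

Let uncons d (t : d.+1.-tuple R) : R * d.-tuple R :=
  (thead t, [tuple of behead t]).

Let measurable_uncons d : measurable_fun setT (@uncons d).
Proof.
apply/measurable_fun_pairP; split; last exact: measurable_behead.
exact: measurable_tnth.
Qed.

Let tuple_consK d : cancel (@tuple_cons d) (@uncons d).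
Proof.
by move=> [x t]; rewrite /uncons theadE; congr pair; exact/val_inj.
Qed.

Let lebesgue_tuple_sigma_finite_ex d :
  exists m : {sigma_finite_measure set (d.-tuple R) -> \bar R},
    m = @lebesgue_tuple d :> (set _ -> _).
Proof.
elim: d => [|d [m mE]].
  by exists [the {sigma_finite_measure set _ -> \bar R} of dirac [tuple]].
pose nu : {measure set (d.+1.-tuple R) -> \bar R} :=
  measure_function_pushforward__canonical__measure_function_Measure
    (lebesgue_measure \x m)%E (@measurable_tuple_cons d).
have nuE : nu = @lebesgue_tuple d.+1 :> (set _ -> _) by rewrite /= -mE.
have snu : sigma_finite setT nu.
  have /sigma_finiteP[F [FT ndF Foo]] := sigma_finiteT (@lebesgue_measure R).
  have /sigma_finiteP[G [GT ndG Goo]] := sigma_finiteT m.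
  exists (fun n => @uncons d @^-1` (F n `*` G n)).
    apply/seteqP; split => // t _.
    have [k _ Fk] : (\bigcup_i F i) (uncons t).1 by rewrite -FT.
    have [l _ Gl] : (\bigcup_i G i) (uncons t).2 by rewrite -GT.
    exists (maxn k l) => //; split.
      by move: Fk; exact/subsetPset/ndF/leq_maxl.
    by move: Gl; exact/subsetPset/ndG/leq_maxr.
  move=> n; have [mF Fn] := Foo n; have [mG Gn] := Goo n.
  split.
    rewrite -[X in measurable X]setTI; apply: measurable_uncons => //.
    exact: measurableX.
  rewrite /= /pushforward -comp_preimage.
  rewrite (_ : _ \o _ = id); last by apply/funext; exact: tuple_consK.
  by rewrite preimage_id product_measure1E// lte_mul_pinfty// ge0_fin_numE.
pose H := Measure_isSigmaFinite.Build _ _ _ (nu : set _ -> \bar R) snu.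
pose nu' : {sigma_finite_measure set (d.+1.-tuple R) -> \bar R} :=
  HB.pack (Measure.sort nu) (Measure.class nu) H.
by exists nu'.
Qed.

Section instances.
Variable d : nat.

Let lebesgue_tuple0 : @lebesgue_tuple d set0 = 0%E.
Proof. by have [m <-] := lebesgue_tuple_sigma_finite_ex d. Qed.

Let lebesgue_tuple_ge0 A : (0 <= @lebesgue_tuple d A)%E.
Proof. by have [m <-] := lebesgue_tuple_sigma_finite_ex d. Qed.

Let lebesgue_tuple_sigma_additive : semi_sigma_additive (@lebesgue_tuple d).
Proof.
have [m <-] := lebesgue_tuple_sigma_finite_ex d.
exact: measure_semi_sigma_additive.
Qed.

HB.instance Definition _ := isMeasure.Build _ _ _ (@lebesgue_tuple d)
  lebesgue_tuple0 lebesgue_tuple_ge0 lebesgue_tuple_sigma_additive.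

Let lebesgue_tuple_sigma_finite : sigma_finite setT (@lebesgue_tuple d).
Proof.
have [m <-] := lebesgue_tuple_sigma_finite_ex d.
exact: (sigma_finiteT m).
Qed.

HB.instance Definition _ := Measure_isSigmaFinite.Build _ _ _
  (@lebesgue_tuple d) lebesgue_tuple_sigma_finite.

End instances.

Lemma lebesgue_tuple_box d (A : d.-tuple (set R)) :
  (forall i, measurable (tnth A i)) ->
  lebesgue_tuple [set x : d.-tuple R | forall i, tnth A i (tnth x i)] =
    (\prod_(i < d) lebesgue_measure (tnth A i))%E.
Proof.
elim: d A => [|d IH] A mA.
  rewrite big_ord0 /= /dirac indicE mem_set//; first by case.
rewrite big_ord_recl
  -[LHS]/((lebesgue_measure \x @lebesgue_tuple d)%E (@tuple_cons d @^-1` _)).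
pose B : d.-tuple (set R) := [tuple of behead A].
have BE i : tnth B i = tnth A (lift ord0 i).
  by rewrite [in RHS](tuple_eta A) tnthS.
have mB : measurable [set x : d.-tuple R | forall i, tnth B i (tnth x i)].
  rewrite (_ : [set _ | _] =
      \bigcap_(i in [set: 'I_d]) (@tnth d R ^~ i @^-1` tnth B i)); last first.
    by apply/seteqP; split => [x Bx i _|x Bx i]; exact: Bx.
  apply: fin_bigcap_measurable => // i _.
  rewrite -[X in measurable X]setTI; apply: measurable_tnth => //.
  by rewrite BE.
rewrite (_ : _ @^-1` _ =
    tnth A ord0 `*` [set x : d.-tuple R | forall i, tnth B i (tnth x i)]).
  rewrite product_measure1E//; last exact: mA.
  congr (_ * _)%E; apply: (etrans (IH B _)); first by move=> i; rewrite BE.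
  by apply: eq_bigr => i _; rewrite BE.
apply/seteqP; split => [[x t] /= H|[x t] /= [Hx Ht] i].
  split; first by have := H ord0; rewrite tnth0.
  by move=> i; have := H (lift ord0 i); rewrite tnthS -BE.
case: (unliftP ord0 i) => [k ->|->]; last by rewrite tnth0.
by rewrite tnthS -BE.
Qed.

End lebesgue_tuple.

Section constants.
Context {R : realType}.

Definition Gamma (a : R) : R :=
  \int[lebesgue_measure]_(t in `]0, +oo[) (t `^ (a - 1) * expR (- t)).

Definition unit_ball_volume (d : nat) : R :=
  pi `^ (d%:R / 2) / Gamma (1 + d%:R / 2).

End constants.

Section densities.
Context {R : realType} {d : nat}.
Implicit Types f : d.-tuple R -> R.

Definition is_density f :=
  [/\ measurable_fun [set: d.-tuple R] f, forall x, 0 <= f x &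
      (\int[@lebesgue_tuple R d]_x (f x)%:E = 1)%E].

(* [0 `^ rho] is 0 for [rho > 0]. *)
Definition Irho (rho : R) f : \bar R :=
  (\int[@lebesgue_tuple R d]_y (f y `^ rho)%:E)%E.

End densities.

Section random_vectors.
Context {R : realType} {dT} {T : measurableType dT} (P : probability T R).

Definition mutually_independent {dU} {U : measurableType dU}
    (X : nat -> {RV P >-> U}) :=
  forall (J : {fset nat}) (B : nat -> set U),
    (forall i, measurable (B i)) ->
    P (\bigcap_(i in [set` J]) (X i @^-1` B i)) =
    (\prod_(i <- J) P (X i @^-1` B i))%E.

Definition has_density {d : nat} (X : {RV P >-> d.-tuple R})
    (f : d.-tuple R -> R) :=
  forall B : set (d.-tuple R), measurable B ->
    distribution P X B = (\int[@lebesgue_tuple R d]_(x in B) (f x)%:E)%E.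

Definition cvg_in_L1 (Y : nat -> T -> R) (Z : T -> R) :=
  [/\ forall n, Y n \in Lfun P 1%E, Z \in Lfun P 1%E &
      ('E_P[fun w => `|Y n w - Z w|%R] @[n --> \oo] --> 0)%E].

End random_vectors.

Section nearest_neighbors.
Context {R : realType} {d : nat}.
Local Open Scope fset_scope.

(* Distance from [x] to its [j]-th nearest neighbor in [A `\ x], for [x \in A]
   and [0 < j]; ties between neighbors are counted with multiplicity. *)
Definition knn_dist (j : nat) (x : d.-tuple R) (A : {fset d.-tuple R}) : R :=
  if (j < #|` A|)%N
  then nth 0 (sort <=%R [seq edist x y | y <- enum_fset (A `\ x)]) j.-1
  else 0.

(* The sequence X_1, X_2, ... is indexed from 0, so that the sample
   {X_1, ..., X_n} is the set of the [x i] with [i < n]. *)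
Definition sample (x : nat -> d.-tuple R) (n : nat) : {fset d.-tuple R} :=
  [fset x (val i) | i : 'I_n].

Definition knn_power_sum (j : nat) (alpha : R) (x : nat -> d.-tuple R)
    (n : nat) : R :=
  \sum_(i < n) (n%:R `^ d%:R^-1 * knn_dist j (x i) (sample x n)) `^ alpha.

End nearest_neighbors.

(* Main.v *)
(* Write D_i for the distance from X_i to its jth nearest neighbour among n
   sample points.  By the layer cake formula n^-1 S_n is the integral over
   v > 0 of the fraction Z_n(v) of the i with (n^(1/d) D_i)^alpha > v, that is,
   D_i > r with r = v^(1/alpha) n^(-1/d).  Given X_i = x this event says that a
   binomial variable with parameters n - 1 and mu (ball x r) is less than j;
   by the L^1 form of Lebesgue differentiation and Poisson approximation its
   probability tends to F(v), the mean under f of the probability that a Poisson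
   variable with parameter omega_d v^(d/alpha) f(x) is less than j.  Two balls
   of radius r are disjoint with high probability, and occupation numbers of
   disjoint sets are negatively correlated, so E (Z_n(v) - F(v))^2 -> 0.
   To integrate over v, one needs an integrable bound on E Z_n(v).  With
   s = v^(1/alpha), cut space at M = s^(d/beta): the part inside M is covered by
   O((M / r)^d) cells of diameter at most r, each contributing at most j / n, and
   the part outside M has mass O(M^(d - beta)); this gives O(s^(d^2/beta - d)).
   Finiteness of I_(1 - alpha/d)(f) forces d < beta (1 - alpha/d), which is
   exactly the integrability of this bound.  Finally the integral of F is
   computed by Tonelli from the gamma distribution function. *)

(* The obstacle is that S_n need not have a finite second moment, so no variance argument applies to
   S_n itself. The layer cake formula trades the unbounded powers for fractions Z_n(v) in [0, 1],
   whose second moments are harmless; moments of the distances enter only through the integrable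
   bound in v. The cut M = s^(d/beta) is the value that balances the two parts of that bound. The
   cells contribute (M / r)^d j / n = j (M / s)^d, which is free of n because r = s n^(-1/d); the
   outside contributes M^(d - beta); the two agree when M^beta = s^d. The cell count is of the right
   order only for r <= M. For r > M a different argument is used: a point of norm at most r / 2 has
   nearly all the mass within distance r, so everything reduces to the mass outside radius r / 2,
   which obeys the same bound. The sample is a set, so coincident points would change its size and
   its neighbor counts. They are discarded as a null event, the law having no atoms. *)
Require Import Defs.
From HB Require Import structures.
From mathcomp Require Import all_boot all_order all_algebra finmap.
From mathcomp Require Import all_classical all_reals all_analysis.
From mathcomp Require Import measurable_realfun ring lra.

Set Implicit Arguments.
Unset Strict Implicit.
Unset Printing Implicit Defensive.
Import Order.TTheory GRing.Theory Num.Theory.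
Import numFieldNormedType.Exports.

Local Open Scope classical_set_scope.
Local Open Scope ring_scope.

(* mathcomp-analysis has an unrelated [edist]. *)
Local Notation edist := Defs.edist.
#[local] Arguments lebesgue_tuple : simpl never.

(** * Binomial and Poisson lower tails *)

Section binomial_lower_tail.
Context {R : realType}.
Implicit Types (m j : nat) (p q : R).

(* The probability that a binomial variable with parameters [m] and [p] is
   less than [j]. *)
Fixpoint binlt m j p : R :=
  if m is m'.+1 then
    if j is j'.+1 then p * binlt m' j' p + (1 - p) * binlt m' j p else 0
  else (0 < j)%:R.

Lemma binltS m j p :
  binlt m.+1 j.+1 p = p * binlt m j p + (1 - p) * binlt m j.+1 p.
Proof. by []. Qed.

Lemma binlt0 m p : binlt m 0 p = 0.
Proof. by case: m. Qed.

Lemma binlt_ge0 m j p : 0 <= p <= 1 -> 0 <= binlt m j p.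
Proof.
move=> /andP[p0 p1]; elim: m j => [|m IH] [|j]//=.
by rewrite addr_ge0// mulr_ge0// subr_ge0.
Qed.

Lemma binlt_le1 m j p : 0 <= p <= 1 -> binlt m j p <= 1.
Proof.
move=> /andP[p0 p1]; elim: m j => [|m IH] [|j]//=.
have := IH j; have := IH j.+1; nra.
Qed.

Lemma binlt_leS m j p : 0 <= p <= 1 -> binlt m j p <= binlt m j.+1 p.
Proof.
move=> /[dup] p01 /andP[p0 p1]; elim: m j => [|m IH] [|j]; rewrite ?binlt0 ?binlt_ge0//.
rewrite !binltS lerD// ler_wpM2l//; last by rewrite subr_ge0.
Qed.

Lemma binlt_dec m j p : 0 <= p <= 1 -> binlt m.+1 j p <= binlt m j p.
Proof.
move=> /[dup] p01 /andP[p0 p1]; case: j => [|j]; first by rewrite !binlt0.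
by rewrite binltS; have := binlt_leS m j p01; nra.
Qed.

Lemma binlt_homo m m' j p : 0 <= p <= 1 -> (m <= m')%N ->
  binlt m' j p <= binlt m j p.
Proof.
move=> p01 /subnK <-; elim: (m' - m)%N => //= k.
by apply: le_trans; exact: binlt_dec.
Qed.

(** A larger success probability puts more weight on the smaller of the two values [binlt m j] and
    [binlt m j.+1]. *)
Lemma binlt_anti m j p q : 0 <= p -> p <= q -> q <= 1 ->
  binlt m j q <= binlt m j p.
Proof.
move=> p0 pq q1; elim: m j => [|m IH] [|j]//; rewrite !binltS.
have p01 : 0 <= p <= 1 by rewrite p0 (le_trans pq).
have := IH j; have := IH j.+1; have := binlt_leS m j p01.
nra.
Qed.

(* The i-th term is the probability that trial i is a success preceded by fewer
   than j successes; there are at most j such trials. *)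
Lemma binlt_sum m j p : 0 <= p <= 1 ->
  \sum_(i < m) p * binlt i j p <= j%:R.
Proof.
move=> p01; elim: j => [|j IH].
  by rewrite big1// => i _; rewrite binlt0 mulr0.
rewrite (eq_bigr (fun i : 'I_m => p * binlt i j p +
    (binlt i j.+1 p - binlt i.+1 j.+1 p))); last first.
  by move=> i _; rewrite binltS; ring.
rewrite big_split/= -natr1 lerD//.
rewrite -(big_mkord xpredT (fun i => binlt i j.+1 p - binlt i.+1 j.+1 p)).
rewrite -[leLHS]opprK -sumrN.
under eq_bigr do rewrite opprB.
rewrite telescope_sumr// opprB.
have := binlt_ge0 m j.+1 p01; have := binlt_le1 0 j.+1 p01; lra.
Qed.

(** The terms of [binlt_sum] decrease with the number of trials, so the last of the first m + 1
    terms is at most their average. *)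
Lemma binlt_mul_le m j p : 0 <= p <= 1 -> p * binlt m j p <= j%:R / m.+1%:R.
Proof.
move=> /[dup] p01 /andP[p0 _]; rewrite ler_pdivlMr//.
apply: le_trans (binlt_sum m.+1 j p01).
rewrite mulr_natr -[X in _ *+ X]card_ord -sumr_const.
apply: ler_sum => i _; rewrite ler_wpM2l//.
by apply: binlt_homo => //; rewrite -ltnS.
Qed.

(** More trials only lower the probability, so take m = j. Fewer than j successes in j trials means
    that some trial fails, and the union bound applies. *)
Lemma binlt_full m j p : 0 <= p <= 1 -> (j <= m)%N ->
  binlt m j p <= j%:R * (1 - p).
Proof.
move=> /[dup] p01 /andP[p0 p1] jm; apply: le_trans (binlt_homo _ p01 jm) _.
elim: j {jm} => [|j IH]; first by rewrite binlt0 mul0r.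
have := binlt_ge0 j j p01; have := binlt_le1 j j.+1 p01.
by rewrite binltS -natr1; nra.
Qed.

End binomial_lower_tail.

Section poisson_lower_tail.
Context {R : realType}.
Implicit Types (m j : nat) (z : R).

(* The probability that a Poisson variable with parameter [z] is less than
   [j]. *)
Definition poislt j z : R := \sum_(k < j) z ^+ k / k`!%:R * expR (- z).

Lemma poislt0 z : poislt 0 z = 0.
Proof. by rewrite /poislt big_ord0. Qed.

Lemma poislt_at0 j : poislt j 0 = (0 < j)%:R :> R.
Proof.
case: j => [|j]; first by rewrite poislt0.
rewrite /poislt big_ord_recl/= oppr0 expR0 expr0 fact0 divr1 mulr1 big1 ?addr0//.
by move=> i _; rewrite expr0n/= mul0r mul0r.
Qed.

Lemma poisltS j z : poislt j.+1 z = poislt j z + z ^+ j / j`!%:R * expR (- z).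
Proof. by rewrite /poislt big_ord_recr. Qed.

Lemma poislt_ge0 j z : 0 <= z -> 0 <= poislt j z.
Proof.
by move=> z0; apply: sumr_ge0 => k _; rewrite !mulr_ge0 ?exprn_ge0 ?expR_ge0.
Qed.

Lemma poislt_leS j z : 0 <= z -> poislt j z <= poislt j.+1 z.
Proof.
by move=> z0; rewrite poisltS lerDl !mulr_ge0 ?exprn_ge0 ?expR_ge0.
Qed.

Lemma is_derive_expRN z : is_derive z 1 (fun z => expR (- z)) (- expR (- z)).
Proof.
apply: (is_derive_eq (is_derive1_comp (is_derive_expR (- z)) (is_deriveNid z 1))).
by rewrite /GRing.scale/= mulrN1.
Qed.

Lemma is_derive_poislt j z :
  is_derive z 1 (poislt j.+1) (- (z ^+ j / j`!%:R * expR (- z))).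
Proof.
elim: j => [|j IH].
  have -> : poislt 1 = (fun z => expR (- z)) :> (R -> R).
    apply/funext => y.
    by rewrite /poislt big_ord_recl big_ord0 fact0 expr0 divr1 mul1r addr0.
  rewrite fact0 expr0 divr1 mul1r; exact: is_derive_expRN.
have -> : poislt j.+2 = poislt j.+1 +
    (@GRing.exp R ^~ j.+1) * (fun z : R => (j.+1`!%:R^-1 * expR (- z))).
  by apply/funext => y; rewrite poisltS/= !fctE mulrA.
have h : is_derive z 1 (fun z : R => (j.+1`!%:R^-1 * expR (- z)))
    (j.+1`!%:R^-1 * - expR (- z)).
  exact: (is_deriveZ (j.+1`!%:R^-1 : R) (is_derive_expRN z)).
have hX : is_derive z 1 (@GRing.exp R ^~ j.+1) (j.+1%:R * z ^+ j).
  have := is_deriveX j.+1 (is_derive_id z (1 : R)).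
  rewrite (_ : id ^+ j.+1 = (@GRing.exp R ^~ j.+1)); last by apply/funext => y; rewrite fctE.
  by move=> /is_derive_eq; apply; rewrite /GRing.scale/= mulr1.
have := is_deriveD IH (is_deriveM hX h).
move=> /is_derive_eq; apply.
have fn0 : j`!%:R != 0 :> R by rewrite pnatr_eq0 -lt0n fact_gt0.
have jn0 : j.+1%:R != 0 :> R by rewrite pnatr_eq0.
rewrite /GRing.scale /= factS natrM invfM exprS.
field.
by rewrite fn0 nat1r jn0.
Qed.

Lemma continuous_poislt j : continuous (poislt j).
Proof.
move=> z; case: j => [|j]; last first.
  have [+ _] := is_derive_poislt j z.
  by move=> /derivable1_diffP/differentiable_continuous.
rewrite (_ : poislt 0 = cst 0); last by apply/funext => y; rewrite poislt0.
exact: cst_continuous.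
Qed.

(** The derivative is written as a difference of two consecutive tails because this is the shape of
    the recursion of [binlt]. *)
Lemma MVT_poislt j y z : 0 <= y <= z -> exists2 c, y <= c <= z &
  poislt j.+1 z - poislt j.+1 y = (poislt j c - poislt j.+1 c) * (z - y).
Proof.
move=> /andP[y0 yz].
have [c] := @MVT_segment R (poislt j.+1)
  (fun z => - (z ^+ j / j`!%:R * expR (- z))) y z yz
  (fun x _ => is_derive_poislt j x)
  (continuous_subspaceT (@continuous_poislt j.+1)).
rewrite in_itv/= => ycz ->; exists c => //.
by rewrite poisltS opprD addrA subrr sub0r.
Qed.

Lemma poislt_le1 j z : 0 <= z -> poislt j z <= 1.
Proof.
move=> z0; case: j => [|j]; first by rewrite poislt0.
have [|c /andP[c0 _]] := @MVT_poislt j 0 z; first by rewrite lexx.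
rewrite poislt_at0/= subr0 => /eqP; rewrite subr_eq => /eqP ->.
rewrite gerDr; have := poislt_leS j c0; nra.
Qed.

(** The derivative is a difference of two numbers of [0, 1], which gives the constant 1. *)
Lemma poislt_lipschitz j y z : 0 <= y -> 0 <= z ->
  `|poislt j z - poislt j y| <= `|z - y|.
Proof.
wlog yz : y z / y <= z => [hw y0 z0|].
  by have [/hw/(_ y0 z0)//|/ltW/hw/(_ z0 y0)] := leP y z; rewrite distrC (distrC z).
case: j => [|j] y0 z0; first by rewrite !poislt0 subrr normr0.
have [|c /andP[yc cz] ->] := @MVT_poislt j y z; first by rewrite y0.
have c0 := le_trans y0 yc.
rewrite normrM ler_piMl//.
have := poislt_leS j c0; have := poislt_le1 j.+1 c0; have := poislt_ge0 j c0.
by rewrite ler_norml; lra.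
Qed.

(* The difference equation of [binlt] is the explicit Euler scheme for
   [poislt j.+1 z]' = poislt j z - poislt j.+1 z. *)
Lemma binlt_poislt m j p : 0 <= p <= 1 ->
  `|binlt m j p - poislt j (m%:R * p)| <= 2 * m%:R * p ^+ 2.
Proof.
move=> /[dup] p01 /andP[p0 p1]; elim: m j => [|m IH] j.
  by rewrite mul0r poislt_at0/= subrr normr0 mulr0 mul0r.
case: j => [|j]; first by rewrite binlt0 poislt0 subrr normr0 !mulr_ge0 ?exprn_ge0.
have -> : m.+1%:R * p = m%:R * p + p by rewrite -natr1; ring.
have mp0 : 0 <= m%:R * p by rewrite mulr_ge0.
have [|c /andP[yc cz] E] := @MVT_poislt j (m%:R * p) (m%:R * p + p).
  by rewrite mp0 lerDl.
have c0 := le_trans mp0 yc.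
(* The first two terms are the inherited errors, combined with weights p and 1 - p. The third is the
   local error of one Euler step: c lies within p of m p and [poislt] is 1-Lipschitz, so it is at
   most 2 p^2. *)
rewrite (_ : binlt _ _ _ - _ = p * (binlt m j p - poislt j (m%:R * p)) +
  (1 - p) * (binlt m j.+1 p - poislt j.+1 (m%:R * p)) +
  p * ((poislt j (m%:R * p) - poislt j c) -
       (poislt j.+1 (m%:R * p) - poislt j.+1 c))); last first.
  move/eqP: E; rewrite subr_eq => /eqP ->; rewrite binltS; ring.
have := IH j; have := IH j.+1.
have := poislt_lipschitz j c0 mp0; have := poislt_lipschitz j.+1 c0 mp0.
rewrite (@ler0_norm _ (m%:R * p - c)) ?subr_le0//.
rewrite -[m.+1%:R]natr1.
set A := poislt j _ - _; set B := poislt j.+1 _ - _.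
set C := binlt _ _ _ - _; set D := binlt _ _ _ - _.
rewrite !ler_norml => /andP[B1 B2] /andP[A1 A2] /andP[D1 D2] /andP[C1 C2].
have : 0 <= p ^+ 2 by rewrite exprn_ge0.
have : p * A <= p * p by nra.
have : p * B <= p * p by nra.
have : - (p * p) <= p * A by nra.
have : - (p * p) <= p * B by nra.
rewrite -!expr2 => *.
by apply/andP; split; nra.
Qed.

Lemma cvg_poislt_pinfty j : poislt j z @[z --> +oo] --> (0 : R).
Proof.
apply/cvgrPdist_le => e e0; near=> z.
have z0 : 0 < z by near: z; exact: nbhs_pinfty_gt.
rewrite sub0r normrN ger0_norm; last exact/poislt_ge0/ltW.
(* Since expR z >= z^(k+1) / (k+1)!, the k-th term is at most (k + 1) / z. This threshold makes each
   of the j + 1 terms at most e / (j + 1). *)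
have zj : (j.+1%:R * j.+1%:R / e) <= z.
  near: z; apply: nbhs_pinfty_ge; exact: num_real.
have -> : e = \sum_(k < j.+1) e / j.+1%:R.
  by rewrite sumr_const card_ord -[RHS]mulr_natr divfK// pnatr_eq0.
apply: (le_trans (poislt_leS j (ltW z0))).
apply: ler_sum => k _; rewrite expRN ler_pdivrMr ?expR_gt0//.
apply: (le_trans _ (ler_wpM2l _ (expR_ge1Dxn k (ltW z0)))); last first.
  by rewrite divr_ge0// ltW.
have zk : (k.+1%:R * j.+1%:R / e) <= z.
  apply: le_trans zj; rewrite ler_pM2r ?invr_gt0// ler_pM2r ?ltr0n// ler_nat.
  exact: ltn_ord.
rewrite factS natrM invfM exprS.
have kf : 0 < k`!%:R :> R by rewrite ltr0n fact_gt0.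
rewrite mulrDr mulr1 -[leLHS]add0r; apply: lerD; first by rewrite divr_ge0// ltW.
have k1 : 0 < k.+1%:R :> R by rewrite ltr0n.
have j1 : 0 < j.+1%:R :> R by rewrite ltr0n.
rewrite [leRHS](_ : _ = (e / j.+1%:R * z / k.+1%:R) * (z ^+ k / k`!%:R)); last first.
  by field; rewrite ?nat1r ?gt_eqF.
apply: ler_peMl; first by rewrite divr_ge0 ?exprn_ge0// ltW.
rewrite ler_pdivlMr// mul1r mulrAC ler_pdivlMr// mulrC -ler_pdivrMr//.
by rewrite ler_pdivrMr// [leLHS]mulrC [leRHS]mulrC -ler_pdivrMr.
Unshelve. all: by end_near. Qed.

Lemma continuous_poisson_dens j :
  continuous (fun t : R => t ^+ j / j`!%:R * expR (- t)).
Proof.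
move=> x; apply: cvgM.
  by apply: cvgM; [exact: exprn_continuous|exact: cvg_cst].
by apply: continuous_comp; [exact: opp_continuous|exact: continuous_expR].
Qed.

(** The integrand is the gamma density of shape j + 1, and [- poislt j.+1] is an antiderivative of
    it that vanishes at infinity. *)
Lemma integral_poislt_dens j z : 0 <= z ->
  (\int[lebesgue_measure]_(t in `[z, +oo[) (t ^+ j / j`!%:R * expR (- t))%:E =
   (poislt j.+1 z)%:E)%E.
Proof.
move=> z0.
rewrite (@ge0_continuous_FTC2y _ _ (- poislt j.+1) z 0).
- by rewrite fctE EFinN oppeK add0e.
- move=> x zx; have x0 := le_trans z0 zx.
  by rewrite !mulr_ge0 ?exprn_ge0 ?expR_ge0.
- apply: continuous_subspaceT; exact: continuous_poisson_dens.
- by rewrite -oppr0; apply: cvgN; exact: cvg_poislt_pinfty.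
- by move=> x _; apply: derivableN; have [] := is_derive_poislt j x.
- by apply: cvgN; apply: cvg_at_right_filter; exact: continuous_poislt.
- move=> x _; rewrite derive1E.
  by have [_ ->] := is_deriveN (is_derive_poislt j x); rewrite opprK.
Qed.

End poisson_lower_tail.

Lemma measurable_bool_natr {R : realType} dT (T : measurableType dT) (A : set T)
    (b : T -> bool) :
  measurable_fun A b -> measurable_fun A (fun x => (b x)%:R : R).
Proof. exact: (measurableT_comp (f := fun b : bool => (b%:R : R))). Qed.

Lemma measurable_set_bool dT (T : measurableType dT) (b : T -> bool) :
  measurable_fun setT b -> measurable [set w | b w].
Proof. by move=> mb; rewrite -[X in measurable X]setTI; exact: (mb measurableT [set true]). Qed.

Lemma powR_inv_le {R : realType} (a x y : R) : 0 < a -> 0 <= x -> 0 <= y ->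
  (x `^ a^-1 <= y) = (x <= y `^ a).
Proof.
move=> a0 x0 y0; have an0 : a != 0 by rewrite gt_eqF.
apply/idP/idP => h.
  rewrite -[leLHS](powRr1 x0) -(mulVf an0) powRrM.
  by rewrite ge0_ler_powR ?nnegrE ?powR_ge0 ?(ltW a0).
rewrite -[leRHS](powRr1 y0) -(mulfV an0) powRrM.
by rewrite ge0_ler_powR ?nnegrE ?powR_ge0 ?invr_ge0 ?(ltW a0).
Qed.

(** * Change of variables and layers on the real line *)

Section real_line.
Context {R : realType}.
Local Open Scope ereal_scope.
Implicit Types (g : R -> \bar R).

(** The pushforward of Lebesgue measure by a translation has the same values on half-open intervals,
    which determine the measure. *)
Lemma ge0_integral_lebesgue_shift (a : R) g : measurable_fun setT g ->
  (forall x, 0 <= g x) ->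
  \int[lebesgue_measure]_x g (x + a)%R = \int[lebesgue_measure]_x g x.
Proof.
move=> mg g0.
have ms : measurable_fun setT ((fun x => x + a)%R : _ -> measurableTypeR R).
  by apply: measurable_funD => //; exact: measurable_cst.
rewrite -[LHS](@ge0_integral_pushforward _ _ (measurableTypeR R) (measurableTypeR R)
  R _ ms lebesgue_measure setT g measurableT)//.
apply: eq_measure_integral => A mA _.
apply/esym/lebesgue_measure_unique => //= _ [[b c]] _ <-.
rewrite /pushforward/= (_ : _ @^-1` _ = `](b - a)%R, (c - a)%R]%classic).
  rewrite !lebesgue_measure_itv/= !lte_fin ltrD2r.
  by congr (if _ then _ else _); rewrite -!EFinB; congr EFin; ring.
by apply/seteqP; split => x/=; rewrite !in_itv/= ltrBlDr lerBrDr.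
Qed.

Lemma ge0_integral_lebesgue_scale (r : R) g : (0 < r)%R ->
  measurable_fun setT g -> (forall x, 0 <= g x) ->
  r%:E * \int[lebesgue_measure]_x g (r * x)%R = \int[lebesgue_measure]_x g x.
Proof.
move=> r0 mg g0.
have ms : measurable_fun setT ((fun x => r * x)%R : _ -> measurableTypeR R).
  exact: mulrl_measurable.
rewrite -[X in _ * X](@ge0_integral_pushforward _ _ (measurableTypeR R) (measurableTypeR R)
  R _ ms lebesgue_measure setT g measurableT)//.
have r0' : (0 <= r)%R by exact: ltW.
rewrite -[r]/(NngNum r0')%:num.
rewrite -ge0_integral_mscale//.
apply: eq_measure_integral => A mA _.
apply/esym/lebesgue_measure_unique => //= _ [[b c]] _ <-.
rewrite /mscale/= /pushforward/= (_ : _ @^-1` _ = `](b / r)%R, (c / r)%R]%classic).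
  rewrite !lebesgue_measure_itv/= !lte_fin ltr_pM2r ?invr_gt0//.
  case: ifPn => _; last by rewrite mule0.
  by rewrite -!EFinB -EFinM; congr EFin; field; rewrite gt_eqF.
by apply/seteqP; split => x/=; rewrite !in_itv/= ltr_pdivrMr// ler_pdivlMr// mulrC.
Qed.

Lemma layer_cake (y : R) : (0 <= y)%R ->
  \int[lebesgue_measure]_(v in `[0%R, +oo[) (v < y)%R%:R%:E = y%:E.
Proof.
move=> y0.
transitivity (\int[lebesgue_measure]_(v in `[0%R, +oo[) (\1_(`[0%R, y[%classic) v)%:E).
  apply: eq_integral => v; rewrite inE/= in_itv/= andbT => v0.
  by rewrite indicE mem_setE in_itv/= v0.
rewrite integral_indic// setIidl; last first.
  by move=> x /=; rewrite !in_itv/= andbT => /andP[].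
by rewrite [LHS]lebesgue_measure_itv/= lte_fin sube0; case: ltgtP y0 => // <-.
Qed.

End real_line.

(** * Lebesgue measure and balls in R^d *)

Section lebesgue_tuple_theory.
Context {R : realType}.
Local Open Scope ereal_scope.
Local Notation leb := (@lebesgue_tuple R _).

Lemma ge0_integral_lebesgue_tupleS d (g : d.+1.-tuple R -> \bar R) :
  measurable_fun setT g -> (forall x, 0 <= g x) ->
  \int[leb]_x g x =
  \int[lebesgue_measure]_t \int[leb]_y g (tuple_cons (t, y)).
Proof.
move=> mg g0.
transitivity (\int[lebesgue_measure \x leb]_p g (tuple_cons p)).
  rewrite -[RHS](@ge0_integral_pushforward _ _
    ((measurableTypeR R * d.-tuple R)%type : measurableType _)
    (d.+1.-tuple R) R _ (@measurable_tuple_cons R d)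
    (lebesgue_measure \x leb) setT g measurableT)//.
rewrite fubini_tonelli1//.
by apply: measurableT_comp => //; exact: measurable_tuple_cons.
Qed.

Definition taddt d (x h : d.-tuple R) : d.-tuple R :=
  [tuple tnth x i + tnth h i | i < d]%R.

Definition tscale d (r : R) (x : d.-tuple R) : d.-tuple R :=
  [tuple r * tnth x i | i < d]%R.

Lemma tadd_cons d (t s : R) (x h : d.-tuple R) :
  taddt (tuple_cons (t, x)) (tuple_cons (s, h)) = tuple_cons (t + s, taddt x h)%R.
Proof.
apply: eq_from_tnth => i; rewrite tnth_mktuple.
case: (unliftP ord0 i) => [k ->|->]; last by rewrite !tnth0.
by rewrite !tnthS tnth_mktuple.
Qed.

Lemma tscale_cons d (r t : R) (x : d.-tuple R) :
  tscale r (tuple_cons (t, x)) = tuple_cons (r * t, tscale r x)%R.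
Proof.
apply: eq_from_tnth => i; rewrite tnth_mktuple.
case: (unliftP ord0 i) => [k ->|->]; last by rewrite !tnth0.
by rewrite !tnthS tnth_mktuple.
Qed.

Lemma measurable_taddt d dT (T : measurableType dT) (F G : T -> d.-tuple R) :
  measurable_fun setT F -> measurable_fun setT G ->
  measurable_fun setT (fun x => taddt (F x) (G x)).
Proof.
move=> mF mG; apply/measurable_fun_tnthP => i.
rewrite (_ : _ \o _ = fun x => tnth (F x) i + tnth (G x) i)%R; last first.
  by apply/funext => x /=; rewrite tnth_mktuple.
by apply: measurable_funD; exact: (measurableT_comp (measurable_tnth i)).
Qed.

Lemma measurable_tscale d dT (T : measurableType dT) (r : T -> R) (F : T -> d.-tuple R) :
  measurable_fun setT r -> measurable_fun setT F ->
  measurable_fun setT (fun x => tscale (r x) (F x)).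
Proof.
move=> mr mF; apply/measurable_fun_tnthP => i.
rewrite (_ : _ \o _ = fun x => r x * tnth (F x) i)%R; last first.
  by apply/funext => x /=; rewrite tnth_mktuple.
by apply: measurable_funM => //; exact: (measurableT_comp (measurable_tnth i)).
Qed.

Lemma tuple_consP d (x : d.+1.-tuple R) :
  exists t y, x = tuple_cons (t, y).
Proof.
exists (thead x), [tuple of behead x].
by rewrite /tuple_cons {1}(tuple_eta x).
Qed.

Lemma measurable_cons1 d (t : R) :
  measurable_fun setT (fun y : d.-tuple R => tuple_cons (t, y)).
Proof.
apply: (measurableT_comp (@measurable_tuple_cons R d)).
exact: pair1_measurable.
Qed.

Lemma measurable_integral_cons d (g : d.+1.-tuple R -> \bar R) :
  measurable_fun setT g -> (forall x, 0 <= g x) ->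
  measurable_fun setT (fun t => \int[leb]_y g (tuple_cons (t, y))).
Proof.
move=> mg g0.
apply: (@measurable_fun_fubini_tonelli_F _ _ _ _ _ leb (g \o @tuple_cons R d)) => //=.
by apply: measurableT_comp => //; exact: measurable_tuple_cons.
Qed.

Lemma ge0_integral_shift d (h : d.-tuple R) (g : d.-tuple R -> \bar R) :
  measurable_fun setT g -> (forall x, 0 <= g x) ->
  \int[leb]_x g (taddt x h) = \int[leb]_x g x.
Proof.
elim: d h g => [|d IH] h g mg g0.
  by apply: eq_integral => x _; rewrite (tuple0 x) (tuple0 (taddt _ _)).
have [s [k ->]] := tuple_consP h.
rewrite ge0_integral_lebesgue_tupleS//; last first.
  by apply: (measurableT_comp mg); apply: measurable_taddt => //.
rewrite (ge0_integral_lebesgue_tupleS mg g0).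
under eq_integral => t _ do under eq_integral do rewrite tadd_cons.
transitivity (\int[lebesgue_measure]_t \int[leb]_y g (tuple_cons (t + s, y)%R)).
  apply: eq_integral => t _.
  rewrite (IH k (fun y => g (tuple_cons (t + s, y)%R)))//.
  by apply: (measurableT_comp mg); exact: measurable_cons1.
rewrite (ge0_integral_lebesgue_shift s (g := fun t => \int[leb]_y g (tuple_cons (t, y)%R)))//.
  exact: measurable_integral_cons.
by move=> t; exact: integral_ge0.
Qed.

Lemma ge0_integral_scale d (r : R) (g : d.-tuple R -> \bar R) : (0 < r)%R ->
  measurable_fun setT g -> (forall x, 0 <= g x) ->
  (r ^+ d)%:E * \int[leb]_x g (tscale r x) = \int[leb]_x g x.
Proof.
move=> r0; elim: d g => [|d IH] g mg g0.
  by rewrite expr0 mul1e; apply: eq_integral => x _; rewrite (tuple0 x) (tuple0 (tscale _ _)).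
rewrite ge0_integral_lebesgue_tupleS//; last first.
  by apply: (measurableT_comp mg); apply: measurable_tscale => //.
rewrite (ge0_integral_lebesgue_tupleS mg g0).
under eq_integral => t _ do under eq_integral do rewrite tscale_cons.
rewrite exprSr EFinM -muleA.
rewrite -(ge0_integral_lebesgue_scale r0 (g := fun t => \int[leb]_y g (tuple_cons (t, y)%R)))//; last 2 first.
- exact: measurable_integral_cons.
- by move=> t; exact: integral_ge0.
rewrite muleCA; congr (_ * _).
rewrite -ge0_integralZl//; last 3 first.
- apply: (@measurable_fun_fubini_tonelli_F _ _ _ _ _ leb (fun p => g (tuple_cons (r * p.1, tscale r p.2)%R))) => //=.
  apply: (measurableT_comp mg).
  apply: (measurableT_comp (@measurable_tuple_cons R d)).
  apply/measurable_fun_pairP; split => /=.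
    by apply: measurable_funM => //; exact: measurable_fst.
  by apply: measurable_tscale => //; exact: measurable_snd.
- by move=> t _; exact: integral_ge0.
- by rewrite lee_fin exprn_ge0// ltW.
apply: eq_integral => t _.
rewrite (IH (fun y => g (tuple_cons (r * t, y)%R)))//.
by apply: (measurableT_comp mg); exact: measurable_cons1.
Qed.

End lebesgue_tuple_theory.

Section euclidean_theory.
Context {R : realType} {d : nat}.
Implicit Types (x y z h : d.-tuple R) (r : R).

Lemma enorm_ge0 x : 0 <= enorm x.
Proof. exact: sqrtr_ge0. Qed.

Lemma enorm_sqr x : enorm x ^+ 2 = \sum_(i < d) tnth x i ^+ 2.
Proof. by rewrite sqr_sqrtr// sumr_ge0// => i _; rewrite sqr_ge0. Qed.

Lemma ler_tnth_enorm x i : `|tnth x i| <= enorm x.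
Proof.
rewrite -(@ler_pXn2r _ 2)// ?nnegrE ?enorm_ge0//.
rewrite enorm_sqr (bigD1 i)//= real_normK ?num_real// lerDl.
by rewrite sumr_ge0// => j _; rewrite sqr_ge0.
Qed.

(** Expand the squared norm of |y| x - |x| y, which is nonnegative, and divide by 2 |x| |y|; the
    degenerate cases are treated apart. *)
Lemma enorm_cauchy_schwarz x y :
  \sum_(i < d) tnth x i * tnth y i <= enorm x * enorm y.
Proof.
have [x0|x0] := eqVneq (enorm x) 0.
  rewrite x0 mul0r big1// => i _.
  have := ler_tnth_enorm x i; rewrite x0 normr_le0 => /eqP ->.
  by rewrite mul0r.
have [y0|y0] := eqVneq (enorm y) 0.
  rewrite y0 mulr0 big1// => i _.
  have := ler_tnth_enorm y i; rewrite y0 normr_le0 => /eqP ->.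
  by rewrite mulr0.
have xp : 0 < enorm x by rewrite lt_neqAle eq_sym x0 enorm_ge0.
have yp : 0 < enorm y by rewrite lt_neqAle eq_sym y0 enorm_ge0.
have : 0 <= \sum_(i < d) (enorm y * tnth x i - enorm x * tnth y i) ^+ 2.
  by rewrite sumr_ge0// => i _; rewrite sqr_ge0.
under eq_bigr do rewrite sqrrB !exprMn.
rewrite big_split/= sumrB -!mulr_sumr -!enorm_sqr.
rewrite (eq_bigr (fun i => (2 * (enorm x * enorm y)) *
  (tnth x i * tnth y i))); last by move=> i _; ring.
rewrite -mulr_sumr => H.
have xy0 : 0 < 2 * (enorm x * enorm y) by rewrite !mulr_gt0.
by rewrite -(ler_pM2l xy0); nra.
Qed.

Lemma enorm_taddt x y : enorm (taddt x y) <= enorm x + enorm y.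
Proof.
rewrite -(@ler_pXn2r _ 2)// ?nnegrE ?addr_ge0 ?enorm_ge0// enorm_sqr.
under eq_bigr do rewrite tnth_mktuple sqrrD.
rewrite 2!big_split/= sqrrD !enorm_sqr lerD2r lerD2l.
under eq_bigr do rewrite -mulr_natr.
by rewrite -mulr_suml -[leRHS]mulr_natr ler_wpM2r// enorm_cauchy_schwarz.
Qed.

Lemma edist_ge0 x y : 0 <= edist x y.
Proof. exact: enorm_ge0. Qed.

Lemma edistC x y : edist x y = edist y x.
Proof.
rewrite /edist /enorm; congr Num.sqrt; apply: eq_bigr => i _.
by rewrite !tnth_mktuple -sqrrN opprB.
Qed.

Lemma edistxx x : edist x x = 0.
Proof.
rewrite /edist /enorm big1 ?sqrtr0// => i _.
by rewrite tnth_mktuple subrr expr0n.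
Qed.

Lemma edist_triangle y x z : edist x z <= edist x y + edist y z.
Proof.
rewrite (le_trans _ (enorm_taddt _ _))// /edist.
rewrite le_eqVlt; apply/orP; left; apply/eqP; congr enorm.
by apply: eq_from_tnth => i; rewrite !tnth_mktuple; ring.
Qed.

Lemma edist_eq0 x y : edist x y = 0 -> x = y.
Proof.
move=> xy; apply: eq_from_tnth => i.
have := ler_tnth_enorm [tuple tnth x i - tnth y i | i < d] i.
by rewrite tnth_mktuple -/(edist x y) xy normr_le0 subr_eq0 => /eqP.
Qed.

Lemma enormE x : enorm x = edist x [tuple 0 | i < d].
Proof.
congr enorm; apply: eq_from_tnth => i.
by rewrite !tnth_mktuple subr0.
Qed.

Lemma edist_taddt x h : edist x (taddt x h) = enorm h.
Proof.
rewrite edistC; congr enorm; apply: eq_from_tnth => i.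
by rewrite !tnth_mktuple addrAC subrr add0r.
Qed.

Lemma enorm_tscale r x : 0 <= r -> enorm (tscale r x) = r * enorm x.
Proof.
move=> r0; rewrite {1}/enorm.
under eq_bigr do rewrite tnth_mktuple exprMn.
by rewrite -mulr_sumr sqrtrM ?sqr_ge0// sqrtr_sqr ger0_norm.
Qed.

(** Dividing by d rather than by its square root is wasteful but enough: d (r / d)^2 = r^2 / d <=
    r^2. *)
Lemma edist_le_coord x y r : 0 <= r ->
  (forall i, `|tnth x i - tnth y i| <= r / d%:R) -> edist x y <= r.
Proof.
move=> r0 xy; rewrite -(@ler_pXn2r _ 2)// ?nnegrE ?edist_ge0// enorm_sqr.
have [d0|d0] := posnP d.
  rewrite big1 ?sqr_ge0// => i _.
  by have := ltn_ord i; rewrite [X in (_ < X)%N]d0.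
have dn0 : d%:R != 0 :> R by rewrite pnatr_eq0 -lt0n.
have d1 : 1 <= d%:R :> R by rewrite ler1n.
apply: (@le_trans _ _ (\sum_(i < d) (r / d%:R) ^+ 2)).
  apply: ler_sum => i _; rewrite tnth_mktuple -real_normK ?num_real//.
  by rewrite ler_pXn2r ?nnegrE// divr_ge0.
rewrite sumr_const card_ord -mulr_natr exprMn.
rewrite [leLHS](_ : _ = r ^+ 2 / d%:R); last by field.
by rewrite ler_pdivrMr ?(lt_le_trans _ d1)// ler_peMr// sqr_ge0.
Qed.

Lemma measurable_enorm : measurable_fun setT (@enorm R d).
Proof.
apply: (@measurableT_comp _ _ _ _ _ _ (@Num.sqrt R)).
  by apply: continuous_measurable_fun; exact: sqrt_continuous.
apply: measurable_sum => i.
by apply: measurable_funX; exact: measurable_tnth.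
Qed.

Lemma measurable_edist dT (T : measurableType dT) (F G : T -> d.-tuple R) :
  measurable_fun setT F -> measurable_fun setT G ->
  measurable_fun setT (fun t => edist (F t) (G t)).
Proof.
move=> mF mG.
apply: (measurableT_comp measurable_enorm); apply/measurable_fun_tnthP => i.
rewrite (_ : _ \o _ = fun t => tnth (F t) i - tnth (G t) i); last first.
  by apply/funext => t /=; rewrite tnth_mktuple.
by apply: measurable_funB; exact: (measurableT_comp (measurable_tnth i)).
Qed.

End euclidean_theory.

Section ball_volume.
Context {R : realType}.
Local Open Scope ereal_scope.
Local Notation leb := (@lebesgue_tuple R _).

Definition eball d (x : d.-tuple R) (r : R) : set (d.-tuple R) :=
  [set y | (edist x y <= r)%R].

Lemma measurable_eball d (x : d.-tuple R) r : measurable (eball x r).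
Proof.
rewrite -[X in measurable X]setTI.
by apply: (measurable_fun_le (f := edist x)) => //; exact: measurable_edist.
Qed.

Lemma lebesgue_tuple_set1 d (x : d.+1.-tuple R) : leb [set x] = 0.
Proof.
pose A := [tuple [set tnth x i] | i < d.+1].
rewrite (_ : [set x] = [set y | forall i, tnth A i (tnth y i)]).
  rewrite lebesgue_tuple_box; last by move=> i; rewrite tnth_mktuple.
  rewrite big_ord_recl tnth_mktuple lebesgue_measure_set1 mul0e//.
apply/seteqP; split => [y -> i|y H]; first by rewrite tnth_mktuple.
by apply: eq_from_tnth => i; have := H i; rewrite tnth_mktuple.
Qed.

Definition unit_ball_measure d : \bar R := leb (eball [tuple 0%R | i < d] 1).

Lemma lebesgue_eball d (x : d.+1.-tuple R) r : (0 <= r)%R ->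
  leb (eball x r) = (r ^+ d.+1)%:E * unit_ball_measure d.+1.
Proof.
(* Scaling needs a positive radius. A ball of radius 0 is a single point, which is null because the
   dimension is positive. *)
rewrite le_eqVlt => /predU1P[<-|r0].
  rewrite expr0n mul0e (_ : eball x 0 = [set x]) ?lebesgue_tuple_set1//.
  apply/seteqP; split => [y /= xy|y ->]; last by rewrite /eball/= edistxx.
  by apply/esym/edist_eq0/eqP; rewrite eq_le edist_ge0 andbT.
have indic_ge0 (A : set (d.+1.-tuple R)) z : 0 <= (\1_A z)%:E :> \bar R by rewrite lee_fin.
have mE (z : d.+1.-tuple R) s : measurable_fun setT (fun y => (\1_(eball z s) y)%:E : \bar R).
  by apply/measurable_EFinP; apply: measurable_indic; exact: measurable_eball.
rewrite /unit_ball_measure -[eball x r]setIT -[eball _ 1]setIT.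
do 2 (rewrite -integral_indic//; last exact: measurable_eball).
rewrite -(ge0_integral_shift x (mE _ _))// -(ge0_integral_scale r0)//; last first.
  by apply: (measurableT_comp (mE _ _)); apply: measurable_taddt.
congr (_ * _); apply: eq_integral => y _; congr EFin; rewrite !indicE; congr ((nat_of_bool _)%:R).
have E : (r * enorm y = edist x (taddt (tscale r y) x))%R.
  rewrite -enorm_tscale ?ltW// -(edist_taddt x); congr edist.
  by apply: eq_from_tnth => i; rewrite !tnth_mktuple addrC.
by apply/idP/idP; rewrite !inE /eball/= -E (edistC _ y) -enormE ger_pMr.
Qed.

Lemma integral_gauss_tuple d :
  \int[leb]_x (expR (- @enorm R d x ^+ 2))%:E = (Num.sqrt pi ^+ d)%:E.
Proof.
elim: d => [|d IH].
  rewrite expr0 [LHS](@integral_dirac _ (0.-tuple R) [tuple] R setT)//=; last first.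
    apply/measurable_EFinP; apply: measurableT_comp => //.
    by apply: measurableT_comp => //; apply: measurable_funX; exact: measurable_enorm.
  by rewrite diracT mul1e /enorm big_ord0 sqrtr0 expr0n/= oppr0 expR0.
rewrite ge0_integral_lebesgue_tupleS; last 2 first.
- apply/measurable_EFinP; apply: measurableT_comp => //.
  by apply: measurableT_comp => //; apply: measurable_funX; exact: measurable_enorm.
- by move=> x; rewrite lee_fin expR_ge0.
transitivity (\int[lebesgue_measure]_t ((expR (- t ^+ 2))%:E * (Num.sqrt (pi : R) ^+ d)%:E)).
  apply: eq_integral => t _.
  rewrite -IH -ge0_integralZl//.
  - apply: eq_integral => y _; rewrite -EFinM -expRD; congr (expR _)%:E.
    rewrite !enorm_sqr big_ord_recl tnth0 opprD; congr (- _ - _)%R.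
    by apply: eq_bigr => i _; rewrite tnthS.
  - apply/measurable_EFinP; apply: measurableT_comp => //.
    by apply: measurableT_comp => //; apply: measurable_funX; exact: measurable_enorm.
rewrite ge0_integralZr//.
- by rewrite [X in X * _]integralT_gauss -EFinM exprS.
- apply/measurable_EFinP; apply: (@measurableT_comp _ _ _ _ _ _ (@expR R)) => //.
  by apply: (@measurableT_comp _ _ _ _ _ _ (-%R : R -> R)) => //; exact: measurable_funX.
Qed.

Lemma expRN_tail (z : R) : (0 <= z)%R ->
  \int[lebesgue_measure]_t ((z <= t)%R%:R * expR (- t))%:E = (expR (- z))%:E.
Proof.
move=> z0; transitivity (poislt 1 z)%:E; last first.
  by rewrite /poislt big_ord_recl big_ord0 fact0 expr0 divr1 mul1r addr0.
rewrite -integral_poislt_dens// [RHS]integral_mkcond.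
apply: eq_integral => t _; rewrite patchE mem_setE in_itv/= andbT.
by case: ifP => _; rewrite ?mul0r// expr0 fact0 divr1 mul1r.
Qed.

(** The extended integral of which [Gamma] is the real part [fine]. Finiteness has to be proved
    before the two can be identified. *)
Definition Gammae (a : R) : \bar R :=
  \int[lebesgue_measure]_(t in `]0%R, +oo[) (t `^ (a - 1) * expR (- t))%:E.

Lemma sqrtr_expn_powR (t : R) d : (0 < t)%R ->
  (Num.sqrt t ^+ d = t `^ (1 + d%:R / 2 - 1))%R.
Proof.
move=> t0; rewrite -powR12_sqrt ?ltW// -powR_mulrn ?powR_ge0// -powRrM.
by congr (_ `^ _)%R; rewrite addrAC subrr add0r mulrC.
Qed.

Lemma measurable_powR_expR (a : R) (D : set R) :
  measurable_fun D (fun t : R => t `^ (a - 1) * expR (- t))%R.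
Proof.
apply: measurable_funTS; apply: measurable_funM; first exact: measurable_powR.
by apply: measurableT_comp => //; exact: measurable_expR.
Qed.

(* Both sides are the Gaussian integral: expR (- |x|^2) is written as the
   integral of expR (- t) over t >= |x|^2. *)
Lemma unit_ball_measure_Gammae d :
  unit_ball_measure d.+1 * Gammae (1 + d.+1%:R / 2) = (Num.sqrt pi ^+ d.+1)%:E.
Proof.
rewrite -integral_gauss_tuple.
pose G (p : d.+1.-tuple R * measurableTypeR R) : \bar R :=
  ((enorm p.1 ^+ 2 <= p.2)%R%:R * expR (- p.2))%:E.
have mG : measurable_fun setT G.
  apply/measurable_EFinP; apply: measurable_funM; last first.
    apply: (@measurableT_comp _ _ _ _ _ _ (@expR R)) => //.
    by apply: (@measurableT_comp _ _ _ _ _ _ (-%R : R -> R)) => //; exact: measurable_snd.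
  apply: measurable_bool_natr.
  apply: measurable_fun_ler; last exact: measurable_snd.
  apply: measurable_funX; apply: (measurableT_comp (@measurable_enorm R d.+1)).
  exact: measurable_fst.
have G0 p : 0 <= G p by rewrite lee_fin mulr_ge0// expR_ge0.
transitivity (\int[leb]_x \int[lebesgue_measure]_t G (x, t)); last first.
  by apply: eq_integral => x _; rewrite -expRN_tail// sqr_ge0.
rewrite (fubini_tonelli _ mG)//.
rewrite /Gammae -ge0_integralZl//; last 2 first.
- by apply/measurable_EFinP; exact: measurable_powR_expR.
- by move=> t _; rewrite lee_fin mulr_ge0 ?powR_ge0 ?expR_ge0.
rewrite [LHS]integral_mkcond; apply: eq_integral => t _.
rewrite patchE mem_setE in_itv/= andbT.
rewrite /G; under [RHS]eq_integral do rewrite mulrC EFinM /=.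
rewrite [RHS]ge0_integralZl//; last first.
  apply/measurable_EFinP.
  apply: measurable_bool_natr.
  by apply: measurable_fun_ler => //; apply: measurable_funX; exact: measurable_enorm.
have [t0|t0] := ltP t 0%R.
  rewrite ltNge (ltW t0)/= integral0_eq ?mule0// => x _.
  by rewrite leNgt (lt_le_trans t0) ?sqr_ge0.
rewrite [X in _ = _ * X](_ : _ = (Num.sqrt t ^+ d.+1)%:E * unit_ball_measure d.+1); last first.
  rewrite -(lebesgue_eball [tuple 0%R | i < d.+1]) ?sqrtr_ge0//.
  rewrite -[X in leb X]setIT -integral_indic//; last exact: measurable_eball.
  apply: eq_integral => x _; rewrite indicE; congr ((nat_of_bool _)%:R%:E).
  rewrite -[in LHS](sqr_sqrtr t0) ler_pXn2r ?nnegrE ?enorm_ge0 ?sqrtr_ge0//.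
  by apply/idP/idP; rewrite inE /eball/= edistC -enormE.
move: t0; rewrite le_eqVlt => /predU1P[<-|t0].
  by rewrite ltxx sqrtr0 expr0n mul0e mule0.
by rewrite t0 muleA [LHS]muleC EFinM sqrtr_expn_powR// [in RHS](muleC (expR _)%:E).
Qed.

(** The Gaussian identity is solved for the volume. Neither factor can be infinite, since their
    product is finite and positive; this also excludes the default value of [fine]. *)
Lemma unit_ball_measureE d : unit_ball_measure d.+1 = (unit_ball_volume d.+1)%:E.
Proof.
have := unit_ball_measure_Gammae d.
rewrite /unit_ball_volume /Gamma /Rintegral -/(Gammae _).
have p0 : (0 < Num.sqrt (pi : R) ^+ d.+1)%R by rewrite exprn_gt0// sqrtr_gt0 pi_gt0.
have k0 : 0 <= unit_ball_measure d.+1 by exact: measure_ge0.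
have G0 : 0 <= Gammae (1 + d.+1%:R / 2).
  by apply: integral_ge0 => t _; rewrite lee_fin mulr_ge0 ?powR_ge0 ?expR_ge0.
have -> : (pi `^ (d.+1%:R / 2) = Num.sqrt (pi : R) ^+ d.+1)%R.
  by rewrite sqrtr_expn_powR ?pi_gt0// addrAC subrr add0r.
move: k0 G0 p0; set p := (Num.sqrt _ ^+ _)%R.
case: (unit_ball_measure _) => [k| |]//; case: (Gammae _) => [g| |]//=; rewrite ?lee_fin.
- move=> k0 g0 p0 [kg]; congr EFin; rewrite -kg mulfK//.
  by apply: contra_ltN p0 => /eqP g00; rewrite -kg g00 mulr0.
- rewrite le_eqVlt => /predU1P[<- _ p0|k0 _ _]; last by rewrite gt0_muley.
  by rewrite mul0e => -[p00]; move: p0; rewrite -p00 ltxx.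
- move=> _; rewrite le_eqVlt => /predU1P[<- p0|g0 _]; last by rewrite gt0_mulye.
  by rewrite mule0 => -[p00]; move: p0; rewrite -p00 ltxx.
Qed.

Lemma unit_ball_volume_gt0 d : (0 < unit_ball_volume d.+1 :> R)%R.
Proof.
have := unit_ball_measure_Gammae d.
have p0 : (0 < Num.sqrt (pi : R) ^+ d.+1)%R by rewrite exprn_gt0// sqrtr_gt0 pi_gt0.
have : 0 <= unit_ball_measure d.+1 :> \bar R by exact: measure_ge0.
rewrite unit_ball_measureE lee_fin le_eqVlt => /predU1P[<-|//].
by rewrite mul0e => -[p00]; move: p0; rewrite -p00 ltxx.
Qed.

Lemma lebesgue_eballE d (x : d.+1.-tuple R) r : (0 <= r)%R ->
  leb (eball x r) = (unit_ball_volume d.+1 * r ^+ d.+1)%:E.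
Proof. by move=> r0; rewrite lebesgue_eball// unit_ball_measureE -EFinM mulrC. Qed.

End ball_volume.

(** * L1 continuity of translations and ball averages *)

Section dominated.
Context d (T : measurableType d) (R : realType).
Variable mu : {measure set T -> \bar R}.
Local Open Scope ereal_scope.

(** Convergence is asked only where [G x < +oo]: in the induction on the dimension [G] is the
    integral of a slice, which Tonelli makes finite only almost everywhere. *)
Lemma ge0_dominated_cvg0 (F : nat -> T -> \bar R) (G : T -> \bar R) :
  (forall n, measurable_fun setT (F n)) -> (forall n x, 0 <= F n x) ->
  measurable_fun setT G -> (forall n x, F n x <= G x) ->
  \int[mu]_x G x < +oo ->
  {ae mu, forall x, G x < +oo -> F n x @[n --> \oo] --> 0} ->
  \int[mu]_x F n x @[n --> \oo] --> 0.
Proof.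
move=> mF F0 mG FG iG Fcvg.
have G0 x : 0 <= G x by exact: le_trans (F0 0%N x) (FG 0%N x).
have intG : mu.-integrable setT G.
  by apply/integrableP; split => //; under eq_integral do rewrite gee0_abs//.
have [] := @dominated_convergence _ _ _ mu setT measurableT F (cst 0) G mF
  (measurable_cst _) _ intG _.
- apply: filterS2 (integrable_ae measurableT intG) Fcvg => x /(_ I) Gfin Fx _.
  apply: Fx.
  by rewrite ltey_eq Gfin.
- by apply: aeW => x n _; rewrite gee0_abs.
by move=> _ _; rewrite integral0.
Qed.

Lemma abse_integralB_le (D : set T) (a b : T -> R) : measurable D ->
  measurable_fun D a -> measurable_fun D b ->
  (forall x, 0 <= a x)%R -> (forall x, 0 <= b x)%R ->
  \int[mu]_(x in D) (a x)%:E < +oo -> \int[mu]_(x in D) (b x)%:E < +oo ->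
  `| \int[mu]_(x in D) (a x)%:E - \int[mu]_(x in D) (b x)%:E | <=
  \int[mu]_(x in D) `|a x - b x|%:E%R.
Proof.
move=> mD ma mb a0 b0 ia ib.
have inta : mu.-integrable D (EFin \o a).
  apply/integrableP; split; first exact/measurable_EFinP.
  by under eq_integral do rewrite gee0_abs ?lee_fin//.
have intb : mu.-integrable D (EFin \o b).
  apply/integrableP; split; first exact/measurable_EFinP.
  by under eq_integral do rewrite gee0_abs ?lee_fin//.
rewrite -(integralB mD inta intb).
apply: (le_trans (le_abse_integral _ _ _)) => //.
by apply/measurable_EFinP; exact: measurable_funB.
Qed.

End dominated.

Section extended_cvg0.
Context {R : realType}.
Local Open Scope ereal_scope.
Implicit Types u v : nat -> \bar R.

Lemma ge0_cvg0P u : (forall n, 0 <= u n) ->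
  u n @[n --> \oo] --> 0 <->
  (forall e : R, (0 < e)%R -> \forall n \near \oo, u n <= e%:E).
Proof.
move=> u0; split => [/fine_cvgP[ufin /cvgrPdist_le uc] e e0|ule].
  near=> n.
  have ufn : u n \is a fin_num by near: n.
  rewrite -(fineK ufn) lee_fin (le_trans (ler_norm _))//.
  by rewrite -[X in (X <= _)%R]normrN -[(- _)%R]add0r; near: n; exact: uc.
apply/fine_cvgP; split.
  have := ule 1%R ltr01; apply: filterS => n un1.
  by rewrite ge0_fin_numE// (le_lt_trans un1)// ltry.
apply/cvgrPdist_le => e e0; near=> n.
rewrite sub0r normrN/= ger0_norm; last by rewrite fine_ge0.
have une : u n <= e%:E by near: n; exact: ule.
by rewrite -lee_fin fineK// ge0_fin_numE// (le_lt_trans une)// ltry.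
Unshelve. all: by end_near. Qed.

Lemma ge0_le_cvg0 u v : (forall n, 0 <= u n) -> (forall n, u n <= v n) ->
  v n @[n --> \oo] --> 0 -> u n @[n --> \oo] --> 0.
Proof.
move=> u0 uv; apply: (@squeeze_cvge _ _ _ _ (cst 0)); last exact: cvg_cst.
by apply: nearW => n; rewrite u0 uv.
Qed.

Lemma cvge0D u v : u n @[n --> \oo] --> 0 -> v n @[n --> \oo] --> 0 ->
  u n + v n @[n --> \oo] --> 0.
Proof. by move=> u0 v0; rewrite -[0 in X in _ --> X]add0e; apply: cvgeD. Qed.

Lemma cvge0Zl (k : R) u : u n @[n --> \oo] --> 0 -> k%:E * u n @[n --> \oo] --> 0.
Proof. by move=> u0; rewrite -[0 in X in _ --> X](mule0 k%:E); apply: cvgeZl. Qed.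

End extended_cvg0.

Section shift_continuity_real.
Context {R : realType}.
Local Open Scope ereal_scope.
Local Notation mu := (@lebesgue_measure R).

Lemma measurable_shift_dist (g : R -> R) (s : R) : measurable_fun setT g ->
  measurable_fun setT (fun t : R => `|g (t + s) - g t|%:E : \bar R)%R.
Proof.
move=> mg; apply/measurable_EFinP; apply: measurableT_comp => //.
apply: measurable_funB => //; apply: measurableT_comp => //.
by apply: measurable_funD => //; exact: measurable_cst.
Qed.

(** The truncated function is continuous except at M and - M, which form a null set, so dominated
    convergence applies. *)
Lemma shift_cvg_trunc (c : R -> R) (M : R) (h : nat -> R) : (0 <= M)%R ->
  continuous c -> h n @[n --> \oo] --> (0 : R)%R ->
  let g := (c * \1_(`[- M, M]%classic))%R in
  \int[mu]_t `|g (t + h n) - g t|%:E%R @[n --> \oo] --> 0.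
Proof.
move=> M0 cc hc g.
have [K [_ /(_ (K + 1)%R)]] : bounded_set (c @` `[(- M)%R, M]%classic).
  apply/compact_bounded/continuous_compact; last exact: segment_compact.
  exact/continuous_subspaceT.
rewrite ltrDl ltr01 => /(_ isT) Kb.
have [B [_ /(_ (B + 1)%R)]] : bounded_fun h.
  by apply: cvg_seq_bounded; apply/cvg_ex; exists 0%R.
rewrite ltrDl ltr01 => /(_ isT) Bb.
have K0 : (0 <= K + 1)%R.
  apply: le_trans (Kb (c 0%R) _) => //; exists 0%R => //=.
  by rewrite in_itv/= oppr_le0 M0.
have gK t : (`|g t| <= K + 1)%R.
  rewrite /g fctE indicE; case: (boolP (t \in _)) => tM; rewrite ?mulr1 ?mulr0 ?normr0//.
  by apply: Kb; exists t => //; rewrite inE in tM.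
have g_out t : (M < `|t|)%R -> g t = 0%R.
  move=> Mt; rewrite /g fctE indicE memNset ?mulr0//= in_itv/= -ler_norml.
  by apply/negP; rewrite -ltNge.
have mg : measurable_fun setT g.
  apply: measurable_funM; first exact: continuous_measurable_fun.
  exact: measurable_indic.
(* [B + 1] bounds every [h n], so for t outside E both t and t + h n leave [- M, M] and the
   difference vanishes. Inside E it is at most twice the bound [K + 1] of g. *)
pose E : set (measurableTypeR R) := `[(- (M + (B + 1)))%R, (M + (B + 1))%R]%classic.
have mE : measurable E by exact: measurable_itv.
apply: (@ge0_dominated_cvg0 _ _ _ _ _
  (fun t => (((K + 1) *+ 2)%R%:E * (\1_E t)%:E))).
- by move=> n; exact: measurable_shift_dist.
- by move=> n x; rewrite lee_fin.
- by apply/measurable_EFinP; apply: measurable_funM => //; exact: measurable_indic.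
- move=> n x; rewrite -EFinM lee_fin indicE.
  have [xE|/negP xE] := boolP (x \in E).
    by rewrite mulr1 mulr2n (le_trans (ler_normB _ _))// lerD.
  have : ~ (`|x| <= M + (B + 1))%R.
    by move=> xMB; apply: xE; rewrite inE /E/= in_itv/= -ler_norml.
  move=> /negP; rewrite -ltNge => xMB.
  have hB : (`|h n| <= B + 1)%R by exact: Bb.
  have B0 : (0 <= B + 1)%R by exact: le_trans hB.
  rewrite !g_out ?subrr ?normr0 ?mulr0//.
    by rewrite (le_lt_trans _ xMB)// lerDl.
  rewrite -(ltrD2r (B + 1)%R) (lt_le_trans xMB)//.
  rewrite (le_trans _ (lerD (lexx _) hB))//.
  by rewrite (le_trans _ (ler_normB _ _))// addrK.
- rewrite ge0_integralZl//; last 2 first.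
  + by apply/measurable_EFinP; exact: measurable_indic.
  + by rewrite lee_fin mulrn_wge0.
  rewrite integral_indic// setIT [X in _ * X]lebesgue_measure_itv/=.
  by case: ifPn => _; rewrite ?mule0 ?ltry// -EFinB -EFinM ltry.
exists [set M; - M]%R; split.
- by apply: measurableU; exact: measurable_set1.
- by apply: countable_lebesgue_measure0; apply: finite_set_countable; exact: finite_set2.
move=> t; apply: contra_notP => tM _.
have {}tM : (`|t| != M)%R.
  apply/negP; rewrite eqr_norml M0 andbT => /orP tM'; apply: tM.
  by case: tM' => /eqP ->; [left|right].
have g_in u : (`|u| <= M)%R -> g u = c u.
  by move=> uM; rewrite /g fctE indicE mem_set ?mulr1//= in_itv/= -ler_norml.
apply/ge0_cvg0P => [n|e e0]; first by rewrite lee_fin.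
move/cvgrPdist_le : hc => hc.
have [tltM|tgtM] := ltP `|t|%R M.
  have cth : c (t + h n)%R @[n --> \oo] --> c t.
    apply: continuous_cvg; first exact: cc.
    by rewrite -[X in _ --> X]addr0; apply: cvgD; [exact: cvg_cst|exact/cvgrPdist_le].
  move/cvgrPdist_le : cth => cth.
  near=> n; rewrite lee_fin !g_in ?(ltW tltM)//.
    by rewrite distrC; near: n; exact: cth.
  rewrite (le_trans (ler_normD _ _))// -lerBrDl.
  rewrite -[X in (X <= _)%R]normrN -[(- _)%R]add0r; near: n.
  by apply: hc; rewrite subr_gt0.
have {}tgtM : (M < `|t|)%R by rewrite lt_neqAle eq_sym tM.
near=> n; rewrite !g_out ?subrr ?normr0 ?lee_fin ?ltW//.
have hn : (`|h n| <= (`|t| - M) / 2)%R.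
  rewrite -[X in (X <= _)%R]normrN -[(- _)%R]add0r; near: n.
  by apply: hc; rewrite divr_gt0// subr_gt0.
have := ler_normB (t + h n)%R (h n); rewrite addrK.
lra.
Unshelve. all: by end_near. Qed.

(** Half of e pays for restricting g to a large interval, the other half for replacing it there by a
    continuous function. *)
Lemma trunc_approx (g : R -> R) (e : R) : measurable_fun setT g ->
  \int[mu]_t `|g t|%:E < +oo -> (0 < e)%R ->
  exists (c : R -> R) (M : R), [/\ continuous c, (0 <= M)%R &
   \int[mu]_t `|g t - (c * \1_(`[- M, M]%classic)) t|%:E%R <= e%:E].
Proof.
move=> mg ig e0; have e2 : (0 < e / 2)%R by rewrite divr_gt0.
have mag : measurable_fun setT (fun t => `|g t|%:E : \bar R).
  by apply/measurable_EFinP; exact: measurableT_comp.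
pose E (n : nat) : set (measurableTypeR R) := `[- n%:R, n%:R]%classic%R.
have mE n : measurable (E n) by exact: measurable_itv.
have mF n : measurable_fun setT (fun t => (\1_(~` E n) t * `|g t|)%:E : \bar R).
  apply/measurable_EFinP; apply: measurable_funM; last exact/measurable_EFinP.
  by apply: measurable_indic; exact: measurableC.
have F0 n t : 0 <= (\1_(~` E n) t * `|g t|)%:E :> \bar R by rewrite lee_fin mulr_ge0.
have : \int[mu]_t (\1_(~` E n) t * `|g t|)%:E @[n --> \oo] --> 0.
  apply: (ge0_dominated_cvg0 mF F0 mag) => //.
    by move=> n x; rewrite lee_fin indicE ler_piMl// lern1 leq_b1.
  apply: aeW => x _; apply: cvg_near_cst; near=> n.
  rewrite indicE memNset ?mul0r//= /E; apply; rewrite /= in_itv/= -ler_norml.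
  by near: n; exact: nbhs_infty_ger.
move=> /(ge0_cvg0P (fun n => _))-/(_ _ (e / 2) e2)%R[|N _ /(_ N (leqnn N))/= NP].
  by move=> n; apply: integral_ge0 => x _.
have [|||c_ [cc ic /(ge0_cvg0P (fun n => _))-/(_ _ (e / 2) e2)%R[|m _ /(_ m (leqnn m))/= mP]]] :=
  @approximation_continuous_integrable R (E N) g.
- exact: mE.
- by rewrite [X in X < _]lebesgue_measure_itv/=; case: ifP => _; rewrite ?ltry.
- apply: (@integrableS _ _ _ _ setT) => //.
  by apply/integrableP; split; [exact/measurable_EFinP|exact: ig].
- by move=> n; apply: integral_ge0 => x _; rewrite abse_ge0.
exists (c_ m), N%:R; split => //.
have mc : measurable_fun setT (c_ m) by exact: continuous_measurable_fun.
have mgc : measurable_fun setT (fun t => `|g t - c_ m t|%:E : \bar R).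
  by apply/measurable_EFinP; apply: measurableT_comp => //; exact: measurable_funB.
apply: (@le_trans _ _ (\int[mu]_t (((fun t => `|g t - c_ m t|%:E) \_ (E N)) t +
    (\1_(~` E N) t * `|g t|)%:E))).
  apply: ge0_le_integral => //.
  - apply/measurable_EFinP; apply: measurableT_comp => //; apply: measurable_funB => //.
    by apply: measurable_funM => //; exact: measurable_indic.
  - apply: emeasurable_funD; last exact: mF.
    by apply/(measurable_restrictT _ _).1 => //; exact: measurable_funTS.
  - move=> t _; rewrite patchE indicE in_setC/= fctE indicE.
    by case: ifPn => tE; rewrite ?mulr1 ?mulr0 ?mul0r ?mul1r ?adde0 ?subr0 ?add0e.
rewrite ge0_integralD//; last 2 first.
- by move=> t _; rewrite patchE; case: ifP => // _; rewrite lee_fin.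
- by apply/(measurable_restrictT _ _).1 => //; exact: measurable_funTS.
rewrite -integral_mkcond (splitr e) EFinD leeD//.
Unshelve. all: by end_near. Qed.

(** A three-epsilon argument: the distance of g to its truncated continuous approximant is paid
    twice, once shifted and once not, and translation invariance makes the two costs equal. *)
Lemma shift_cvg_real (g : R -> R) (h : nat -> R) : measurable_fun setT g ->
  \int[mu]_t `|g t|%:E < +oo -> h n @[n --> \oo] --> (0 : R)%R ->
  \int[mu]_t `|g (t + h n) - g t|%:E%R @[n --> \oo] --> 0.
Proof.
move=> mg ig hc.
apply/ge0_cvg0P => [n|e e0]; first by apply: integral_ge0 => x _; rewrite lee_fin.
have e3 : (0 < e / 3)%R by rewrite divr_gt0.
have [c [M [cc M0 gcM]]] := trunc_approx mg ig e3.
set g' := (c * _)%R in gcM.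
have mg' : measurable_fun setT g'.
  apply: measurable_funM; first exact: continuous_measurable_fun.
  exact: measurable_indic.
have mgg' : measurable_fun setT (fun t => `|g t - g' t|%:E : \bar R).
  by apply/measurable_EFinP; apply: measurableT_comp => //; exact: measurable_funB.
have := shift_cvg_trunc M0 cc hc; rewrite -/g'.
move=> /(ge0_cvg0P (fun n => _))-/(_ _ (e / 3) e3)%R[|N _ NP].
  by move=> n; apply: integral_ge0 => x _; rewrite lee_fin.
exists N => // n /NP/= {}NP.
apply: (@le_trans _ _ (\int[mu]_t ((`|g (t + h n) - g' (t + h n)|%:E +
    `|g t - g' t|%:E) + `|g' (t + h n) - g' t|%:E)%R)).
  apply: ge0_le_integral => //.
  - exact: measurable_shift_dist.
  - apply: emeasurable_funD; last exact: measurable_shift_dist.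
    apply: emeasurable_funD => //; apply: (measurableT_comp mgg').
    by apply: measurable_funD => //; exact: measurable_cst.
  - move=> t _; rewrite -!EFinD lee_fin.
    rewrite (_ : g (t + h n) - g t = (g (t + h n)%R - g' (t + h n)%R) -
      (g t - g' t) + (g' (t + h n)%R - g' t))%R; last by ring.
    by rewrite (le_trans (ler_normD _ _))// lerD2r ler_normB.
have ms : measurable_fun setT (fun t : R => `|g (t + h n) - g' (t + h n)|%:E : \bar R)%R.
  apply: (measurableT_comp mgg').
  by apply: measurable_funD => //; exact: measurable_cst.
rewrite ge0_integralD//; last 3 first.
- by move=> t _; rewrite -EFinD lee_fin addr_ge0.
- exact: emeasurable_funD.
- exact: measurable_shift_dist.
rewrite ge0_integralD//.
rewrite (ge0_integral_lebesgue_shift (h n) (g := fun t => `|g t - g' t|%:E)%R)//.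
rewrite (_ : e = e / 3 + e / 3 + e / 3)%R; last by field.
by rewrite !EFinD !leeD.
Qed.

Lemma shift_dist_le (g : R -> R) (s : R) : measurable_fun setT g ->
  \int[mu]_t `|g (t + s) - g t|%:E%R <= 2%:E * \int[mu]_t `|g t|%:E.
Proof.
move=> mg.
have mag : measurable_fun setT (fun t => `|g t|%:E : \bar R).
  by apply/measurable_EFinP; exact: measurableT_comp.
have ms : measurable_fun setT (fun t : R => `|g (t + s)|%:E : \bar R)%R.
  by apply: (measurableT_comp mag); apply: measurable_funD => //; exact: measurable_cst.
apply: (@le_trans _ _ (\int[mu]_t (`|g (t + s)|%:E + `|g t|%:E)%R)).
  apply: ge0_le_integral => //.
  - exact: measurable_shift_dist.
  - exact: emeasurable_funD.
  - by move=> t _; rewrite -EFinD lee_fin ler_normB.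
rewrite ge0_integralD//.
rewrite (ge0_integral_lebesgue_shift s mag)//.
by rewrite mule_natl mule2n.
Qed.

End shift_continuity_real.

Section shift_continuity.
Context {R : realType}.
Local Open Scope ereal_scope.
Local Notation leb := (@lebesgue_tuple R _).

Lemma measurable_tshift_dist d (g : d.-tuple R -> R) (s : d.-tuple R) :
  measurable_fun setT g ->
  measurable_fun setT (fun t => `|g (taddt t s) - g t|%:E : \bar R)%R.
Proof.
move=> mg; apply/measurable_EFinP; apply: measurableT_comp => //.
apply: measurable_funB => //; apply: measurableT_comp => //.
exact: measurable_taddt.
Qed.

Lemma tshift_dist_le d (g : d.-tuple R -> R) s : measurable_fun setT g ->
  \int[leb]_t `|g (taddt t s) - g t|%:E%R <= 2%:E * \int[leb]_t `|g t|%:E.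
Proof.
move=> mg.
have mag : measurable_fun setT (fun t => `|g t|%:E : \bar R).
  by apply/measurable_EFinP; exact: measurableT_comp.
apply: (@le_trans _ _ (\int[leb]_t (`|g (taddt t s)|%:E + `|g t|%:E))).
  apply: ge0_le_integral => //.
  - exact: measurable_tshift_dist.
  - apply: emeasurable_funD => //.
    by apply: (measurableT_comp mag); exact: measurable_taddt.
  - by move=> t _; rewrite -EFinD lee_fin ler_normB.
rewrite ge0_integralD//; last first.
  by apply: (measurableT_comp mag); exact: measurable_taddt.
rewrite (ge0_integral_shift s mag)//.
by rewrite mule_natl mule2n.
Qed.

(* By induction on the dimension, shifting the first coordinate and the
   remaining ones separately. *)
Lemma shift_cvg d (g : d.-tuple R -> R) (h : nat -> d.-tuple R) :
  measurable_fun setT g -> \int[leb]_t `|g t|%:E < +oo ->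
  (forall i, tnth (h n) i @[n --> \oo] --> (0 : R)%R) ->
  \int[leb]_t `|g (taddt t (h n)) - g t|%:E%R @[n --> \oo] --> 0.
Proof.
elim: d g h => [|d IH] g h mg ig hc.
  rewrite (_ : (fun n => _) = cst 0); first exact: cvg_cst.
  apply/funext => n; rewrite integral0_eq// => x _.
  by rewrite (tuple0 x) (tuple0 (taddt _ _)) subrr normr0.
pose s n := thead (h n); pose k n := [tuple of behead (h n)].
have hE n : h n = tuple_cons (s n, k n) by rewrite /tuple_cons {1}(tuple_eta (h n)).
pose A n t := \int[leb]_y `|g (tuple_cons (t, taddt y (k n))) - g (tuple_cons (t, y))|%:E%R.
pose B n y := \int[lebesgue_measure]_t `|g (tuple_cons (t + s n, y)) - g (tuple_cons (t, y))|%:E%R.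
have mag : measurable_fun setT (fun t => `|g t|%:E : \bar R).
  by apply/measurable_EFinP; exact: measurableT_comp.
pose Gt t := \int[leb]_y `|g (tuple_cons (t, y))|%:E.
pose Gy y := \int[lebesgue_measure]_t `|g (tuple_cons (t, y))|%:E.
have mgc : measurable_fun setT (g \o @tuple_cons R d).
  by apply: measurableT_comp => //; exact: measurable_tuple_cons.
have mgc1 t : measurable_fun setT (fun y : d.-tuple R => g (tuple_cons (t, y))).
  by apply: (measurableT_comp mg); exact: measurable_cons1.
have mgc2 y : measurable_fun setT (fun t : measurableTypeR R => g (tuple_cons (t, y))).
  apply: (measurableT_comp mg); apply: (measurableT_comp (@measurable_tuple_cons R d)).
  exact: pair2_measurable.
have mH n : measurable_fun setT (fun p : measurableTypeR R * d.-tuple R =>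
    `|g (tuple_cons (p.1, taddt p.2 (k n))) - g (tuple_cons p)|%:E : \bar R)%R.
  apply/measurable_EFinP; apply: measurableT_comp => //.
  apply: measurable_funB => //; apply: (measurableT_comp mgc).
  apply/measurable_fun_pairP; split; first exact: measurable_fst.
  by apply: measurable_taddt => //; exact: measurable_snd.
have mK n : measurable_fun setT (fun p : measurableTypeR R * d.-tuple R =>
    `|g (tuple_cons (p.1 + s n, p.2)) - g (tuple_cons p)|%:E : \bar R)%R.
  apply/measurable_EFinP; apply: measurableT_comp => //.
  apply: measurable_funB => //; apply: (measurableT_comp mgc).
  apply/measurable_fun_pairP; split; last exact: measurable_snd.
  by apply: measurable_funD => //; exact: measurable_fst.
have magc : measurable_fun setT (fun p : measurableTypeR R * d.-tuple R =>
    `|g (tuple_cons p)|%:E : \bar R).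
  by apply/measurable_EFinP; exact: measurableT_comp.
have mA n : measurable_fun setT (A n).
  exact: (@measurable_fun_fubini_tonelli_F _ _ _ _ _ leb _ (mH n)).
have mB n : measurable_fun setT (B n).
  exact: (@measurable_fun_fubini_tonelli_G _ _ _ _ _ lebesgue_measure _ (mK n)).
have mGt : measurable_fun setT Gt.
  exact: (@measurable_fun_fubini_tonelli_F _ _ _ _ _ leb _ magc).
have mGy : measurable_fun setT Gy.
  exact: (@measurable_fun_fubini_tonelli_G _ _ _ _ _ lebesgue_measure _ magc).
have iGt : \int[lebesgue_measure]_t Gt t < +oo.
  by move: ig; rewrite ge0_integral_lebesgue_tupleS.
have iGy : \int[leb]_y Gy y < +oo.
  by move: iGt; rewrite /Gt (fubini_tonelli _ magc).
apply: (@ge0_le_cvg0 _ _ (fun n => \int[lebesgue_measure]_t A n t + \int[leb]_y B n y)).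
- by move=> n; apply: integral_ge0 => x _; rewrite lee_fin.
- move=> n; rewrite ge0_integral_lebesgue_tupleS//; last exact: measurable_tshift_dist.
  rewrite /B -(fubini_tonelli _ (mK n))//.
  (* The path from (t, y) to its translate passes through (t + s n, y). The second leg is [A n]
     evaluated at t + s n, whose integral is that of [A n]. *)
  rewrite -(ge0_integral_lebesgue_shift (s n) (mA n)); last first.
    by move=> t; apply: integral_ge0 => y _; rewrite lee_fin.
  rewrite -ge0_integralD//; last 4 first.
  + by move=> t _; apply: integral_ge0 => y _; rewrite lee_fin.
  + by apply: (measurableT_comp (mA n)); apply: measurable_funD => //; exact: measurable_cst.
  + by move=> t _; apply: integral_ge0 => y _; rewrite lee_fin.
  + exact: (@measurable_fun_fubini_tonelli_F _ _ _ _ _ leb _ (mK n)).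
  apply: ge0_le_integral => //.
  + by move=> t _; apply: integral_ge0 => y _; rewrite lee_fin.
  + apply: (measurable_integral_cons (g := fun x => `|g (taddt x (h n)) - g x|%:E)%R) => //.
    exact: measurable_tshift_dist.
  + apply: emeasurable_funD.
      by apply: (measurableT_comp (mA n)); apply: measurable_funD => //; exact: measurable_cst.
    exact: (@measurable_fun_fubini_tonelli_F _ _ _ _ _ leb _ (mK n)).
  move=> t _.
  have mH1 : measurable_fun setT (fun y => `|g (tuple_cons (t + s n, taddt y (k n))) -
      g (tuple_cons (t + s n, y))|%:E : \bar R)%R.
    exact: (measurableT_comp (mH n) (pair1_measurable (t + s n)%R)).
  have mK1 : measurable_fun setT (fun y => `|g (tuple_cons (t + s n, y)) -
      g (tuple_cons (t, y))|%:E : \bar R)%R.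
    exact: (measurableT_comp (mK n) (pair1_measurable (t : measurableTypeR R))).
  rewrite -ge0_integralD//; apply: ge0_le_integral => //.
  + apply: (measurableT_comp (measurable_tshift_dist (h n) mg)).
    exact: measurable_cons1.
  + exact: emeasurable_funD.
  + move=> y _; rewrite hE tadd_cons -EFinD lee_fin.
    apply: le_trans (ler_normD _ _).
    by rewrite addrA subrK.
apply: cvge0D.
- apply: (@ge0_dominated_cvg0 _ (measurableTypeR R) R lebesgue_measure A
    (fun t => 2%:E * Gt t)) => //.
  + by move=> n x; apply: integral_ge0 => y _; rewrite lee_fin.
  + exact: measurable_funeM.
  + by move=> n t; apply: tshift_dist_le; exact: mgc1.
  + rewrite ge0_integralZl//; last by move=> t _; apply: integral_ge0 => y _; rewrite lee_fin.
    by rewrite lte_mul_pinfty.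
  + apply: aeW => t tfin; apply: IH => //.
      move: tfin; rewrite -/(Gt t).
      by case: (Gt t) => [r|//|//]; rewrite ?ltry// gt0_muley// ?lte_fin.
    move=> i; rewrite (_ : (fun n => _) = (fun n => tnth (h n) (lift ord0 i)))//.
    by apply/funext => n; rewrite hE tnthS.
- apply: (@ge0_dominated_cvg0 _ _ R leb B (fun y => 2%:E * Gy y)) => //.
  + by move=> n x; apply: integral_ge0 => y _; rewrite lee_fin.
  + exact: measurable_funeM.
  + by move=> n y; apply: (@shift_dist_le R (fun t => g (tuple_cons (t, y)))); exact: mgc2.
  + rewrite ge0_integralZl//; last by move=> t _; apply: integral_ge0 => y _; rewrite lee_fin.
    by rewrite lte_mul_pinfty.
  + apply: aeW => y tfin; apply: (@shift_cvg_real _ (fun t => g (tuple_cons (t, y)))) => //.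
    * exact: mgc2.
    * move: tfin; rewrite -/(Gy y).
      by case: (Gy y) => [r|//|//]; rewrite ?ltry// gt0_muley// ?lte_fin.
    * by rewrite (_ : s = (fun n => tnth (h n) ord0)).
Qed.

Lemma tadd_comm d (x y : d.-tuple R) : taddt x y = taddt y x.
Proof. by apply: eq_from_tnth => i; rewrite !tnth_mktuple addrC. Qed.

Lemma integral_eball_scale d (f : d.+1.-tuple R -> R) x r :
  measurable_fun setT f -> (forall x, 0 <= f x)%R -> (0 < r)%R ->
  (r ^- d.+1)%:E * \int[leb]_(y in eball x r) (f y)%:E =
  \int[leb]_z (\1_(eball [tuple 0%R | i < d.+1] 1) z *
    f (taddt x (tscale r z)))%:E.
Proof.
move=> mf f0 r0.
pose F y := (\1_(eball x r) y * f y)%:E : \bar R.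
have mF : measurable_fun setT F.
  apply/measurable_EFinP; apply: measurable_funM => //.
  by apply: measurable_indic; exact: measurable_eball.
have F0 y : 0 <= F y by rewrite lee_fin mulr_ge0.
have -> : \int[leb]_(y in eball x r) (f y)%:E = \int[leb]_y F y.
  rewrite integral_mkcond; apply: eq_integral => y _.
  by rewrite patchE /F indicE; case: ifPn => _; rewrite ?mul1r ?mul0r.
rewrite -(ge0_integral_shift x mF)// -(ge0_integral_scale r0); last 2 first.
- by apply: (measurableT_comp mF); exact: measurable_taddt.
- by move=> z; exact: F0.
rewrite muleA -EFinM mulVf ?mul1e ?expf_neq0 ?gt_eqF//.
apply: eq_integral => z _; rewrite /F tadd_comm; congr (_ * _)%:E.
rewrite !indicE; congr ((nat_of_bool _)%:R).
by apply/idP/idP; rewrite !inE /eball/= edist_taddt enorm_tscale ?(ltW r0)//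
  (edistC _ z) -enormE ger_pMr.
Qed.

(* The rescaled ball average is an average of the translates of f by r n z over
   z in the unit ball. *)
Lemma ball_average_cvg d (f : d.+1.-tuple R -> R) (r : nat -> R) :
  measurable_fun setT f -> (forall x, 0 <= f x)%R ->
  \int[leb]_x (f x)%:E < +oo ->
  (forall n, 0 < r n)%R -> r n @[n --> \oo] --> (0 : R)%R ->
  \int[leb]_x `| (r n ^- d.+1)%:E * \int[leb]_(y in eball x (r n)) (f y)%:E -
     (unit_ball_volume d.+1 * f x)%:E | @[n --> \oo] --> 0.
Proof.
move=> mf f0 fi r0 rc.
set U := \1_(eball [tuple 0%R | i < d.+1] 1) : d.+1.-tuple R -> R.
have mU : measurable_fun setT U by apply: measurable_indic; exact: measurable_eball.
have U0 z : (0 <= U z)%R by rewrite /U.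
have iU : \int[leb]_z (U z)%:E = (unit_ball_volume d.+1)%:E.
  rewrite integral_indic ?setIT//; last exact: measurable_eball.
  by rewrite [LHS]lebesgue_eballE// expr1n mulr1.
have mUE : measurable_fun setT (fun z => (U z)%:E : \bar R) by exact/measurable_EFinP.
(* The L1 distance from f to its translate by r n z. It is at most twice the norm of f, which
   supplies the dominating function on the unit ball. *)
pose W n z := \int[leb]_x `|f (taddt x (tscale (r n) z)) - f x|%:E%R.
have mUf n : measurable_fun setT (fun p : d.+1.-tuple R * d.+1.-tuple R =>
    ((U p.2)%:E * `|f (taddt p.1 (tscale (r n) p.2)) - f p.1|%:E%R) : \bar R).
  apply: emeasurable_funM.
    by apply/measurable_EFinP; apply: (measurableT_comp mU); exact: measurable_snd.
  apply/measurable_EFinP; apply: measurableT_comp => //; apply: measurable_funB.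
    apply: (measurableT_comp mf); apply: measurable_taddt; first exact: measurable_fst.
    by apply: measurable_tscale => //; exact: measurable_snd.
  by apply: (measurableT_comp mf); exact: measurable_fst.
have Uf0 n (p : d.+1.-tuple R * d.+1.-tuple R) :
    0 <= (U p.2)%:E * `|f (taddt p.1 (tscale (r n) p.2)) - f p.1|%:E%R.
  by rewrite mule_ge0// lee_fin.
have UW n z : (U z)%:E * W n z =
    \int[leb]_x ((U z)%:E * `|f (taddt x (tscale (r n) z)) - f x|%:E%R).
  by rewrite ge0_integralZl ?lee_fin//; exact: measurable_tshift_dist.
have absf : \int[leb]_x `|f x|%:E < +oo.
  by under eq_integral do rewrite ger0_norm//.
apply: (@ge0_le_cvg0 _ _ (fun n => \int[leb]_z ((U z)%:E * W n z))).
- by move=> n; apply: integral_ge0 => x _; rewrite abse_ge0.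
- move=> n; under [leRHS]eq_integral do rewrite UW.
  rewrite -(fubini_tonelli _ (mUf n))//.
  apply: ge0_le_integral => //.
  + apply: measurableT_comp => //; apply: emeasurable_funB.
      under eq_fun do rewrite integral_eball_scale//.
      apply: (@measurable_fun_fubini_tonelli_F _ _ _ _ _ leb
        (fun p => (U p.2 * f (taddt p.1 (tscale (r n) p.2)))%:E)).
        apply/measurable_EFinP; apply: measurable_funM.
          by apply: (measurableT_comp mU); exact: measurable_snd.
        apply: (measurableT_comp mf); apply: measurable_taddt; first exact: measurable_fst.
        by apply: measurable_tscale => //; exact: measurable_snd.
      by move=> p; rewrite lee_fin mulr_ge0.
    by apply/measurable_EFinP; exact: measurable_funM.
  + exact: (@measurable_fun_fubini_tonelli_F _ _ _ _ _ leb _ (mUf n)).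
  + move=> x _.
    have iB : \int[leb]_(y in eball x (r n)) (f y)%:E < +oo.
      rewrite (le_lt_trans _ fi)//; apply: ge0_subset_integral => //.
      * exact: measurable_eball.
      * exact/measurable_EFinP.
      * by move=> y _; rewrite lee_fin.
    have mS : measurable_fun setT (fun z => f (taddt x (tscale (r n) z))).
      by apply: (measurableT_comp mf); apply: measurable_taddt => //; exact: measurable_tscale.
    have Ufx : \int[leb]_z (U z * f x)%:E = (unit_ball_volume d.+1 * f x)%:E.
      under eq_integral do rewrite EFinM.
      transitivity (\int[leb]_z (U z)%:E * (f x)%:E); last by rewrite iU.
      by apply: (ge0_integralZr leb measurableT mUE) => [z _|]; rewrite lee_fin.
    rewrite -Ufx integral_eball_scale//.
    apply: (@le_trans _ _ (\int[leb]_z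
       `|U z * f (taddt x (tscale (r n) z)) - U z * f x|%:E%R)).
      apply: abse_integralB_le => //.
      * exact: measurable_funM.
      * exact: measurable_funM.
      * by move=> z; rewrite mulr_ge0.
      * by move=> z; rewrite mulr_ge0.
      * rewrite -integral_eball_scale// lte_mul_pinfty// lee_fin.
        by rewrite invr_ge0 exprn_ge0// ltW.
      * by rewrite Ufx ltry.
    apply: ge0_le_integral => //.
    * by apply/measurable_EFinP; apply: measurableT_comp => //; apply: measurable_funB; exact: measurable_funM.
    * by apply: (measurableT_comp (mUf n)); exact: pair1_measurable.
    * by move=> z _; rewrite -EFinM lee_fin/= -mulrBr normrM (ger0_norm (U0 z)).
- apply: (@ge0_dominated_cvg0 _ _ _ _ _
    (fun z => (U z)%:E * (2%:E * \int[leb]_x `|f x|%:E))).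
  + move=> n; under eq_fun do rewrite UW.
    exact: (@measurable_fun_fubini_tonelli_G _ _ _ _ _ leb _ (mUf n)).
  + by move=> n z; rewrite UW; apply: integral_ge0 => x _; exact: (Uf0 n (x, z)).
  + by apply: emeasurable_funM => //; exact/measurable_EFinP.
  + move=> n z; apply: lee_wpmul2l; first by rewrite lee_fin.
    exact: tshift_dist_le.
  + rewrite (ge0_integralZr leb measurableT mUE); last 2 first.
    * by move=> z _; rewrite lee_fin.
    * by rewrite mule_ge0// integral_ge0.
    rewrite iU; apply: lte_mul_pinfty => //.
      by rewrite lee_fin ltW// unit_ball_volume_gt0.
    exact: lte_mul_pinfty.
  + apply: aeW => z _; apply: cvge0Zl; apply: shift_cvg => // i.
    rewrite (_ : (fun n => _) = (fun n => r n * tnth z i)%R); last first.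
      by apply/funext => n; rewrite tnth_mktuple.
    by rewrite -[X in _ --> X](mul0r (tnth z i)); apply: cvgM => //; exact: cvg_cst.
Qed.

End shift_continuity.

(** * Occupation numbers of independent samples *)

Section independent_tuples.
Context {R : realType} {dT dU} {T : measurableType dT} {U : measurableType dU}.
Variables (P : probability T R) (X : nat -> {RV P >-> U}).
Variable mu : probability U R.
Hypothesis Xindep : mutually_independent X.
Hypothesis Xmu : forall i (B : set U), measurable B -> P (X i @^-1` B) = mu B.
Local Open Scope ereal_scope.

Definition rv_tuple m (l : m.-tuple nat) (w : T) : m.-tuple U :=
  [tuple X (tnth l i) w | i < m].

Lemma measurable_rv_tuple m (l : m.-tuple nat) : measurable_fun setT (rv_tuple l).
Proof.
apply/measurable_fun_tnthP => i.
rewrite (_ : _ \o _ = X (tnth l i)); first exact: measurable_funPT.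
by apply/funext => w /=; rewrite tnth_mktuple.
Qed.

HB.instance Definition _ m (l : m.-tuple nat) :=
  isMeasurableFun.Build _ _ _ _ (rv_tuple l) (@measurable_rv_tuple m l).

(** The sides are labelled by the indices of the variables, not by positions in the tuple, so that
    the independence hypothesis applies without relabelling. *)
Definition index_box m (l : m.-tuple nat) (B : nat -> set U) : set (m.-tuple U) :=
  [set t | forall i, B (tnth l i) (tnth t i)].

Lemma rv_tuple_box m (l : m.-tuple nat) B :
  rv_tuple l @^-1` index_box l B = \bigcap_(i in [set` [fset k in tval l]%fset]) (X i @^-1` B i).
Proof.
apply/seteqP; split => w /=.
  move=> H k /=; rewrite !inE => /tnthP[i ->].
  by have := H i; rewrite tnth_mktuple.
by move=> H i; rewrite tnth_mktuple; apply: H; rewrite /= !inE mem_tnth.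
Qed.

Lemma measurable_index_box m (l : m.-tuple nat) B :
  (forall i, measurable (B i)) -> measurable (index_box l B).
Proof.
move=> mB; rewrite (_ : index_box l B =
  \bigcap_(i in [set: 'I_m]) (@tnth m U ^~ i @^-1` B (tnth l i))); last first.
  by apply/seteqP; split => [t H i _|t H i]; exact: H.
apply: fin_bigcap_measurable => // i _.
by rewrite -[X in measurable X]setTI; exact: measurable_tnth.
Qed.

Definition index_boxes m (l : m.-tuple nat) : set (set (m.-tuple U)) :=
  [set index_box l B | B in [set B | forall i, measurable (B i)]].

(** When the indices are distinct, a box can constrain one coordinate alone, and such boxes generate
    the product sigma-algebra. *)
Lemma index_boxes_generate m (l : m.-tuple nat) : uniq l ->
  @measurable _ (m.-tuple U) = <<s index_boxes l >>.
Proof.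
move=> ul; apply/seteqP; split.
  apply: smallest_sub; first exact: smallest_sigma_algebra.
  case: m l ul => [|m] l ul; first by rewrite big_ord0.
  rewrite -bigcup_mkord_ord => A [i /= im [C mC <-]]; rewrite setTI.
  apply: sub_sigma_algebra.
  pose k : 'I_m.+1 := inord i.
  exists (fun n => if n == tnth l k then C else setT).
    by move=> n; case: ifP.
  apply/seteqP; split => t /=; first by move=> /(_ k); rewrite eqxx.
  move=> Ct n; case: ifPn => // /eqP/(tuple_uniqP _ ul) -> //.
apply: smallest_sub; first exact: sigma_algebra_measurable.
by move=> _ [B mB <-]; exact: measurable_index_box.
Qed.

(** For fixed A both sides are finite measures in B. They agree on boxes by independence, and boxes
    are stable under intersection and generate. *)
Lemma indep_rv_tuple m (k : nat) (l : m.-tuple nat) A B : uniq (k :: l) ->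
  measurable A -> measurable B ->
  P (X k @^-1` A `&` rv_tuple l @^-1` B) = mu A * P (rv_tuple l @^-1` B).
Proof.
move=> /= /andP[kl ul] mA mB.
have mXA : measurable (X k @^-1` A) by rewrite -[X in measurable X]setTI; exact: measurable_funPT.
pose m1 := pushforward (mrestr P mXA) (rv_tuple l).
have muA : mu A = (fine (mu A))%:E by rewrite fineK// fin_num_measure.
have muA0 : (0 <= fine (mu A))%R by rewrite fine_ge0.
pose m2 := mscale (NngNum muA0) (distribution P (rv_tuple l)).
have H1 B' : m1 B' = P (X k @^-1` A `&` rv_tuple l @^-1` B').
  by rewrite /m1 /pushforward /mrestr setIC.
have H2 B' : m2 B' = mu A * P (rv_tuple l @^-1` B').
  by rewrite /m2 /mscale/= -muA.
rewrite -H1 -H2.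
apply: (measure_unique (index_boxes l) (fun=> setT)) => //.
- exact: index_boxes_generate.
- move=> _ _ [B1 mB1 <-] [B2 mB2 <-]; exists (fun i => B1 i `&` B2 i).
    by move=> i; exact: measurableI.
  by apply/seteqP; split => t /=; [move=> H; split => i; have [] := H i|
    move=> [H3 H4] i; split].
- by move=> _; exists (fun=> setT) => //; apply/seteqP; split.
- by apply: bigcup_const; exists 0%N.
- move=> _ [B' mB' <-]; rewrite -[LHS]/(m1 _) -[RHS]/(m2 _) H1 H2 rv_tuple_box.
  pose B2 i := if i == k then A else B' i.
  have mB2 i : measurable (B2 i) by rewrite /B2; case: ifP.
  rewrite (_ : _ `&` _ = \bigcap_(i in [set` (k |` [fset k in tval l])%fset]) (X i @^-1` B2 i)).
    rewrite Xindep// big_fsetU1/=; last by rewrite !inE.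
    rewrite {1}/B2 eqxx Xmu// Xindep//; congr (_ * _).
    apply: eq_fbigr => i; rewrite !inE => il.
    by rewrite /B2; case: eqP => // ik; rewrite ik (negbTE kl) in il.
  apply/seteqP; split => w /=.
    move=> [wA H] i /=; rewrite !inE /B2 => /orP[/eqP ->|il]; first by rewrite eqxx.
    by case: eqP => [->//|_]; apply: H; rewrite /= !inE.
  move=> H; split; first by have := H k; rewrite /= !inE eqxx /B2 eqxx; apply.
  move=> i /=; rewrite !inE => il; have := H i; rewrite /= !inE il orbT /B2 => /(_ isT).
  by case: eqP => // ik; rewrite ik (negbTE kl) in il.
- move=> _; rewrite -[X in X < _]/(m1 _) H1 (le_lt_trans (probability_le1 _ _)) ?ltry//.
  apply: measurableI => //; rewrite preimage_setT; exact: measurableT.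
Qed.

(** This is how a sample point is frozen: the joint law of [X k] and the other points is a product
    measure, so conditioning on [X k] becomes an integral over its position. *)
Lemma fubini_rv_tuple m (k : nat) (l : m.-tuple nat) (E : set (U * m.-tuple U)) :
  uniq (k :: l) -> measurable E ->
  P [set w | E (X k w, rv_tuple l w)] =
  \int[mu]_x P [set w | E (x, rv_tuple l w)].
Proof.
move=> ukl mE.
have mXV : measurable_fun setT (fun w => (X k w, rv_tuple l w)).
  by apply: measurable_fun_pair => //; exact: measurable_rv_tuple.
transitivity ((mu \x distribution P (rv_tuple l)) E); last first.
  rewrite /product_measure1/=; apply: eq_integral => x _.
  congr (P _); apply/seteqP; split => w /=; rewrite /xsection/= inE//.
rewrite (product_measure_unique (m' := pushforward P (fun w => (X k w, rv_tuple l w))))//.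
move=> A B mA mB; rewrite -[RHS](indep_rv_tuple ukl mA mB).
by [].
Qed.

Lemma measurable_rv_tuple_preimage m (l : m.-tuple nat) (B : set (m.-tuple U)) :
  measurable B -> measurable (rv_tuple l @^-1` B).
Proof.
by move=> mB; rewrite -[X in measurable X]setTI; exact: measurable_rv_tuple.
Qed.

Definition hits m (A : set U) (t : m.-tuple U) : nat := count (fun y => y \in A) t.

Lemma measurable_hits m A : measurable A ->
  measurable_fun setT (fun t : m.-tuple U => (hits A t)%:R : R).
Proof.
move=> mA; rewrite (_ : (fun _ => _) = (fun t => \sum_(i < m) \1_A (tnth t i)))%R.
  apply: measurable_sum => i; apply: measurableT_comp; first exact: measurable_indic.
  exact: measurable_tnth.
apply/funext => t; rewrite /hits -sum1_count natr_sum big_mkcond/=.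
rewrite big_tuple; apply: eq_bigr => i _; rewrite indicE.
by case: (_ \in _).
Qed.

Lemma measurable_hits_lt m A j : measurable A ->
  measurable [set t : m.-tuple U | (hits A t < j)%N].
Proof.
move=> mA; rewrite (_ : [set _ | _] =
  setT `&` (fun t => (hits A t)%:R < (j%:R : R))%R @^-1` [set true]); last first.
  by apply/seteqP; split => t /=; rewrite ltr_nat //= => -[].
by apply: measurable_fun_ltr => //; exact: measurable_hits.
Qed.

Lemma rv_tuple_cons m k (l : m.-tuple nat) w :
  rv_tuple [tuple of k :: l] w = [tuple of X k w :: rv_tuple l w].
Proof.
apply: eq_from_tnth => i; rewrite tnth_mktuple.
case: (unliftP ord0 i) => [i' ->|->]; last by rewrite !tnth0.
by rewrite !tnthS tnth_mktuple.
Qed.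

Lemma hits0 A (t : 0.-tuple U) : hits A t = 0%N.
Proof. by rewrite (tuple0 t). Qed.

Lemma hits_cons m A x (t : m.-tuple U) :
  hits A [tuple of x :: t] = ((x \in A) + hits A t)%N.
Proof. by []. Qed.

(** Splitting on whether the first point falls in A reproduces the recursion that defines
    [binlt]. *)
Lemma prob_hits_lt m (l : m.-tuple nat) A j : uniq l -> measurable A ->
  P [set w | (hits A (rv_tuple l w) < j)%N] = (binlt m j (fine (mu A)))%:E.
Proof.
move=> ul mA.
have muA : mu A = (fine (mu A))%:E by rewrite fineK// fin_num_measure.
elim: m l j ul => [|m IH] l j.
  move=> _; case: j => [|j].
    by rewrite (_ : [set _ | _] = set0) ?measure0//; apply/seteqP; split.
  rewrite (_ : [set _ | _] = setT) ?probability_setT//.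
  by apply/seteqP; split => // w _ /=; rewrite hits0.
case/tupleP: l => k l /[dup] ukl /= /andP[kl ul].
case: j => [|j].
  by rewrite (_ : [set _ | _] = set0) ?measure0//; apply/seteqP; split.
have mXA B : measurable B -> measurable (X k @^-1` B).
  by move=> mB; rewrite -[X in measurable X]setTI; exact: measurable_funPT.
rewrite (_ : [set _ | _] =
   (X k @^-1` A `&` rv_tuple l @^-1` [set t | (hits A t < j)%N]) `|`
   (X k @^-1` (~` A) `&` rv_tuple l @^-1` [set t | (hits A t < j.+1)%N])).
  transitivity (P (X k @^-1` A `&` rv_tuple l @^-1` [set t | (hits A t < j)%N]) +
      P (X k @^-1` (~` A) `&` rv_tuple l @^-1` [set t | (hits A t < j.+1)%N])).
    apply: measureU.
    - by apply: measurableI; [exact: mXA|apply: measurable_rv_tuple_preimage; exact: measurable_hits_lt].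
    - apply: measurableI; first by apply: mXA; exact: measurableC.
      by apply: measurable_rv_tuple_preimage; exact: measurable_hits_lt.
    - by apply/seteqP; split => // w /= [[? _] []].
  rewrite (indep_rv_tuple ukl mA (measurable_hits_lt j mA)).
  rewrite (indep_rv_tuple ukl (measurableC mA) (measurable_hits_lt j.+1 mA)).
  rewrite probability_setC// ![P _](IH l)// muA.
  by rewrite -EFinB -!EFinM -EFinD.
apply/seteqP; split => w /=; rewrite rv_tuple_cons hits_cons.
  by have [wA|wA] := boolP (X k w \in A); [left|right]; split => //; rewrite ?inE ?notin_setE in wA.
move=> [[wA H]|[wA H]].
  by rewrite mem_set// add1n ltnS.
by rewrite memNset.
Qed.

(* Negative correlation of the occupation numbers of disjoint sets: in the
   induction on the sample size the two sides differ by p q times a product of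
   nonnegative increments of [binlt]. *)
Lemma prob_hits2_lt m (l : m.-tuple nat) A B i j : uniq l ->
  measurable A -> measurable B -> A `&` B = set0 ->
  P [set w | (hits A (rv_tuple l w) < i)%N /\ (hits B (rv_tuple l w) < j)%N] <=
  (binlt m i (fine (mu A)) * binlt m j (fine (mu B)))%:E.
Proof.
move=> ul mA mB AB.
set p := fine (mu A); set q := fine (mu B).
have muA : mu A = p%:E by rewrite fineK// fin_num_measure.
have muB : mu B = q%:E by rewrite fineK// fin_num_measure.
have mAB : measurable (A `|` B) by exact: measurableU.
have muAB : mu (A `|` B) = (p + q)%:E by transitivity (mu A + mu B); [exact: measureU|rewrite muA muB].
have p0 : (0 <= p)%R by rewrite fine_ge0.
have q0 : (0 <= q)%R by rewrite fine_ge0.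
have pq1 : (p + q <= 1)%R by rewrite -lee_fin -muAB probability_le1.
have p01 : (0 <= p <= 1)%R by rewrite p0; lra.
have q01 : (0 <= q <= 1)%R by rewrite q0; lra.
elim: m l i j ul => [|m IH] l i j ul.
  case: i => [|i]; first by rewrite (_ : [set _ | _] = set0) ?measure0 ?mul0r//; apply/seteqP; split => // w /= [].
  case: j => [|j]; first by rewrite (_ : [set _ | _] = set0) ?measure0 ?mulr0//; apply/seteqP; split => // w /= [].
  rewrite /= mulr1; apply: probability_le1.
  rewrite (_ : [set _ | _] = setT)//.
  by apply/seteqP; split => // w _ /=; rewrite !hits0.
case: i => [|i]; first by rewrite (_ : [set _ | _] = set0) ?measure0 ?mul0r//; apply/seteqP; split => // w /= [].
case: j => [|j]; first by rewrite (_ : [set _ | _] = set0) ?measure0 ?mulr0//; apply/seteqP; split => // w /= [].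
case/tupleP: l ul => k l /[dup] ukl /= /andP[kl ul].
pose H i j := [set t : m.-tuple U | (hits A t < i)%N /\ (hits B t < j)%N].
have mH i' j' : measurable (H i' j').
  rewrite (_ : H i' j' = [set t | (hits A t < i')%N] `&` [set t | (hits B t < j')%N])//.
  by apply: measurableI; exact: measurable_hits_lt.
have mXA C : measurable C -> measurable (X k @^-1` C).
  by move=> mC; rewrite -[X in measurable X]setTI; exact: measurable_funPT.
have mXH C i' j' : measurable C -> measurable (X k @^-1` C `&` rv_tuple l @^-1` H i' j').
  by move=> mC; apply: measurableI; [exact: mXA|exact: measurable_rv_tuple_preimage].
have mC : measurable (~` (A `|` B)) by exact: measurableC.
rewrite (_ : [set _ | _] = (X k @^-1` A `&` rv_tuple l @^-1` H i j.+1) `|`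
   ((X k @^-1` B `&` rv_tuple l @^-1` H i.+1 j) `|`
   (X k @^-1` (~` (A `|` B)) `&` rv_tuple l @^-1` H i.+1 j.+1))).
  rewrite [leLHS](_ : _ = P (X k @^-1` A `&` rv_tuple l @^-1` H i j.+1) +
     (P (X k @^-1` B `&` rv_tuple l @^-1` H i.+1 j) +
      P (X k @^-1` (~` (A `|` B)) `&` rv_tuple l @^-1` H i.+1 j.+1))); last first.
    rewrite [LHS]measureU; last 3 first.
    - exact: mXH.
    - by apply: measurableU; exact: mXH.
    - apply/seteqP; split => // w /= [[wA _] [[wB _]|[wN _]]].
        by have : (A `&` B) (X k w) by []; rewrite AB.
      by apply: wN; left.
    congr (_ + _); apply: measureU.
    - exact: mXH.
    - exact: mXH.
    - by apply/seteqP; split => // w /= [[wB _] [wN _]]; apply: wN; right.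
  rewrite !indep_rv_tuple// muA muB probability_setC// muAB -EFinB.
  apply: (@le_trans _ _ (p%:E * (binlt m i p * binlt m j.+1 q)%:E +
    (q%:E * (binlt m i.+1 p * binlt m j q)%:E +
    (1 - (p + q))%:E * (binlt m i.+1 p * binlt m j.+1 q)%:E))).
    apply: leeD; first by apply: lee_wpmul2l; rewrite ?lee_fin//; exact: IH.
    apply: leeD; first by apply: lee_wpmul2l; rewrite ?lee_fin//; exact: IH.
    by apply: lee_wpmul2l; rewrite ?lee_fin ?subr_ge0//; exact: IH.
  rewrite -!EFinM -!EFinD lee_fin -subr_ge0.
  rewrite [X in (0 <= X)%R](_ : _ = p * q * ((binlt m i.+1 p - binlt m i p) *
    (binlt m j.+1 q - binlt m j q)))%R; last by ring.
  by rewrite !mulr_ge0 ?subr_ge0 ?binlt_leS.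
have AnB x : A x -> x \notin B.
  by move=> Ax; rewrite notin_setE => Bx; have : (A `&` B) x by []; rewrite AB.
apply/seteqP; split => w /=; rewrite !rv_tuple_cons !hits_cons.
  have [wA|wA] := boolP (X k w \in A).
    rewrite (negbTE (AnB _ _)) ?add0n ?add1n ?ltnS; last by rewrite inE in wA.
    by move=> [? ?]; left; rewrite inE in wA.
  have [wB|wB] := boolP (X k w \in B).
    by rewrite add0n add1n ltnS => -[? ?]; right; left; rewrite inE in wB.
  rewrite !add0n => -[? ?]; right; right; split => //.
  by rewrite notin_setE in wA; rewrite notin_setE in wB; move=> [].
move=> [[wA [? ?]]|[[wB [? ?]]|[wN [? ?]]]].
- by rewrite (negbTE (AnB _ wA)) mem_set// add1n ltnS add0n.
- rewrite (mem_set wB) (_ : (X k w \in A) = false) ?add0n ?add1n ?ltnS//.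
  by apply/negbTE; rewrite notin_setE => /AnB; rewrite mem_set.
- have -> : (X k w \in A) = false by apply: memNset => ?; apply: wN; left.
  by have -> : (X k w \in B) = false by apply: memNset => ?; apply: wN; right.
Qed.

Section neighbors.
Variable nb : U -> set U.
Hypothesis mnb : measurable [set p : U * U | nb p.1 p.2].

Lemma measurable_nb x : measurable (nb x).
Proof.
rewrite (_ : nb x = xsection [set p : U * U | nb p.1 p.2] x).
  exact: measurable_xsection.
by apply/seteqP; split => y; rewrite /xsection/= inE.
Qed.

Lemma measurable_mu_nb : measurable_fun setT (fun x => fine (mu (nb x))).
Proof.
apply: (@measurableT_comp _ _ _ _ _ _ (@fine R)) => //.
rewrite (_ : (fun x => mu (nb x)) = mu \o xsection [set p : U * U | nb p.1 p.2]).
  exact: measurable_fun_xsection.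
apply/funext => x /=; congr (mu _).
by apply/seteqP; split => y; rewrite /xsection/= inE.
Qed.

Lemma mu_nb01 x : (0 <= fine (mu (nb x)) <= 1)%R.
Proof.
by rewrite fine_ge0//= -lee_fin fineK ?probability_le1 ?fin_num_measure//; exact: measurable_nb.
Qed.

Lemma measurable_binlt m j : measurable_fun setT (binlt m j : R -> R).
Proof.
elim: m j => [|m IH] [|j] /=; try exact: measurable_cst.
apply: measurable_funD; first exact: measurable_funM.
by apply: measurable_funM => //; exact: measurable_funB.
Qed.

Lemma measurable_binlt_nb m j :
  measurable_fun setT (fun x => (binlt m j (fine (mu (nb x))))%:E : \bar R).
Proof.
apply/measurable_EFinP; apply: (measurableT_comp (measurable_binlt m j)).
exact: measurable_mu_nb.
Qed.

Lemma measurable_hits_nb dV (V : measurableType dV) m (F : V -> U) (G : V -> m.-tuple U) j :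
  measurable_fun setT F -> measurable_fun setT G ->
  measurable [set v | (hits (nb (F v)) (G v) < j)%N].
Proof.
move=> mF mG; pose N := [set p : U * U | nb p.1 p.2].
rewrite (_ : [set _ | _] =
  setT `&` (fun v => (\sum_(i < m) \1_N (F v, tnth (G v) i))%R < (j%:R : R))%R @^-1` [set true]).
  apply: measurable_fun_ltr => //; apply: measurable_sum => i.
  apply: (@measurableT_comp _ _ _ _ _ _ (\1_N : U * U -> R)); first exact: measurable_indic.
  apply: measurable_fun_pair => //.
  exact: (measurableT_comp (measurable_tnth i)).
have E v : (\sum_(i < m) \1_N (F v, tnth (G v) i) = (hits (nb (F v)) (G v))%:R :> R)%R.
  rewrite /hits -sum1_count natr_sum big_tuple [RHS]big_mkcond/=.
  apply: eq_bigr => i _; rewrite indicE.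
  have -> : ((F v, tnth (G v) i) \in N) = (tnth (G v) i \in nb (F v)).
    by apply/idP/idP; rewrite !inE.
  by case: (_ \in _).
by apply/seteqP; split => v /=; rewrite E ltr_nat// => -[].
Qed.

Lemma prob_neighbors_lt m k (l : m.-tuple nat) j : uniq (k :: l) ->
  P [set w | (hits (nb (X k w)) (rv_tuple l w) < j)%N] =
  \int[mu]_x (binlt m j (fine (mu (nb x))))%:E.
Proof.
move=> /[dup] ukl /andP[_ ul].
rewrite (@fubini_rv_tuple m k l [set p | (hits (nb p.1) p.2 < j)%N])//.
  by apply: eq_integral => x _ /=; apply: prob_hits_lt => //; exact: measurable_nb.
by apply: measurable_hits_nb; [exact: measurable_fst|exact: measurable_snd].
Qed.

Lemma measurable_prob_section m (l : m.-tuple nat) (E : set (U * m.-tuple U)) :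
  measurable E -> measurable_fun setT (fun x => P [set w | E (x, rv_tuple l w)]).
Proof.
move=> mE; rewrite (_ : (fun _ => _) = distribution P (rv_tuple l) \o xsection E).
  exact: measurable_fun_xsection.
apply/funext => x /=; congr (P _).
by apply/seteqP; split => w; rewrite /xsection/= inE.
Qed.

(** In the application [nb x] is the ball of radius r around x and [near x] the ball of radius r +
    r. *)
Variable near : U -> set U.
Hypothesis mnear : measurable [set p : U * U | near p.1 p.2].
Hypothesis far_disjoint : forall x y, ~ near x y -> nb x `&` nb y = set0.

(** Both distinguished points are frozen in turn. For positions x and y that are not near, the two
    sets are disjoint and [prob_hits2_lt] factors the bound; near positions contribute nothing to
    the event. *)
Lemma prob_neighbors2_lt m k1 k2 (l : m.-tuple nat) j : uniq [:: k1, k2 & l] ->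
  P [set w | [/\ ~ near (X k1 w) (X k2 w),
    (hits (nb (X k1 w)) (rv_tuple l w) < j)%N &
    (hits (nb (X k2 w)) (rv_tuple l w) < j)%N]] <=
  (\int[mu]_x (binlt m j (fine (mu (nb x))))%:E) *
  (\int[mu]_x (binlt m j (fine (mu (nb x))))%:E).
Proof.
move=> /[dup] ukkl /=/andP[_ ukl].
pose E2 := [set q : U * (U * m.-tuple U) | [/\ ~ near q.1 q.2.1,
  (hits (nb q.1) q.2.2 < j)%N & (hits (nb q.2.1) q.2.2 < j)%N]].
have mE2 : measurable E2.
  have m21 : measurable_fun setT (fun q : U * (U * m.-tuple U) => q.2.1).
    by apply: (measurableT_comp measurable_fst); exact: measurable_snd.
  have m22 : measurable_fun setT (fun q : U * (U * m.-tuple U) => q.2.2).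
    by apply: (measurableT_comp measurable_snd); exact: measurable_snd.
  rewrite (_ : E2 = ((fun q => (q.1, q.2.1)) @^-1` (~` [set p : U * U | near p.1 p.2])) `&`
    ([set q | (hits (nb q.1) q.2.2 < j)%N] `&` [set q | (hits (nb q.2.1) q.2.2 < j)%N])); last first.
    by apply/seteqP; split => q /=; [move=> [? ? ?]|move=> [? [? ?]]].
  apply: measurableI; last by apply: measurableI; exact: measurable_hits_nb.
  rewrite -[X in measurable X]setTI.
  by apply: measurable_fun_pair => //; exact: measurableC.
pose l' := [tuple of k2 :: l].
pose E1 := (fun p : U * m.+1.-tuple U => (p.1, (thead p.2, [tuple of behead p.2]))) @^-1` E2.
have mE1 : measurable E1.
  rewrite -[X in measurable X]setTI.
  apply: measurable_fun_pair => //; apply: measurable_fun_pair.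
    by apply: (measurableT_comp (measurable_tnth ord0)); exact: measurable_snd.
  by apply: (measurableT_comp (@measurable_behead _ _ _)); exact: measurable_snd.
have VE w : (thead (rv_tuple l' w), [tuple of behead (rv_tuple l' w)]) =
    (X k2 w, rv_tuple l w).
  by rewrite rv_tuple_cons theadE; congr pair; exact/val_inj.
have E1E x w : E1 (x, rv_tuple l' w) = E2 (x, (X k2 w, rv_tuple l w)).
  by rewrite -VE.
have b0 x : (0 <= binlt m j (fine (mu (nb x))))%R by apply: binlt_ge0; exact: mu_nb01.
set I := integral _ _ _.
rewrite [leLHS](_ : _ = P [set w | E1 (X k1 w, rv_tuple l' w)]); last first.
  by congr (P _); apply/funext => w /=; rewrite E1E.
rewrite (@fubini_rv_tuple _ k1 l' E1)//.
have I0 : 0 <= I by apply: integral_ge0 => x _; rewrite lee_fin.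
rewrite {1}/I -(ge0_integralZr mu measurableT (measurable_binlt_nb m j))//; last first.
  by move=> x _; rewrite lee_fin.
apply: ge0_le_integral => //.
- exact: measurable_prob_section.
- by apply: emeasurable_funM => //; exact: measurable_binlt_nb.
move=> x _.
rewrite [leLHS](_ : _ = P [set w | E2 (x, (X k2 w, rv_tuple l w))]); last first.
  by congr (P _); apply/funext => w /=; rewrite E1E.
have mE2x : measurable [set p | E2 (x, p)].
  by rewrite -[X in measurable X]setTI; exact: (@pair1_measurable _ _ _ _ x).
rewrite (@fubini_rv_tuple _ k2 l [set p | E2 (x, p)])//=.
rewrite -(ge0_integralZl mu measurableT (measurable_binlt_nb m j))//; last 2 first.
- by move=> y _; rewrite lee_fin.
- by rewrite lee_fin.
apply: ge0_le_integral => //.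
- exact: (@measurable_prob_section _ _ [set p | E2 (x, p)]).
- by apply: emeasurable_funM => //; exact: measurable_binlt_nb.
move=> y _; have [xy|xy] := pselect (near x y).
  rewrite (_ : [set _ | _] = set0) ?measure0; first by rewrite -EFinM lee_fin mulr_ge0.
  by apply/seteqP; split => // w; rewrite /E2/= => -[].
case/andP : ukl => _ ul.
apply: le_trans (prob_hits2_lt j j ul (measurable_nb x) (measurable_nb y) (far_disjoint xy)).
apply: le_measure; rewrite ?inE.
- apply: (@measurable_rv_tuple_preimage _ l [set t | E2 (x, (y, t))]).
  by have := @pair1_measurable _ _ U (m.-tuple U) y measurableT _ mE2x; rewrite setTI.
- apply: (@measurable_rv_tuple_preimage _ l
    ([set t | (hits (nb x) t < j)%N] `&` [set t | (hits (nb y) t < j)%N])).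
  by apply: measurableI; apply: measurable_hits_lt; exact: measurable_nb.
- by move=> w; rewrite /E2/= => -[].
Qed.

End neighbors.

End independent_tuples.

(** * Nearest neighbor distances *)

Section nearest_neighbor_distance.
Context {R : realType} {d : nat}.
Implicit Types (x y : d.-tuple R) (A : {fset d.-tuple R}) (r : R).

Lemma knn_dist_ge0 j x A : 0 <= knn_dist j x A.
Proof.
rewrite /knn_dist; case: ifP => // _.
set s := sort _ _; have [js|js] := ltnP j.-1 (size s); last by rewrite nth_default.
have : nth 0 s j.-1 \in s by exact: mem_nth.
by rewrite mem_sort => /mapP[y _ ->]; exact: edist_ge0.
Qed.

(** In a sorted list the entry of rank j exceeds r exactly when fewer than j entries are at most r.
    The condition on the cardinality accounts for the default distance 0, which never exceeds r. *)
Lemma lt_knn_dist j x A r : (0 < j)%N -> x \in A -> 0 <= r ->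
  (r < knn_dist j x A) = (j < #|` A|)%N &&
  (count (fun y => edist x y <= r)%R (enum_fset (A `\ x)%fset) < j)%N.
Proof.
move=> j0 xA r0; rewrite /knn_dist; case: ifP => jA /=; last by rewrite ltNge r0.
set s := [seq edist x y | y <- _].
have js : (j.-1 < size (sort <=%R s))%N.
  rewrite size_sort size_map.
  by move: jA; rewrite (cardfsD1 x) xA add1n ltnS /= => /(leq_trans _) ->//; rewrite prednK.
have sorts : sorted <=%R (sort <=%R s) by exact: sort_le_sorted.
have -> : count (fun y => edist x y <= r)%R (enum_fset (A `\ x)%fset) =
    count (<= r)%R (sort <=%R s).
  by rewrite (permP (permEl (perm_sort _ _))) count_map.
case: (ltnP (count _ _) j) => cj.
  by apply: nth_count_gt => //; rewrite js andbT -ltnS prednK.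
apply/negbTE; rewrite -leNgt; apply: nth_count_le => //.
by rewrite prednK.
Qed.

Section sample.
Variables (z : nat -> d.-tuple R) (n : nat).

Let zs (s : seq nat) := [seq z k | k <- s].

(** Counts do not depend on the order of enumeration, so the finite set can be replaced by a list
    without duplicates, on which measurability is proved by induction. *)
Lemma perm_sample : perm_eq (enum_fset (sample z n)) (undup (zs (iota 0 n))).
Proof.
apply: uniq_perm; [exact: fset_uniq|exact: undup_uniq|].
move=> y; rewrite mem_undup; apply/idP/idP.
  move=> /imfsetP[/= i _ ->]; apply/mapP; exists (val i) => //.
  by rewrite mem_iota/=.
move=> /mapP[k]; rewrite mem_iota/= add0n => kn ->.
by apply/imfsetP; exists (Ordinal kn).
Qed.

Lemma mem_sample i : (i < n)%N -> z i \in sample z n.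
Proof. by move=> ni; apply/imfsetP; exists (Ordinal ni). Qed.

Lemma count_sampleD1 x (a : pred (d.-tuple R)) :
  count a (enum_fset (sample z n `\ x)%fset) =
  count (fun y => (y != x) && a y) (undup (zs (iota 0 n))).
Proof.
rewrite -(permP perm_sample).
transitivity (count a [seq y <- enum_fset (sample z n) | y != x]); last first.
  by rewrite count_filter; apply: eq_count => y /=; rewrite andbC.
apply/permP/uniq_perm; [exact: fset_uniq|by rewrite filter_uniq//; exact: fset_uniq|].
by move=> y; rewrite mem_filter !inE.
Qed.

Lemma card_sample : #|` sample z n| = size (undup (zs (iota 0 n))).
Proof. exact: (perm_size perm_sample). Qed.

Lemma lt_knn_dist_sample j i r : (0 < j)%N -> (i < n)%N -> 0 <= r ->
  (r < knn_dist j (z i) (sample z n)) =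
  (j < count predT (undup (zs (iota 0 n))))%N &&
  (count (fun y => (y != z i) && (edist (z i) y <= r)%R) (undup (zs (iota 0 n))) < j)%N.
Proof.
by move=> j0 ni r0; rewrite lt_knn_dist ?mem_sample// card_sample count_sampleD1 count_predT.
Qed.

(* The sample is a set, so its size and its neighbor counts are those of the
   list of sample points only when these points are distinct. *)
Lemma lt_knn_dist_distinct j i (s : seq nat) r :
  (0 < j)%N -> (j < n)%N -> (i < n)%N -> 0 <= r ->
  uniq (zs (iota 0 n)) -> perm_eq (iota 0 n) (i :: s) ->
  (r < knn_dist j (z i) (sample z n)) =
  (count (fun y => edist (z i) y <= r)%R (zs s) < j)%N.
Proof.
move=> j0 jn ni r0 uz ps.
rewrite lt_knn_dist_sample// undup_id// count_predT size_map size_iota jn /=.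
have pz := perm_map z ps.
rewrite (permP pz)/= eqxx/= add0n.
congr (_ < _)%N; apply: eq_in_count => y ys.
rewrite -[LHS]/((y != z i) && _) (_ : y != z i)//.
move: uz; rewrite (perm_uniq pz)/= => /andP[+ _].
by apply: contra => /eqP <-.
Qed.

End sample.

End nearest_neighbor_distance.

(** * Measurability of nearest neighbor distances *)

Section measurability.
Context {R : realType} {d : nat} {dT} {T : measurableType dT}.
Variable X : nat -> T -> d.-tuple R.
Hypothesis mX : forall i, measurable_fun setT (X i).

Lemma measurable_eq_rv i k : measurable_fun setT (fun w => X i w == X k w).
Proof.
rewrite (_ : (fun _ => _) = (fun w => edist (X i w) (X k w) <= 0)).
  by apply: measurable_fun_ler => //; exact: measurable_edist.
apply/funext => w; apply/eqP/idP => [->|e0]; first by rewrite edistxx.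
by apply: edist_eq0; apply/eqP; rewrite eq_le e0 edist_ge0.
Qed.

Lemma measurable_mem_rv i (s : seq nat) :
  measurable_fun setT (fun w => X i w \in [seq X k w | k <- s]).
Proof.
elim: s => [|k s IH] /=.
  by under eq_fun do rewrite in_nil; exact: measurable_cst.
under eq_fun do rewrite inE.
by apply: measurable_or => //; exact: measurable_eq_rv.
Qed.

Lemma measurable_count_undup (a : T -> d.-tuple R -> bool) (s : seq nat) :
  (forall k, measurable_fun setT (fun w => a w (X k w))) ->
  measurable_fun setT (fun w => count (a w) (undup [seq X k w | k <- s])).
Proof.
move=> ma; elim: s => [|k s IH] /=; first exact: measurable_cst.
rewrite (_ : (fun _ => _) = (fun w => if X k w \in [seq X k0 w | k0 <- s] then
   count (a w) (undup [seq X k0 w | k0 <- s]) else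
   (a w (X k w) + count (a w) (undup [seq X k0 w | k0 <- s])))%N); last first.
  by apply/funext => w; case: ifP.
apply: measurable_fun_ifT => //; first exact: measurable_mem_rv.
apply: measurable_fun_addn => //.
exact: (@measurableT_comp _ _ _ _ _ _ (fun b : bool => b : nat)).
Qed.

(** Rays generate the Borel sets, and each event that the distance exceeds r is a condition on two
    counts that remains valid when sample points coincide. *)
Lemma measurable_knn_dist j i n : (0 < j)%N -> (i < n)%N ->
  measurable_fun setT (fun w => knn_dist j (X i w) (sample (fun k => X k w) n)).
Proof.
move=> j0 ni; apply: (measurability _ (RGenOInfty.measurableE R)) => /= _ [_ [r ->] <-].
rewrite setTI; have [r0|r0] := ltP r 0.
  rewrite (_ : _ @^-1` _ = setT)//; apply/seteqP; split => // w _ /=.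
  by rewrite in_itv/= andbT (lt_le_trans r0)// knn_dist_ge0.
rewrite (_ : _ @^-1` _ =
  setT `&` (fun w => (j < count predT (undup [seq X k w | k <- iota 0 n]))%N &&
  (count (fun y => (y != X i w) && (edist (X i w) y <= r)%R)
    (undup [seq X k w | k <- iota 0 n]) < j)%N) @^-1` [set true]); last first.
  by rewrite setTI; apply/seteqP; split => w /=; rewrite in_itv/= andbT
    (@lt_knn_dist_sample _ _ (fun k => X k w)).
apply: measurable_and => //.
  apply: measurable_fun_ltn; first exact: measurable_cst.
  exact: (@measurable_count_undup (fun _ => predT)).
apply: measurable_fun_ltn => //; apply: measurable_count_undup => k.
apply: measurable_and; last by apply: measurable_fun_ler => //; exact: measurable_edist.
by apply: measurable_neg; exact: measurable_eq_rv.
Qed.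

Lemma measurable_uniq_rv (s : seq nat) :
  measurable_fun setT (fun w => uniq [seq X k w | k <- s]).
Proof.
elim: s => [|k s IH] /=; first exact: measurable_cst.
by apply: measurable_and => //; apply: measurable_neg; exact: measurable_mem_rv.
Qed.

End measurability.

(** * Exceedance probabilities for one and for two sample points *)

Section exceedance_probabilities.
Context {R : realType} {d : nat} {dT} {T : measurableType dT}.
Variables (P : probability T R) (X : nat -> {RV P >-> d.-tuple R}).
Variable mu : probability (d.-tuple R) R.
Hypothesis Xindep : mutually_independent X.
Hypothesis Xmu : forall i (B : set (d.-tuple R)), measurable B ->
  P (X i @^-1` B) = mu B.
Hypothesis mu_atomless : forall x, mu [set x] = 0%E.
Local Open Scope ereal_scope.

Lemma le_prob_null (A B N : set T) : measurable A -> measurable B ->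
  measurable N -> P N = 0 -> A `<=` B `|` N -> P A <= P B.
Proof.
move=> mA mB mN PN AB; apply: (@le_trans _ _ (P (B `|` N))).
  by apply: le_measure; rewrite ?inE//; exact: measurableU.
apply: (@le_trans _ _ (P B + P N)); first exact: measureU2.
by rewrite PN adde0.
Qed.

Lemma measurable_eball_pair r :
  measurable [set p : d.-tuple R * d.-tuple R | eball p.1 r p.2].
Proof.
apply: (measurable_set_bool (b := fun p : d.-tuple R * d.-tuple R => edist p.1 p.2 <= r)%R).
by apply: measurable_fun_ler => //; apply: measurable_edist.
Qed.

Lemma prob_pair i k (D : set (d.-tuple R * d.-tuple R)) : i != k -> measurable D ->
  P [set w | D (X i w, X k w)] = \int[mu]_x mu [set y | D (x, y)].
Proof.
move=> ik mD; pose F (p : d.-tuple R * 1.-tuple (d.-tuple R)) := (p.1, thead p.2).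
have mF : measurable_fun setT F.
  apply: measurable_fun_pair; first exact: measurable_fst.
  by apply: (measurableT_comp (measurable_tnth ord0)); exact: measurable_snd.
have E w : thead (rv_tuple X [tuple k] w) = X k w.
  by rewrite /thead tnth_mktuple.
transitivity (P [set w | (F @^-1` D) (X i w, rv_tuple X [tuple k] w)]).
  by congr (P _); apply/funext => w; rewrite /F/= E.
rewrite (@fubini_rv_tuple _ _ _ _ _ P X mu Xindep Xmu)//; last 2 first.
- by rewrite /= inE ik.
- by rewrite -[X in measurable X]setTI; exact: mF.
apply: eq_integral => x _.
have mDx : measurable [set y | D (x, y)].
  by rewrite -[X in measurable X]setTI; exact: pair1_measurable.
rewrite -(Xmu k mDx); congr (P _).
by apply/funext => w; rewrite /F/= E.
Qed.

Lemma prob_eq_rv i k : i != k -> P [set w | X i w = X k w] = 0.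
Proof.
move=> ik; pose D := [set p : d.-tuple R * d.-tuple R | p.1 = p.2].
(* Seen as a relation at distance 0, the diagonal is measurable by the lemma on balls. *)
have DE : D = [set p | eball p.1 0 p.2].
  apply/seteqP; split => [p/= ->|p /= e0]; first by rewrite /eball/= edistxx.
  by apply: edist_eq0; apply/eqP; rewrite eq_le edist_ge0 andbT.
rewrite (@prob_pair i k D)//; last by rewrite DE; exact: measurable_eball_pair.
rewrite integral0_eq// => x _; rewrite -[RHS](mu_atomless x); congr (mu _).
by apply/seteqP; split => y; rewrite /D/= => ->.
Qed.

Lemma prob_mem_rv k (s : seq nat) : k \notin s ->
  P [set w | X k w \in [seq X i w | i <- s]] = 0.
Proof.
elim: s => [|i s IH] /= ks.
  by rewrite (_ : [set _ | _] = set0) ?measure0//; apply/seteqP; split.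
move: ks; rewrite inE negb_or => /andP[ki ks].
have m1 : measurable [set w | X k w = X i w].
  rewrite (_ : [set _ | _] = [set w | X k w == X i w]).
    by apply: measurable_set_bool; apply: (@measurable_eq_rv _ _ _ _ (fun i => X i)).
  by apply/seteqP; split => w /= /eqP.
have m2 s' : measurable [set w | X k w \in [seq X i w | i <- s']].
  by apply: measurable_set_bool; exact: measurable_mem_rv.
apply/eqP; rewrite eq_le measure_ge0 andbT -(prob_eq_rv ki).
apply: (le_prob_null _ _ _ (IH ks)) => //; first exact: (m2 (i :: s)).
by move=> w /=; rewrite inE => /orP[/eqP|]; [left|right].
Qed.

Lemma prob_not_uniq_rv (s : seq nat) : uniq s ->
  P [set w | ~~ uniq [seq X i w | i <- s]] = 0.
Proof.
elim: s => [|k s IH] /= us.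
  by rewrite (_ : [set _ | _] = set0) ?measure0//; apply/seteqP; split.
case/andP : us => ks us.
have m1 s' : measurable [set w | X k w \in [seq X i w | i <- s']].
  by apply: measurable_set_bool; exact: measurable_mem_rv.
have m2 s' : measurable [set w | ~~ uniq [seq X i w | i <- s']].
  by apply: measurable_set_bool; apply: measurable_neg; exact: measurable_uniq_rv.
apply/eqP; rewrite eq_le measure_ge0 andbT -(prob_mem_rv ks).
apply: (le_prob_null _ _ _ (IH us)) => //; first exact: (m2 (k :: s)).
by move=> w /=; rewrite negb_and negbK => /orP[]; [left|right].
Qed.

Local Notation D j n i w := (knn_dist j (X i w) (sample (fun k => X k w) n)).

Lemma measurable_knn_gt j n i r : (0 < j)%N -> (i < n)%N ->
  measurable [set w | (r < D j n i w)%R].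
Proof.
move=> j0 ni; apply: (measurable_set_bool (b := fun w => r < D j n i w)%R).
by apply: measurable_fun_ltr => //; exact: measurable_knn_dist.
Qed.

Lemma hits_eball m (l : m.-tuple nat) x r w :
  hits (eball x r) (rv_tuple X l w) =
  count (fun y => edist x y <= r)%R [seq X k w | k <- l].
Proof.
rewrite /hits (_ : tval (rv_tuple X l w) = [seq X k w | k <- l]).
  by apply: eq_count => y; apply/idP/idP; rewrite inE.
transitivity (tval (map_tuple (fun k => X k w) l)) => //; congr tval.
by apply: eq_from_tnth => i; rewrite tnth_mktuple tnth_map.
Qed.

Let measurable_hits_eball m (l : m.-tuple nat) j k r :
  measurable [set w | (hits (eball (X k w) r) (rv_tuple X l w) < j)%N].
Proof.
exact: (measurable_hits_nb (R := R) (nb := fun x => eball x r)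
  (measurable_eball_pair r) j (measurable_funPT (X k)) (measurable_rv_tuple X l)).
Qed.

(** Off the null event that two sample points coincide, the event says that fewer than j of the n -
    1 other points fall in the ball around [X i]. *)
Lemma prob_knn_gt j n i r : (0 < j)%N -> (j < n)%N -> (i < n)%N -> (0 <= r)%R ->
  P [set w | (r < D j n i w)%R] =
  \int[mu]_x (binlt n.-1 j (fine (mu (eball x r))))%:E.
Proof.
move=> j0 jn ni r0.
have ii : i \in iota 0 n by rewrite mem_iota.
have sl : size (rem i (iota 0 n)) == n.-1 by rewrite size_rem// size_iota.
pose l := Tuple sl.
have pl : perm_eq (iota 0 n) (i :: l) by exact: perm_to_rem.
have ul : uniq (i :: l) by rewrite -(perm_uniq pl) iota_uniq.
rewrite -(prob_neighbors_lt Xindep Xmu (nb := fun x => eball x r) (measurable_eball_pair r) j ul).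
have mN : measurable [set w | ~~ uniq [seq X k w | k <- iota 0 n]].
  by apply: measurable_set_bool; apply: measurable_neg; exact: measurable_uniq_rv.
have N0 := prob_not_uniq_rv (iota_uniq 0 n).
have m1 := measurable_knn_gt r j0 ni.
have m2 := measurable_hits_eball l j i r.
apply/eqP; rewrite eq_le; apply/andP; split; apply: (le_prob_null _ _ mN N0) => // w /= H.
  have [uw|] := boolP (uniq [seq X k w | k <- iota 0 n]); [left|by right].
  by rewrite hits_eball -(lt_knn_dist_distinct (n := n) (z := fun k => X k w)).
have [uw|] := boolP (uniq [seq X k w | k <- iota 0 n]); [left|by right].
by rewrite (lt_knn_dist_distinct (s := l) (z := fun k => X k w))// -hits_eball.
Qed.

(** Leaving [X k] out of the count around [X i], and conversely, only enlarges the event and makes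
    both counts run over the same n - 2 points. The first term pays for the pairs whose balls may
    meet. *)
Lemma prob_knn_gt2 j n i k r : (0 < j)%N -> (j < n)%N -> (i < n)%N -> (k < n)%N ->
  i != k -> (0 <= r)%R ->
  P [set w | (r < D j n i w)%R /\ (r < D j n k w)%R] <=
  \int[mu]_x mu (eball x (r + r)) +
  (\int[mu]_x (binlt n.-2 j (fine (mu (eball x r))))%:E) *
  (\int[mu]_x (binlt n.-2 j (fine (mu (eball x r))))%:E).
Proof.
move=> j0 jn ni nk ik r0.
have ii : i \in iota 0 n by rewrite mem_iota.
have kk : k \in rem i (iota 0 n).
  by rewrite mem_rem_uniq ?iota_uniq// !inE eq_sym ik mem_iota.
have sl : size (rem k (rem i (iota 0 n))) == n.-2 by rewrite !size_rem// size_iota.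
pose l := Tuple sl.
have pl : perm_eq (iota 0 n) [:: i, k & l].
  by rewrite (permPl (perm_to_rem ii)) perm_cons; exact: perm_to_rem.
have pl' : perm_eq (iota 0 n) [:: k, i & l].
  rewrite (permPl pl) -[[:: i, k & l]]/([:: i; k] ++ l) -[[:: k, i & l]]/([:: k; i] ++ l).
  by rewrite perm_cat2r (perm_catC [:: i] [:: k]).
have ul : uniq [:: i, k & l] by rewrite -(perm_uniq pl) iota_uniq.
have mN : measurable [set w | ~~ uniq [seq X k w | k <- iota 0 n]].
  by apply: measurable_set_bool; apply: measurable_neg; exact: measurable_uniq_rv.
have N0 := prob_not_uniq_rv (iota_uniq 0 n).
have mnear : measurable [set w | eball (X i w) (r + r) (X k w)].
  apply: (measurable_set_bool (b := fun w => edist (X i w) (X k w) <= r + r)%R).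
  by apply: measurable_fun_ler => //; exact: measurable_edist.
have mh m := measurable_hits_eball l j m r.
pose H := [set w | [/\ ~ eball (X i w) (r + r) (X k w),
    (hits (eball (X i w) r) (rv_tuple X l w) < j)%N &
    (hits (eball (X k w) r) (rv_tuple X l w) < j)%N]].
have mH : measurable H.
  rewrite (_ : H = ~` [set w | eball (X i w) (r + r) (X k w)] `&`
    ([set w | (hits (eball (X i w) r) (rv_tuple X l w) < j)%N] `&`
     [set w | (hits (eball (X k w) r) (rv_tuple X l w) < j)%N])).
    by apply: measurableI; [exact: measurableC|exact: measurableI].
  by apply/seteqP; split => w /=; [move=> [? ? ?]|move=> [? [? ?]]].
apply: (@le_trans _ _ (P ([set w | eball (X i w) (r + r) (X k w)] `|` H))).
  apply: (le_prob_null _ _ mN N0).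
  - rewrite (_ : [set w | _] = [set w | (r < D j n i w)%R] `&` [set w | (r < D j n k w)%R])//.
    by apply: measurableI; exact: measurable_knn_gt.
  - exact: measurableU.
  move=> w /= [ri rk].
  have [uw|] := boolP (uniq [seq X k w | k <- iota 0 n]); [left|by right].
  have [?|nr] := pselect (eball (X i w) (r + r) (X k w)); [by left|right].
  split => //; rewrite hits_eball.
    move: ri; rewrite (lt_knn_dist_distinct (s := k :: l) (z := fun k => X k w))//.
    by apply: leq_ltn_trans; rewrite /= leq_addl.
  move: rk; rewrite (lt_knn_dist_distinct (s := i :: l) (z := fun k => X k w))//.
  by apply: leq_ltn_trans; rewrite /= leq_addl.
apply: (le_trans (measureU2 _ _ _)) => //; apply: leeD.
  have := @prob_pair i k [set p | eball p.1 (r + r) p.2] ik (measurable_eball_pair _).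
  by move=> /= ->.
apply: (prob_neighbors2_lt Xindep Xmu (nb := fun x => eball x r) (measurable_eball_pair r) (near := fun x => eball x (r + r)) (measurable_eball_pair _) _ j ul).
move=> x y nxy; apply/seteqP; split => // z /= [xz yz]; apply: nxy.
by rewrite /eball/= (le_trans (edist_triangle z _ _))// lerD// edistC.
Qed.

End exceedance_probabilities.

(** * Tails of the density and the uniform bound *)

Section density_measure.
Context {R : realType} {dU} {U : measurableType dU}.
Variables (nu : {measure set U -> \bar R}) (mu : {measure set U -> \bar R}).
Variable f : U -> R.
Hypothesis mf : measurable_fun setT f.
Hypothesis f0 : forall x, (0 <= f x)%R.
Hypothesis muE : forall B, measurable B -> mu B = (\int[nu]_(x in B) (f x)%:E)%E.
Local Open Scope ereal_scope.

Import HBNNSimple.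

(** The hypothesis is the case of indicators; linearity gives simple functions and monotone
    convergence the rest. *)
Lemma ge0_integral_density (g : U -> \bar R) : measurable_fun setT g ->
  (forall x, 0 <= g x) -> \int[mu]_x g x = \int[nu]_x (g x * (f x)%:E).
Proof.
move=> mg g0.
have mfE : measurable_fun setT (fun x => (f x)%:E : \bar R) by exact/measurable_EFinP.
pose h (n : nat) (x : U) : R := nnsfun_approx measurableT mg n x.
have h0 n x : (0 <= h n x)%R by exact: fun_ge0.
have mh n : measurable_fun setT (fun x => (h n x)%:E : \bar R) by exact/measurable_EFinP/measurable_funPT.
have hnd x : {homo (fun n => (h n x)%:E) : m n / (m <= n)%N >-> m <= n}.
  by move=> m n mn; rewrite lee_fin; exact/lefP/nd_nnsfun_approx.
have hcvg x : (h n x)%:E @[n --> \oo] --> g x.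
  by apply: cvg_nnsfun_approx => // y _.
have L : \int[mu]_x (h n x)%:E @[n --> \oo] --> \int[mu]_x g x.
  rewrite (_ : \int[mu]_x g x = \int[mu]_x limn (fun n => (h n x)%:E)); last first.
    by apply: eq_integral => x _; apply/esym/cvg_lim.
  by apply: cvg_monotone_convergence => // n x _; rewrite lee_fin.
have L' : \int[nu]_x ((h n x)%:E * (f x)%:E) @[n --> \oo] --> \int[nu]_x (g x * (f x)%:E).
  rewrite (_ : \int[nu]_x (g x * _) = \int[nu]_x limn (fun n => (h n x)%:E * (f x)%:E)); last first.
    apply: eq_integral => x _; apply/esym/cvg_lim => //.
    by apply: cvgeZr => //; exact: hcvg.
  apply: cvg_monotone_convergence => //.
  - by move=> n; exact: emeasurable_funM.
  - by move=> n x _; rewrite mule_ge0// lee_fin.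
  - by move=> x _ m n mn; rewrite lee_wpmul2r ?lee_fin//; exact: hnd.
suff E n : \int[mu]_x (h n x)%:E = \int[nu]_x ((h n x)%:E * (f x)%:E).
  by move: L'; rewrite (eq_cvg _ _ (fun n => esym (E n))) => /(cvg_unique _ L); apply.
have muA k : mu (h n @^-1` [set k]) = \int[nu]_x ((\1_(h n @^-1` [set k]) x)%:E * (f x)%:E).
  have mA : measurable (h n @^-1` [set k]) by exact: measurable_sfunP.
  rewrite muE// integral_mkcond; apply: eq_integral => x _.
  by rewrite patchE indicE; case: ifPn => _; rewrite ?mul1e ?mul0e.
have mA k : measurable (h n @^-1` [set k]) by exact: measurable_sfunP.
have mi k : measurable_fun setT (fun x => (\1_(h n @^-1` [set k]) x)%:E : \bar R).
  by apply/measurable_EFinP; exact: measurable_indic.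
have ki0 k x : 0 <= (k * \1_(h n @^-1` [set k]) x)%:E.
  exact: (nnfun_muleindic_ge0 (nnsfun_approx measurableT mg n)).
transitivity (\sum_(k \in range (h n)) \int[mu]_x (k * \1_(h n @^-1` [set k]) x)%:E).
  under eq_integral do rewrite /h fimfunE -fsumEFin//.
  rewrite ge0_integral_fsum//.
  by move=> k; apply/measurable_EFinP; apply: measurable_funM => //; exact/measurable_EFinP.
transitivity (\sum_(k \in range (h n)) \int[nu]_x ((k * \1_(h n @^-1` [set k]) x)%:E * (f x)%:E)); last first.
  under [RHS]eq_integral do rewrite {1}/h fimfunE -fsumEFin// ge0_mule_fsuml//.
  rewrite ge0_integral_fsum//.
  - move=> k; apply: emeasurable_funM => //.
    by apply/measurable_EFinP; apply: measurable_funM => //; exact/measurable_EFinP.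
  - by move=> k x _; rewrite mule_ge0// lee_fin.
apply: eq_fsbigr => k; rewrite inE => -[x _ kx].
have k0 : (0 <= k)%R by rewrite -kx.
under eq_integral do rewrite EFinM.
under [RHS]eq_integral do rewrite EFinM -muleA.
have mif : measurable_fun setT (fun y => (\1_(h n @^-1` [set k]) y)%:E * (f y)%:E).
  exact: emeasurable_funM.
rewrite ge0_integralZl//.
rewrite (ge0_integralZl _ measurableT mif)//; last first.
  by move=> y _; rewrite mule_ge0// lee_fin.
by rewrite -muA integral_indic// setIT.
Qed.

End density_measure.

Section tail.
Context {R : realType} {d : nat}.
Local Notation V := (d.+1.-tuple R).
Local Notation leb := (@lebesgue_tuple R d.+1).
Local Notation D := (d.+1%:R : R).
Variables (f : V -> R) (mu : probability V R) (beta C : R).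
Hypothesis mf : measurable_fun setT f.
Hypothesis f0 : forall x, 0 <= f x.
Hypothesis muE : forall B, measurable B -> mu B = (\int[leb]_(x in B) (f x)%:E)%E.
Hypothesis C0 : 0 < C.
Hypothesis betaD : D < beta.
Hypothesis f_upper : forall x, C <= enorm x -> f x < C * enorm x `^ (- beta).
Hypothesis f_lower : forall x, C <= enorm x -> C^-1 * enorm x `^ (- beta) < f x.

Definition outside (M : R) : set V := [set x | M < enorm x].
Definition annulus (M : R) : set V := [set x | M < enorm x <= 2 * M].

Lemma measurable_outside M : measurable (outside M).
Proof.
apply: (@measurable_set_bool _ _ (fun x : V => M < enorm x)).
by apply: measurable_fun_ltr => //; exact: measurable_enorm.
Qed.

Lemma measurable_annulus M : measurable (annulus M).
Proof.
apply: (@measurable_set_bool _ _ (fun x : V => M < enorm x <= 2 * M)).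
by apply: measurable_and; [apply: measurable_fun_ltr|apply: measurable_fun_ler] => //;
  exact: measurable_enorm.
Qed.

Lemma outside_annulus M : 0 <= M -> outside M = annulus M `|` outside (2 * M).
Proof.
move=> M0; apply/seteqP; split => x /=; rewrite /outside/annulus/=.
  by move=> ->; case: (leP (enorm x) (2 * M)); [left|right].
by move=> [/andP[]//|]; apply: le_lt_trans; lra.
Qed.

Lemma annulus_outside0 M : annulus M `&` outside (2 * M) = set0.
Proof.
apply/seteqP; split => // x [] /=; rewrite /annulus/outside/= => /andP[_ h1].
by rewrite ltNge h1.
Qed.

Let omega : R := unit_ball_volume d.+1.
Let omega_gt0 : 0 < omega. Proof. exact: unit_ball_volume_gt0. Qed.

Let centered_ball (M : R) : set V := eball [tuple 0 | i < d.+1] M.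

Lemma in_centered_ball M x : centered_ball M x = (enorm x <= M) :> Prop.
Proof. by rewrite /centered_ball/eball/= edistC -enormE. Qed.

Lemma leb_annulus M : 0 < M -> leb (annulus M) = (omega * ((2 * M) ^+ d.+1 - M ^+ d.+1))%:E.
Proof.
move=> M0.
have M20 : 0 <= 2 * M by rewrite mulr_ge0// ltW.
have <- : centered_ball (2 * M) `\` centered_ball M = annulus M.
  apply/seteqP; split => x; rewrite /annulus /setD/= !in_centered_ball.
    by move=> [-> /negP]; rewrite -ltNge => ->.
  by move=> /andP[h1 h2]; split => //; apply/negP; rewrite -ltNge.
rewrite measureD//; last 3 first.
- exact: measurable_eball.
- exact: measurable_eball.
- by rewrite [X in (X < _)%E]lebesgue_eballE// ltry.
rewrite (_ : centered_ball (2 * M) `&` centered_ball M = centered_ball M); last first.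
  apply: setIidr => x; rewrite !in_centered_ball => /le_trans; apply.
  by move: M0; lra.
rewrite [X in (X - _)%E]lebesgue_eballE// [X in (_ - X)%E]lebesgue_eballE ?(ltW M0)//.
by rewrite -EFinB -/omega mulrBr.
Qed.

Definition tailmu M : R := fine (mu (outside M)).

Lemma tailmuE M : mu (outside M) = (tailmu M)%:E.
Proof. by rewrite /tailmu fineK// fin_num_measure//; exact: measurable_outside. Qed.

Lemma mu_annulus_le M : C <= M ->
  (mu (annulus M) <= (C * omega * 2 ^+ d.+1 * M `^ (D - beta))%:E)%E.
Proof.
move=> CM; have M0 : 0 < M by exact: lt_le_trans CM.
rewrite muE; last exact: measurable_annulus.
apply: (@le_trans _ _ (\int[leb]_(x in annulus M) (C * M `^ (- beta))%:E)%E).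
  apply: ge0_le_integral => //.
  - exact: measurable_annulus.
  - by move=> x _; rewrite lee_fin.
  - by apply: measurable_funTS; exact/measurable_EFinP.
  - move=> x; rewrite /annulus/= => /andP[Mx _]; rewrite lee_fin.
    apply: (le_trans (ltW (f_upper (le_trans CM (ltW Mx))))).
    rewrite ler_pM2l// !powRN lef_pV2 ?posrE ?powR_gt0//; last exact: lt_trans Mx.
    rewrite ge0_ler_powR ?nnegrE ?ltW//; last exact: lt_trans Mx.
    by apply: le_lt_trans betaD.
rewrite integral_cst; last exact: measurable_annulus.
rewrite [X in (_ * X)%E]leb_annulus// -EFinM lee_fin.
rewrite powRD; last by rewrite (gt_eqF M0) implybT.
rewrite powR_mulrn ?(ltW M0)// [leRHS](_ : _ = (C * M `^ (- beta)) * (omega * (2 * M) ^+ d.+1)); last by rewrite exprMn; ring.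
have := powR_ge0 M (- beta); have : 0 <= M ^+ d.+1 by rewrite exprn_ge0// ltW.
move=> h1 h2; rewrite ler_wpM2l ?mulr_ge0 ?(ltW C0)//.
by rewrite ler_pM2l// gerBl.
Qed.

Let q : R := 2 `^ (D - beta).
Let q1 : q < 1.
Proof.
rewrite /q -opprB powRN invf_lt1 ?powR_gt0//.
have b0 : 0 < beta - D by rewrite subr_gt0.
have := @gt0_ltr_powR R (beta - D) b0 1 2; rewrite powR1 !nnegrE; apply => //.
by rewrite ltr1n.
Qed.

(** The sum of the geometric series of ratio q = 2^(D - beta) formed by the bounds on the masses of
    the dyadic annuli. *)
Definition tail_const : R := C * omega * 2 ^+ d.+1 / (1 - q).

Lemma tail_const_gt0 : 0 < tail_const.
Proof. have h2 : 0 < 2 ^+ d.+1 :> R by rewrite exprn_gt0.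
apply: divr_gt0; last by rewrite subr_gt0; exact: q1.
by apply: mulr_gt0 => //; exact: mulr_gt0. Qed.

(** One dyadic annulus, stated as a monotonicity under doubling of M. Iterating it and letting the
    tail mass vanish replaces the summation of the series. *)
Lemma tailmu_step M : C <= M ->
  tailmu M - tail_const * M `^ (D - beta) <=
  tailmu (2 * M) - tail_const * (2 * M) `^ (D - beta).
Proof.
move=> CM; have M0 : 0 < M by exact: lt_le_trans CM.
have : (mu (outside M) <= (C * omega * 2 ^+ d.+1 * M `^ (D - beta))%:E + (tailmu (2 * M))%:E)%E.
  rewrite (outside_annulus (ltW M0)) -tailmuE.
  apply: le_trans (leeD2r _ (mu_annulus_le CM)).
  by apply: measureU2; [exact: measurable_annulus|exact: measurable_outside].
rewrite tailmuE -EFinD lee_fin powRM ?(ltW M0)// -/q.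
have E : C * omega * 2 ^+ d.+1 = tail_const * (1 - q).
  by rewrite /tail_const divfK// subr_eq0 gt_eqF.
by rewrite E; nra.
Qed.

Lemma cvg_tailmu M : 0 < M -> tailmu (2 ^+ k * M) @[k --> \oo] --> (0 : R).
Proof.
move=> M0; pose F k := outside (2 ^+ k * M).
have mF k : measurable (F k) by exact: measurable_outside.
have FI : \bigcap_k F k = set0.
  apply/seteqP; split => // x Fx.
  have := Fx (Num.truncn (enorm x / M)).+1 I; rewrite /F/outside/=.
  apply/negP; rewrite -leNgt -ler_pdivrMr//.
  apply: (le_trans (ltW (truncnS_gt _))).
  by rewrite -natrX ler_nat ltnW// ltn_expl.
have := @nonincreasing_cvg_mu _ _ _ mu F _ mF _ _.
rewrite FI measure0 => H.
suff /fine_cvgP[_ //] : (mu \o F) k @[k --> \oo] --> (0 : R)%:E.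
apply: H => //.
- by rewrite (le_lt_trans (probability_le1 _ _)) ?ltry.
- by move=> m n mn; apply/subsetPset => x; rewrite /F/outside/=;
    apply: le_lt_trans; rewrite ler_pM2r// ler_eXn2l// ltr1n.
Qed.

Lemma tailmu_le M : C <= M -> tailmu M <= tail_const * M `^ (D - beta).
Proof.
move=> CM; have M0 : 0 < M by exact: lt_le_trans CM.
have H k : tailmu M - tail_const * M `^ (D - beta) <= tailmu (2 ^+ k * M).
  apply: (@le_trans _ _ (tailmu (2 ^+ k * M) - tail_const * (2 ^+ k * M) `^ (D - beta))); last first.
    by rewrite gerBl mulr_ge0 ?powR_ge0// ltW// tail_const_gt0.
  elim: k => [|k IH]; first by rewrite expr0 mul1r.
  apply: (le_trans IH); rewrite exprS -mulrA; apply: tailmu_step.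
  by rewrite (le_trans CM)// ler_peMl ?(ltW M0)// exprn_ege1// ler1n.
rewrite -subr_le0; apply: (cvgr_to_ge (cvg_tailmu M0)).
by apply: nearW => k; exact: H.
Qed.

(* If beta rho <= D, every dyadic annulus contributes at least the same positive
   constant to the integral of f^rho. *)
Lemma exponent_gt (rho : R) : 0 < rho -> (Irho rho f < +oo)%E -> D < beta * rho.
Proof.
move=> rho0 Ifin; rewrite ltNge; apply/negP => bD.
pose g x : \bar R := (f x `^ rho)%:E.
have mg : measurable_fun setT g.
  by apply/measurable_EFinP; apply: (measurableT_comp (measurable_powR rho)).
have g0 x : (0 <= g x)%E by rewrite lee_fin powR_ge0.
pose J M := (\int[leb]_(x in outside M) g x)%E.
have beta0 : 0 < beta by apply: le_lt_trans betaD.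
(* On the annulus f^rho is at least (C^-1 (2 M)^(- beta))^rho, and the volume is omega (2^D - 1)
   M^D. The resulting power M^(D - beta rho) is at least its value at C because its exponent is
   nonnegative. *)
pose c : R := C^-1 `^ rho * 2 `^ (- (beta * rho)) * C `^ (D - beta * rho) * omega * (2 ^+ d.+1 - 1).
have c0 : 0 < c.
  have h2 : 0 < 2 ^+ d.+1 - 1 :> R by rewrite subr_gt0 exprn_egt1// ltr1n.
  rewrite /c; apply: mulr_gt0 => //; apply: mulr_gt0 => //.
  by apply: mulr_gt0; [apply: mulr_gt0|]; apply: powR_gt0; rewrite ?invr_gt0.
have Jstep M : C <= M -> (c%:E + J (2 * M)%R <= J M)%E.
  move=> CM; have M0 : 0 < M by exact: lt_le_trans CM.
  rewrite /J (outside_annulus (ltW M0)) ge0_integral_setU//; last 4 first.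
  - exact: measurable_annulus.
  - exact: measurable_outside.
  - exact: measurable_funTS.
  - by apply/disj_setPS; rewrite annulus_outside0.
  apply: leeD2r.
  apply: (@le_trans _ _ (\int[leb]_(x in annulus M) (C^-1 `^ rho * (2 * M) `^ (- (beta * rho)))%:E)%E).
    rewrite integral_cst; last exact: measurable_annulus.
    rewrite [X in (_ * X)%E]leb_annulus// -EFinM lee_fin /c.
    rewrite exprMn powRM ?(ltW M0)//.
    have E : M `^ (- (beta * rho)) * M ^+ d.+1 = M `^ (D - beta * rho).
      by rewrite addrC powRD ?powR_mulrn ?(ltW M0)// (gt_eqF M0) implybT.
    rewrite [leRHS](_ : _ = C^-1 `^ rho * 2 `^ (- (beta * rho)) *
      (M `^ (- (beta * rho)) * M ^+ d.+1) * omega * (2 ^+ d.+1 - 1)); last by ring.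
    rewrite E ler_wpM2r//; first by rewrite subr_ge0 exprn_ege1// ler1n.
    rewrite ler_wpM2r ?(ltW omega_gt0)// ler_wpM2l ?mulr_ge0 ?powR_ge0//.
    by apply: ge0_ler_powR; rewrite ?subr_ge0 ?nnegrE ?(ltW M0) ?(ltW C0).
  apply: ge0_le_integral => //.
  - exact: measurable_annulus.
  - by move=> x _; rewrite lee_fin mulr_ge0 ?powR_ge0.
  - exact: measurable_funTS.
  - move=> x /andP[Mx xM]; rewrite lee_fin.
    have xC : C <= enorm x by rewrite (le_trans CM)// ltW.
    have x0 : 0 < enorm x by exact: lt_trans Mx.
    rewrite -mulNr powRrM -powRM ?invr_ge0 ?powR_ge0 ?(ltW C0)//.
    apply: ge0_ler_powR; rewrite ?nnegrE ?mulr_ge0 ?powR_ge0 ?invr_ge0 ?f0 ?(ltW C0) ?(ltW rho0)//.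
    apply: le_trans (ltW (f_lower xC)).
    rewrite ler_pM2l ?invr_gt0// !powRN lef_pV2 ?posrE ?powR_gt0 ?mulr_gt0//.
    by apply: ge0_ler_powR; rewrite ?nnegrE ?(ltW x0) ?(ltW beta0)// mulr_ge0// ltW.
have JC : (J C < +oo)%E.
  apply: le_lt_trans Ifin; apply: ge0_subset_integral => //; exact: measurable_outside.
have Jk k : ((k%:R * c)%:E <= J C)%E.
  have : ((k%:R * c)%:E + J (2 ^+ k * C)%R <= J C)%E.
    elim: k => [|k IH]; first by rewrite mul0r add0e expr0 mul1r.
    apply: le_trans IH; rewrite -natr1 mulrDl mul1r EFinD -addeA leeD2l//.
    rewrite exprS -mulrA; apply: Jstep.
    by rewrite ler_peMl ?(ltW C0)// exprn_ege1// ler1n.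
  by apply: le_trans; rewrite leeDl// integral_ge0.
have JCfin : J C \is a fin_num by rewrite ge0_fin_numE// integral_ge0.
have := Jk (Num.truncn (fine (J C) / c)).+1.
rewrite -(fineK JCfin) lee_fin -ler_pdivlMr//.
by apply/negP; rewrite -ltNge truncnS_gt.
Qed.

End tail.

(** * Uniform bounds on the mean exceedance probability *)

Section ball_counts.
Context {R : realType} {d : nat}.
Local Notation V := (d.+1.-tuple R).
Local Notation D := (d.+1%:R : R).
Variable mu : probability V R.
Implicit Types (m j : nat) (r : R).

(** The probability that fewer than j of m further points fall within r of a point frozen at x. *)
Definition ball_binlt m j r (x : V) : R := binlt m j (fine (mu (eball x r))).

Definition inside (M : R) : set V := [set x | enorm x <= M].

Lemma measurable_inside M : measurable (inside M).
Proof.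
apply: (@measurable_set_bool _ _ (fun x : V => enorm x <= M)).
by apply: measurable_fun_ler => //; exact: measurable_enorm.
Qed.

Lemma fine_mu01 (A : set V) : measurable A -> 0 <= fine (mu A) <= 1.
Proof.
move=> mA; rewrite fine_ge0//= -lee_fin fineK ?probability_le1//.
exact: fin_num_measure.
Qed.

Lemma ball_binlt01 m j r x : 0 <= ball_binlt m j r x <= 1.
Proof.
have p01 := fine_mu01 (measurable_eball x r).
by rewrite /ball_binlt binlt_ge0// binlt_le1.
Qed.

Lemma ball_binlt_ge0 m j r x : (0 <= (ball_binlt m j r x)%:E)%E.
Proof. by rewrite lee_fin; case/andP: (ball_binlt01 m j r x). Qed.

Lemma measurable_ball_binlt m j r :
  measurable_fun setT (fun x => (ball_binlt m j r x)%:E : \bar R).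
Proof.
exact: (measurable_binlt_nb mu (nb := fun x => eball x r) (measurable_eball_pair r)).
Qed.

Lemma fin_num_integral_ball_binlt m j r :
  (\int[mu]_x (ball_binlt m j r x)%:E \is a fin_num)%E.
Proof.
rewrite ge0_fin_numE ?integral_ge0// => [|x _]; last exact: ball_binlt_ge0.
apply: (@le_lt_trans _ _ 1%E); last by rewrite ltry.
rewrite -(@probability_setT _ _ _ mu) -[leRHS]mul1e -integral_cst//.
apply: ge0_le_integral => //; try by move=> x _; exact: ball_binlt_ge0.
- exact: measurable_ball_binlt.
- by move=> x _; rewrite lee_fin; case/andP: (ball_binlt01 m j r x).
Qed.

(* The ball of radius r around a point of Q i contains Q i, and
   p * binlt m j p <= j / m.+1. *)
Lemma integral_ball_binlt_cover m j r (I : finType) (Q : I -> set V) (A : set V) :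
  measurable A -> (forall i, measurable (Q i)) -> A `<=` \bigcup_i Q i ->
  (forall i x y, Q i x -> Q i y -> edist x y <= r) ->
  (\int[mu]_(x in A) (ball_binlt m j r x)%:E <= (#|I|%:R * (j%:R / m.+1%:R))%:E)%E.
Proof.
move=> mA mQ AQ Qr.
pose q i := fine (mu (Q i)).
have qE i : mu (Q i) = (q i)%:E by rewrite /q fineK// fin_num_measure.
have q01 i : 0 <= q i <= 1 by exact: fine_mu01.
pose g i x : \bar R := ((binlt m j (q i))%:E * (\1_(Q i) x)%:E)%E.
have mg i : measurable_fun setT (g i).
  apply: emeasurable_funM => //.
  by apply/measurable_EFinP; exact: measurable_indic.
have g0 i x : (0 <= g i x)%E by rewrite mule_ge0// lee_fin// binlt_ge0.
apply: (@le_trans _ _ (\int[mu]_x (\sum_(i <- enum I) g i x))%E).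
  apply: (@le_trans _ _ (\int[mu]_(x in A) (\sum_(i <- enum I) g i x))%E).
    apply: ge0_le_integral => //.
    - by move=> x _; rewrite lee_fin; case/andP: (ball_binlt01 m j r x).
    - by apply: measurable_funTS; exact: measurable_ball_binlt.
    - by apply: measurable_funTS; apply: emeasurable_sum => i.
    - move=> x /AQ [i _ Qx]; rewrite (big_rem i) ?mem_enum//=.
      apply: (@le_trans _ _ (g i x)); last by rewrite leeDl// sume_ge0.
      rewrite /g indicE mem_set// mule1 lee_fin.
      have /andP[q0 _] := q01 i.
      have /andP[_ e1] := fine_mu01 (measurable_eball x r).
      apply: binlt_anti => //.
      rewrite -lee_fin -qE fineK ?fin_num_measure//; last exact: measurable_eball.
      rewrite le_measure ?inE//; first exact: measurable_eball.
      by move=> y Qy; rewrite /eball/=; exact: (Qr i).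
  apply: ge0_subset_integral => //.
  - by apply: emeasurable_sum => i.
  - by move=> x _; exact: sume_ge0.
rewrite ge0_integral_sum//.
apply: (@le_trans _ _ (\sum_(i <- enum I) (j%:R / m.+1%:R)%:E)%E); last first.
  by rewrite sumEFin lee_fin big_const_seq count_predT -cardE iter_addr_0 [leRHS]mulr_natl.
apply: lee_sum => i _; rewrite /g ge0_integralZl//; last 2 first.
- by apply/measurable_EFinP; exact: measurable_indic.
- by rewrite lee_fin binlt_ge0.
rewrite integral_indic// setIT [X in (_ * X)%E]qE -EFinM lee_fin mulrC.
exact: binlt_mul_le.
Qed.

Lemma integral_ball_binlt_near m j r M : 0 < r -> r <= M ->
  (\int[mu]_(x in inside M) (ball_binlt m j r x)%:E <=
  (((2 * D + 1) * M / r) ^+ d.+1 * (j%:R / m.+1%:R))%:E)%E.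
Proof.
move=> r0 rM; have M0 : 0 < M by exact: lt_le_trans rM.
(* Cubes of side r / D have diameter at most r by [edist_le_coord]. *)
pose h := r / D; have h0 : 0 < h by rewrite divr_gt0.
(* The interval [- M, M] is cut into cells of length h along each axis. Rounding down costs one more
   cell, absorbed below through 1 <= M / r: hence the constant 2 D + 1 and the hypothesis
   [r <= M]. *)
pose N := (Num.truncn (2 * M / h)).+1.
pose Q (c : {ffun 'I_d.+1 -> 'I_N}) : set V :=
  \bigcap_(i in setT) [set x | (c i)%:R * h <= tnth x i + M <= (c i).+1%:R * h].
have mQ c : measurable (Q c).
  apply: fin_bigcap_measurable; first exact: finite_finset.
  move=> i _.
  apply: (@measurable_set_bool _ _ (fun x : V => (c i)%:R * h <= tnth x i + M <= (c i).+1%:R * h)).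
  by apply: measurable_and; apply: measurable_fun_ler => //;
    apply: measurable_funD => //; exact: measurable_tnth.
have mA := measurable_inside M.
apply: le_trans (integral_ball_binlt_cover (r := r) m j mA mQ _ _) _.
- move=> x; rewrite /inside/= => xM.
  have xi i : 0 <= tnth x i + M <= 2 * M.
    have := le_trans (ler_tnth_enorm x i) xM; rewrite ler_norml.
    by move=> /andP[]; lra.
  have ti i : (Num.truncn ((tnth x i + M) / h) < N)%N.
    rewrite /N ltnS; apply: le_truncn.
    by rewrite ler_pM2r ?invr_gt0//; case/andP: (xi i).
  exists [ffun i => Ordinal (ti i)] => // i _ /=; rewrite ffunE/=.
  have /andP[x0 _] := xi i.
  have /truncn_itv/andP[] : 0 <= (tnth x i + M) / h by rewrite divr_ge0 ?(ltW h0).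
  by rewrite ler_pdivlMr// ltr_pdivrMr// => -> /ltW ->.
- move=> c x y Qx Qy; apply: edist_le_coord; first exact: ltW.
  move=> i; have /andP[x1 x2] := Qx i I; have /andP[y1 y2] := Qy i I.
  move: x2 y2; rewrite -/h -!natr1 !mulrDl mul1r ler_norml => x2 y2.
  by apply/andP; split; lra.
rewrite lee_fin ler_wpM2r ?divr_ge0//.
rewrite card_ffun !card_ord natrX lerXn2r ?nnegrE//.
  by rewrite divr_ge0 ?(ltW r0)// mulr_ge0 ?(ltW M0)// addr_ge0 ?mulr_ge0.
rewrite [leLHS](_ : _ = (Num.truncn (2 * M / h))%:R + 1); last by rewrite natr1.
rewrite [leRHS](_ : _ = 2 * D * M / r + M / r); last by ring.
rewrite lerD//; last by rewrite ler_pdivlMr// mul1r.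
rewrite [leRHS](_ : _ = 2 * M / h); last by rewrite /h invf_div; ring.
by rewrite truncn_le divr_ge0 ?(ltW h0)// mulr_ge0 ?(ltW M0).
Qed.

Lemma integral_ball_binlt_split m j r M :
  (\int[mu]_x (ball_binlt m j r x)%:E <=
  \int[mu]_(x in inside M) (ball_binlt m j r x)%:E + mu (outside M))%E.
Proof.
have mA := measurable_inside M.
have mO : measurable (outside M : set V) by exact: measurable_outside.
have b0 x : (0 <= (ball_binlt m j r x)%:E)%E.
  by rewrite lee_fin; case/andP: (ball_binlt01 m j r x).
have mb := measurable_ball_binlt m j r.
rewrite (_ : setT = inside M `|` outside M); last first.
  apply/seteqP; split => x //= _; rewrite /outside/inside/=.
  by case: (leP (enorm x) M); [left|right].
rewrite ge0_integral_setU//; last 2 first.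
- exact: measurable_funTS.
- apply/disj_setPS => x [/=]; rewrite /outside/inside/= => xM.
  by rewrite ltNge xM.
apply: leeD2l; rewrite -[leRHS]mul1e -integral_cst//.
apply: ge0_le_integral => //.
- exact: measurable_funTS.
- by move=> x _; rewrite lee_fin; case/andP: (ball_binlt01 m j r x).
Qed.

(* When r exceeds 2 |x|, the ball of radius r around x contains the centered ball
   of radius r / 2. *)
Lemma integral_ball_binlt_far m j r : (j <= m)%N ->
  (\int[mu]_x (ball_binlt m j r x)%:E <= (j.+1%:R * tailmu mu (r / 2))%:E)%E.
Proof.
move=> jm; apply: le_trans (integral_ball_binlt_split _ _ _ (r / 2)) _.
rewrite tailmuE -[X in (_ <= (X * _)%:E)%E]natr1 mulrDl mul1r EFinD leeD2r//.
have mA := measurable_inside (r / 2).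
have t0 : 0 <= tailmu mu (r / 2) by rewrite fine_ge0.
apply: (@le_trans _ _ (\int[mu]_(x in inside (r / 2))
   (j%:R * tailmu mu (r / 2))%:E)%E); last first.
  rewrite integral_cst// -[leRHS]mule1 lee_wpmul2l ?probability_le1//.
  by rewrite lee_fin mulr_ge0.
apply: ge0_le_integral => //.
- by move=> x _; exact: ball_binlt_ge0.
- by apply: measurable_funTS; exact: measurable_ball_binlt.
move=> x; rewrite /inside/= => xr; rewrite lee_fin.
have p01 := fine_mu01 (measurable_eball x r).
apply: (le_trans (binlt_full p01 jm)); rewrite ler_wpM2l//.
rewrite lerBlDr -lee_fin EFinD -tailmuE fineK ?fin_num_measure//; last exact: measurable_eball.
rewrite -[X in (X <= _)%E](@probability_setT _ _ _ mu).
apply: (@le_trans _ _ (mu (outside (r / 2) `|` eball x r))); last first.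
  by apply: measureU2; [exact: measurable_outside|exact: measurable_eball].
rewrite le_measure ?inE//.
  by apply: measurableU; [exact: measurable_outside|exact: measurable_eball].
move=> y _; rewrite /outside/eball/=.
case: (leP (enorm y) (r / 2)) => yr; [right|by left].
apply: (le_trans (edist_triangle [tuple 0 | i < d.+1] _ _)).
by rewrite -enormE edistC -enormE; lra.
Qed.

End ball_counts.

Section tail_bound.
Context {R : realType} {d : nat}.
Local Notation V := (d.+1.-tuple R).
Local Notation leb := (@lebesgue_tuple R d.+1).
Local Notation D := (d.+1%:R : R).
Variables (f : V -> R) (mu : probability V R) (beta C : R).
Hypothesis mf : measurable_fun setT f.
Hypothesis f0 : forall x, 0 <= f x.
Hypothesis muE : forall B, measurable B -> mu B = (\int[leb]_(x in B) (f x)%:E)%E.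
Hypothesis C0 : 0 < C.
Hypothesis betaD : D < beta.
Hypothesis f_upper : forall x, C <= enorm x -> f x < C * enorm x `^ (- beta).

Let tail_le := tailmu_le mf f0 muE C0 betaD f_upper.
Let K : R := @tail_const R d beta C.
Let K0 : 0 < K. Proof. exact: tail_const_gt0. Qed.

(** The first term comes from the number of cells. The second is the factor j + 1 of
    [integral_ball_binlt_far] times the tail constant; the power of 2 is the price of passing from M
    / 2 to M, and the term also covers the mass outside M when r <= M. *)
Definition ball_binlt_const (j : nat) : R :=
  (2 * D + 1) ^+ d.+1 * j%:R + j.+1%:R * K * 2 `^ (beta - D).

(** With M = s^(D / beta), both (M / s)^D and M^(D - beta) equal s^(D^2 / beta - D). The factor 2 in
    [2 * C <= M] allows the tail bound to be used at r / 2 when r > M. *)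
Lemma integral_ball_binlt_le m j s : (j <= m)%N -> 0 < s -> 2 * C <= s `^ (D / beta) ->
  (\int[mu]_x (ball_binlt mu m j (s / m.+1%:R `^ D^-1) x)%:E <=
  (ball_binlt_const j * s `^ (D * D / beta - D))%:E)%E.
Proof.
move=> jm s0; set M := s `^ (D / beta); set r := s / _ => CM.
have beta0 : 0 < beta by apply: le_lt_trans betaD.
have M0 : 0 < M by rewrite powR_gt0.
have r0 : 0 < r by rewrite divr_gt0// powR_gt0.
have ME : M `^ (D - beta) = s `^ (D * D / beta - D).
  by rewrite /M -powRrM; congr (_ `^ _); field; rewrite gt_eqF.
have KM0 : 0 <= K * M `^ (D - beta) by rewrite mulr_ge0 ?powR_ge0 ?ltW.
have two1 : 1 <= 2 `^ (beta - D).
  by rewrite -[leLHS](powRr0 2) ler_powR ?ler1n ?subr_ge0 ?(ltW betaD).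
have far : (j.+1%:R * (K * M `^ (D - beta) * 2 `^ (beta - D)) <=
    ball_binlt_const j * s `^ (D * D / beta - D)).
  rewrite -ME /ball_binlt_const mulrDl; rewrite [leLHS](_ : _ = j.+1%:R * K * 2 `^ (beta - D) * M `^ (D - beta)); last by ring.
  by rewrite lerDr mulr_ge0 ?powR_ge0// mulr_ge0// exprn_ge0// addr_ge0// mulr_ge0.
(* If r <= M, cells inside M and tail mass outside; otherwise the ball of radius r is large compared
   with r / 2 and only the tail mass at r / 2 matters. *)
have [rM|Mr] := leP r M.
  apply: (le_trans (integral_ball_binlt_split mu m j r M)).
  rewrite tailmuE.
  apply: (le_trans (leeD2r _ (integral_ball_binlt_near mu m j r0 rM))).
  rewrite -EFinD lee_fin /ball_binlt_const [leRHS]mulrDl.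
  have rE : r ^+ d.+1 = s ^+ d.+1 / m.+1%:R.
    rewrite /r expr_div_n -[X in _ / X]powR_mulrn ?powR_ge0// -powRrM.
    by rewrite mulVf ?powRr1// pnatr_eq0.
  apply: lerD.
    rewrite expr_div_n exprMn rE.
    rewrite -!mulrA ler_pM2l ?exprn_gt0// ?addr_gt0 ?mulr_gt0//.
    rewrite [X in _ * X <= _](_ : _ = j%:R / s ^+ d.+1); last first.
      by rewrite invf_div mulrC mulrA divfK// pnatr_eq0.
    rewrite mulrCA ler_wpM2l//.
    rewrite powRD; last by rewrite (gt_eqF s0) implybT.
    rewrite powRN powR_mulrn ?(ltW s0)// ler_pM2r ?invr_gt0 ?exprn_gt0//.
    by rewrite /M -powR_mulrn ?powR_ge0// -powRrM [X in _ `^ X]mulrC.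
  have CM' : C <= M by apply: le_trans CM; rewrite ler_peMl ?ler1n ?(ltW C0).
  apply: (le_trans (tail_le CM')); rewrite -/K ME.
  rewrite ler_wpM2r ?powR_ge0//.
  rewrite mulrAC mulrC ler_peMr ?(ltW K0)//.
  by rewrite (le_trans two1)// ler_peMl ?powR_ge0// ler1n.
apply: (le_trans (integral_ball_binlt_far mu r jm)).
rewrite lee_fin; apply: le_trans far.
rewrite ler_wpM2l//.
have Cr : C <= r / 2 by move: CM Mr; lra.
apply: (le_trans (tail_le Cr)); rewrite -/K -mulrA ler_wpM2l ?(ltW K0)//.
have -> : 2 `^ (beta - D) = 2^-1 `^ (D - beta).
  by rewrite -powR_inv1// -powRrM mulN1r opprB.
rewrite -powRM ?(ltW M0)// -(opprB beta) !powRN lef_pV2 ?posrE ?powR_gt0 ?divr_gt0//.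
rewrite ge0_ler_powR ?nnegrE ?subr_ge0 ?(ltW betaD) ?divr_ge0 ?(ltW M0) ?(ltW s0) ?powR_ge0//.
by rewrite ler_pM2r// ltW.
Qed.

End tail_bound.

(** * Poisson limit and its integral *)

Section poisson_limit.
Context {R : realType} {d : nat}.
Local Notation V := (d.+1.-tuple R).
Local Notation leb := (@lebesgue_tuple R d.+1).
Local Notation D := (d.+1%:R : R).
Variables (f : V -> R) (mu : probability V R).
Hypothesis mf : measurable_fun setT f.
Hypothesis f0 : forall x, 0 <= f x.
Hypothesis muE : forall B, measurable B -> mu B = (\int[leb]_(x in B) (f x)%:E)%E.

Let mfE : measurable_fun setT (fun x => (f x)%:E : \bar R).
Proof. exact/measurable_EFinP. Qed.

Let fi : (\int[leb]_x (f x)%:E < +oo)%E.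
Proof. by rewrite -muE// probability_setT ltry. Qed.

Lemma density_atomless x : mu [set x] = 0%E.
Proof.
have mx : measurable [set x].
  rewrite (_ : [set x] = eball x 0); first exact: measurable_eball.
  apply/seteqP; split => y; rewrite /eball/=; first by move=> ->; rewrite edistxx.
  by move=> h; apply/esym/edist_eq0/le_anti; rewrite h edist_ge0.
rewrite muE//; apply: null_set_integral => //; first exact: measurable_funTS.
exact: lebesgue_tuple_set1.
Qed.

Lemma cvg_mu_eball x (r : nat -> R) : r n @[n --> \oo] --> (0 : R) ->
  fine (mu (eball x (r n))) @[n --> \oo] --> (0 : R).
Proof.
move=> r0; pose F k := eball x (k.+1%:R^-1 : R).
have mF k : measurable (F k) by exact: measurable_eball.
have FI : \bigcap_k F k = [set x].
  apply/seteqP; split => y; rewrite /F/eball/=; last first.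
    by move=> -> k _ /=; rewrite edistxx invr_ge0.
  move=> H; apply/esym/edist_eq0/le_anti; rewrite edist_ge0 andbT.
  apply/ler_addgt0Pr => e e0; rewrite add0r.
  apply: (le_trans (H (Num.truncn e^-1) I)).
  by rewrite invf_ple ?posrE// ltW// truncnS_gt.
have /fine_cvgP[_ /cvgrPdist_lt H] : (mu \o F) k @[k --> \oo] --> (0 : R)%:E.
  rewrite (_ : 0%:E = mu (\bigcap_k F k)); last by rewrite FI density_atomless.
  apply: nonincreasing_cvg_mu => //.
  - by rewrite (le_lt_trans (probability_le1 _ _)) ?ltry.
  - exact: bigcap_measurable.
  - move=> m n mn; apply/subsetPset => y; rewrite /F/eball/= => /le_trans; apply.
    by rewrite lef_pV2 ?posrE// ler_nat.
apply/cvgrPdist_lt => e e0.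
have [k _ /(_ _ (leqnn k))] := H e e0; rewrite /= !sub0r !normrN => Fe.
have k0 : 0 < k.+1%:R^-1 :> R by rewrite invr_gt0.
move/cvgrPdist_le : r0 => /(_ _ k0); apply: filterS => n; rewrite sub0r normrN => rn.
rewrite sub0r normrN; apply: le_lt_trans Fe.
rewrite !ger0_norm ?fine_ge0// fine_le ?fin_num_measure//; try exact: measurable_eball.
rewrite le_measure ?inE//; try exact: measurable_eball.
move=> y; rewrite /F/eball/= => /le_trans; apply.
by apply: le_trans rn; exact: ler_norm.
Qed.

Lemma measurable_mu_eball r : measurable_fun setT (fun x => fine (mu (eball x r))).
Proof. exact: (measurable_mu_nb mu (nb := fun x => eball x r) (measurable_eball_pair r)). Qed.

Let fine_mu_eballE x r : (fine (mu (eball x r)))%:E = mu (eball x r).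
Proof. by rewrite fineK// fin_num_measure//; exact: measurable_eball. Qed.

Lemma cvg_integral_mu_eball (r : nat -> R) : r n @[n --> \oo] --> (0 : R) ->
  (\int[mu]_x mu (eball x (r n)) @[n --> \oo] --> 0)%E.
Proof.
move=> r0.
under eq_cvg do under eq_integral do rewrite -fine_mu_eballE.
apply: (@ge0_dominated_cvg0 _ _ R mu _ (cst 1%E)) => //.
- by move=> n; apply/measurable_EFinP; exact: measurable_mu_eball.
- by move=> n x; rewrite lee_fin fine_ge0.
- by move=> n x; rewrite fine_mu_eballE probability_le1//; exact: measurable_eball.
- by rewrite integral_cst// mul1e [X in (X < _)%E]probability_setT ltry.
- apply: aeW => x _; apply: cvg_EFin; first exact: nearW.
  exact: cvg_mu_eball.
Qed.

Lemma cvg_min1_integral (g : nat -> V -> R) :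
  (forall n, measurable_fun setT (g n)) -> (forall n x, 0 <= g n x) ->
  (forall x, g n x @[n --> \oo] --> (0 : R)) ->
  (\int[mu]_x (Num.min 1 (g n x))%:E @[n --> \oo] --> 0)%E.
Proof.
move=> mg g0 gc.
apply: (@ge0_dominated_cvg0 _ _ R mu _ (cst 1%E)) => //.
- by move=> n; apply/measurable_EFinP; apply: measurable_minr.
- by move=> n x; rewrite lee_fin le_min ler01 g0.
- by move=> n x; rewrite lee_fin ge_min lexx.
- by rewrite integral_cst// mul1e [X in (X < _)%E]probability_setT ltry.
- apply: aeW => x _; apply/ge0_cvg0P => [n|e e0].
    by rewrite lee_fin le_min ler01 g0.
  move/cvgrPdist_le : (gc x) => /(_ _ e0); apply: filterS => n.
  by rewrite sub0r normrN ger0_norm// lee_fin => ge; rewrite ge_min ge orbT.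
Qed.

(* The part of f above a level K has small mass; below K, f is bounded. *)
Lemma cvg_min1_integral_L1 (g : nat -> V -> R) :
  (forall n, measurable_fun setT (g n)) -> (forall n x, 0 <= g n x) ->
  (\int[leb]_x (g n x)%:E @[n --> \oo] --> 0)%E ->
  (\int[mu]_x (Num.min 1 (g n x))%:E @[n --> \oo] --> 0)%E.
Proof.
move=> mg g0 gc.
have mh n : measurable_fun setT (fun x => Num.min 1 (g n x)) by exact: measurable_minr.
have h0 n x : 0 <= Num.min 1 (g n x) by rewrite le_min ler01 g0.
apply/ge0_cvg0P => [n|e e0].
  by apply: integral_ge0 => x _; rewrite lee_fin.
have e2 : 0 < e / 2 by rewrite divr_gt0.
pose big (k : nat) x := (k%:R < f x)%R.
have mbig k : measurable_fun setT (fun x => (f x * (big k x)%:R)%:E : \bar R).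
  apply/measurable_EFinP; apply: measurable_funM => //.
  apply: measurable_bool_natr.
  exact: measurable_fun_ltr.
have big_cvg : (\int[leb]_x (f x * (big k x)%:R)%:E @[k --> \oo] --> 0)%E.
  apply: (@ge0_dominated_cvg0 _ _ R leb _ (fun x => (f x)%:E)) => //.
  - by move=> n x; rewrite lee_fin mulr_ge0.
  - by move=> n x; rewrite lee_fin ler_piMr// lern1 leq_b1.
  apply: aeW => x _; apply/ge0_cvg0P => [n|h hp]; first by rewrite lee_fin mulr_ge0.
  exists (Num.truncn (f x)).+1 => // n /= xn.
  have fxn : f x <= n%:R by apply: (le_trans (ltW (truncnS_gt _))); rewrite ler_nat.
  by rewrite /big ltNge fxn mulr0 lee_fin ltW.
have big0 k : (0 <= \int[leb]_x (f x * (big k x)%:R)%:E)%E.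
  by apply: integral_ge0 => x _; rewrite lee_fin mulr_ge0.
have [/(_ big_cvg _ e2) [k _ /(_ _ (leqnn k)) Hk] _] := ge0_cvg0P big0.
have k0 : 0 < k.+1%:R :> R by [].
have gi0 n : (0 <= \int[leb]_x (g n x)%:E)%E.
  by apply: integral_ge0 => x _; rewrite lee_fin.
have [/(_ gc _ (divr_gt0 e2 k0)) + _] := ge0_cvg0P gi0.
apply: filterS => n Hn.
rewrite (ge0_integral_density mf f0 muE)//; last 2 first.
- exact/measurable_EFinP.
- by move=> x; rewrite lee_fin.
apply: (@le_trans _ _ (\int[leb]_x (k.+1%:R%:E * (g n x)%:E + (f x * (big k x)%:R)%:E))%E).
  apply: ge0_le_integral => //.
  - by move=> x _; rewrite -EFinM lee_fin mulr_ge0.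
  - apply: emeasurable_funM => //; exact/measurable_EFinP.
  - apply: emeasurable_funD => //; apply: emeasurable_funM => //; exact/measurable_EFinP.
  - move=> x _; rewrite -!EFinM -EFinD lee_fin /big; have := g0 n x.
    have := f0 x; have : Num.min 1 (g n x) <= 1 by rewrite ge_min lexx.
    have : Num.min 1 (g n x) <= g n x by rewrite ge_min lexx orbT.
    have := h0 n x; rewrite -natr1; move: (Num.min _ _) => t.
    by case: ltP => /= fk; [rewrite mulr1|rewrite mulr0]; have : 0 <= k%:R :> R by []; nra.
rewrite ge0_integralD//; last 3 first.
- by move=> x _; rewrite mule_ge0// lee_fin.
- by apply: emeasurable_funM => //; exact/measurable_EFinP.
- by move=> x _; rewrite lee_fin mulr_ge0.
rewrite ge0_integralZl//; last 2 first.
- exact/measurable_EFinP.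
- by move=> x _; rewrite lee_fin.
rewrite [e]splitr EFinD leeD//.
by move: Hn; rewrite EFinM -lee_pdivlMl// muleC.
Qed.

(* The sample size is n.+1 here and below. *)
Definition knn_radius (s : R) (n : nat) : R := s / n.+1%:R `^ D^-1.

Lemma knn_radius_gt0 s n : 0 < s -> 0 < knn_radius s n.
Proof. by move=> s0; rewrite divr_gt0// powR_gt0. Qed.

Lemma knn_radius_expV s n : 0 < s -> s ^+ d.+1 * knn_radius s n ^- d.+1 = n.+1%:R.
Proof.
move=> s0; rewrite /knn_radius expr_div_n invf_div -[X in X / _]powR_mulrn ?powR_ge0//.
rewrite -powRrM mulVf ?pnatr_eq0// powRr1//.
by rewrite mulrC divfK// expf_neq0// gt_eqF.
Qed.

Lemma cvg_knn_radius s : knn_radius s n @[n --> \oo] --> (0 : R).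
Proof.
rewrite -(mulr0 s); apply: cvgM; first exact: cvg_cst.
have np : \forall n \near \oo, 0 < n.+1%:R `^ D^-1 :> R by apply: nearW => n; rewrite powR_gt0.
apply/(gtr0_cvgV0 np).
apply/cvgryPge => A.
exists (Num.truncn ((Num.max A 0) `^ D)) => // n /= An.
apply: (@le_trans _ _ (Num.max A 0)); first by rewrite le_max lexx.
have A0 : 0 <= Num.max A 0 by rewrite le_max lexx orbT.
rewrite -(@powR_inv_le _ D^-1) ?invr_gt0 ?invrK//.
by apply: (le_trans (ltW (truncnS_gt _))); rewrite ler_nat.
Qed.

Let omega : R := unit_ball_volume d.+1.

(** The error is split according to how it vanishes. The first term gathers the Poisson
    approximation and the replacement of m by n + 1; it has a factor p and tends to 0 pointwise. The
    second is the error of the ball average, known to vanish only in L1 of Lebesgue measure.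
    Truncation at 1 is legitimate because the left-hand side is at most 1. *)
Lemma ball_binlt_poislt_le j m n s x : 0 < s -> (m <= n.+1 <= m.+2)%N ->
  `|ball_binlt mu m j (knn_radius s n) x - poislt j (omega * s ^+ d.+1 * f x)| <=
  Num.min 1 (2 * fine (mu (eball x (knn_radius s n))) * (1 + omega * s ^+ d.+1 * f x)) +
  Num.min 1 (3 * `|n.+1%:R * fine (mu (eball x (knn_radius s n))) - omega * s ^+ d.+1 * f x|).
Proof.
move=> s0 /andP[mn nm]; set kappa := omega * _; set p := fine _.
have kappa0 : 0 <= kappa by rewrite mulr_ge0 ?exprn_ge0 ?ltW// unit_ball_volume_gt0.
have p01 : 0 <= p <= 1 by exact: fine_mu01 (measurable_eball x _).
have /andP[p0 p1] := p01.
have z0 : 0 <= kappa * f x by rewrite mulr_ge0.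
rewrite /ball_binlt -/p; set z := kappa * f x in z0 *.
set Delta := `|_ - _|.
have D1 : Delta <= 1.
  have := binlt_ge0 m j p01; have := binlt_le1 m j p01.
  have := poislt_ge0 j z0; have := poislt_le1 j z0.
  by rewrite /Delta ler_norml => *; apply/andP; split; lra.
have D2 : Delta <= 2 * p * (1 + z) + 3 * `|n.+1%:R * p - z|.
  have mp0 : 0 <= m%:R * p by rewrite mulr_ge0.
  have h1 := binlt_poislt m j p01.
  have h2 := poislt_lipschitz j z0 mp0.
  apply: (le_trans (ler_distD (poislt j (m%:R * p)) _ _)).
  apply: (le_trans (lerD h1 h2)).
  have mn' : m%:R <= n.+1%:R :> R by rewrite ler_nat.
  have nm' : n.+1%:R <= m%:R + 2 :> R by rewrite -natrD addn2 ler_nat.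
  set a := `|n.+1%:R * p - z|.
  have h3 : `|m%:R * p - z| <= 2 * p + a.
    apply: (le_trans (ler_distD (n.+1%:R * p) _ _)); rewrite lerD2r.
    by rewrite -mulrBl normrM (ger0_norm p0) ler_wpM2r// ler_norml; apply/andP; split; lra.
  have h4 : m%:R * p <= z + a.
    have : n.+1%:R * p - z <= a by exact: ler_norm.
    by have := ler_wpM2r p0 mn'; lra.
  have a0 : 0 <= a := normr_ge0 _.
  have : 2 * m%:R * p ^+ 2 <= 2 * p * (z + a).
    by rewrite [leLHS](_ : _ = 2 * p * (m%:R * p)); [rewrite ler_wpM2l// mulr_ge0|ring].
  have : p * a <= a by rewrite ler_piMl.
  by lra.
have u0 : 0 <= 2 * p * (1 + z) by rewrite !mulr_ge0// addr_ge0.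
have v0 : 0 <= 3 * `|n.+1%:R * p - z| by rewrite mulr_ge0.
move: D1 D2 u0 v0; rewrite !minEle; do 2 case: ifP => _; lra.
Qed.

Lemma measurable_ball_binltR m j r : measurable_fun setT (ball_binlt mu m j r).
Proof. by apply/measurable_EFinP; exact: measurable_ball_binlt. Qed.

Lemma measurable_poislt_density j k :
  measurable_fun setT (fun x => poislt j (k * f x)).
Proof.
apply: (measurableT_comp (f := poislt j)).
  by apply: continuous_measurable_fun; exact: continuous_poislt.
exact: measurable_funM.
Qed.

Lemma cvg_integral_ball_binlt j s (m : nat -> nat) : 0 < s ->
  (forall n, (m n <= n.+1 <= (m n).+2)%N) ->
  (\int[mu]_x (`|ball_binlt mu (m n) j (knn_radius s n) x -
     poislt j (omega * s ^+ d.+1 * f x)|)%:E @[n --> \oo] --> 0)%E.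
Proof.
move=> s0 mn; set kappa := omega * _.
have kappa0 : 0 <= kappa by rewrite mulr_ge0 ?exprn_ge0 ?ltW// unit_ball_volume_gt0.
pose p n x := fine (mu (eball x (knn_radius s n))).
have mp n : measurable_fun setT (p n) by exact: measurable_mu_eball.
have p0 n x : 0 <= p n x by rewrite fine_ge0.
pose g1 n x := 2 * p n x * (1 + kappa * f x).
pose g2 n x := 3 * `|n.+1%:R * p n x - kappa * f x|.
have mg1 n : measurable_fun setT (g1 n).
  apply: measurable_funM; first exact: measurable_funM.
  by apply: measurable_funD => //; exact: measurable_funM.
have mg2 n : measurable_fun setT (g2 n).
  apply: measurable_funM => //; apply: measurableT_comp => //.
  by apply: measurable_funB; exact: measurable_funM.
have g10 n x : 0 <= g1 n x by rewrite !mulr_ge0// addr_ge0// mulr_ge0.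
have g20 n x : 0 <= g2 n x by rewrite mulr_ge0.
have c1 : (\int[mu]_x (Num.min 1 (g1 n x))%:E @[n --> \oo] --> 0)%E.
  apply: cvg_min1_integral => // x.
  have : g1 n x @[n --> \oo] --> 2 * 0 * (1 + kappa * f x).
    apply: cvgM; last exact: cvg_cst.
    by apply: cvgM; [exact: cvg_cst|apply: cvg_mu_eball; exact: cvg_knn_radius].
  by rewrite mulr0 mul0r.
have c2 : (\int[mu]_x (Num.min 1 (g2 n x))%:E @[n --> \oo] --> 0)%E.
  apply: cvg_min1_integral_L1 => //.
  have := ball_average_cvg mf f0 fi (fun n => knn_radius_gt0 n s0) (cvg_knn_radius s).
  (* By [knn_radius_expV] multiplying the rescaled ball mass by this power of s gives the sample
     size times p. *)
  move=> /(cvge0Zl (3 * s ^+ d.+1)).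
  pose h n x := `|knn_radius s n ^- d.+1 * p n x - omega * f x|.
  have mh n : measurable_fun setT (fun x => (h n x)%:E : \bar R).
    apply/measurable_EFinP; apply: measurableT_comp => //.
    by apply: measurable_funB; exact: measurable_funM.
  have E n : (\int[leb]_x (g2 n x)%:E = (3 * s ^+ d.+1)%:E * \int[leb]_x
      `|(knn_radius s n ^- d.+1)%:E * \int[leb]_(y in eball x (knn_radius s n)) (f y)%:E -
        (omega * f x)%:E|)%E.
    transitivity (\int[leb]_x ((3 * s ^+ d.+1)%:E * (h n x)%:E))%E.
      apply: eq_integral => x _; rewrite -EFinM; congr EFin.
      rewrite /g2 /h -(knn_radius_expV n s0) -[RHS]mulrA; congr (3 * _).
      rewrite -[X in X * `| _ |]ger0_norm ?exprn_ge0 ?(ltW s0)// -normrM /kappa.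
      by congr `| _ |; ring.
    rewrite ge0_integralZl//; last 2 first.
    - by move=> x _; rewrite lee_fin /h.
    - by rewrite lee_fin mulr_ge0// exprn_ge0// ltW.
    congr (_ * _)%E; apply: eq_integral => x _.
    rewrite -muE; last exact: measurable_eball.
    by rewrite -fine_mu_eballE.
  by rewrite (eq_cvg _ _ E).
apply: ge0_le_cvg0 (cvge0D c1 c2) => n.
  by apply: integral_ge0 => x _; rewrite lee_fin.
rewrite -ge0_integralD//; last 4 first.
- by move=> x _; rewrite lee_fin le_min ler01 g10.
- by apply/measurable_EFinP; exact: measurable_minr.
- by move=> x _; rewrite lee_fin le_min ler01 g20.
- by apply/measurable_EFinP; exact: measurable_minr.
apply: ge0_le_integral => //.
- apply/measurable_EFinP; apply: measurableT_comp => //; apply: measurable_funB.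
    exact: measurable_ball_binltR.
  exact: measurable_poislt_density.
- by apply: emeasurable_funD; apply/measurable_EFinP; exact: measurable_minr.
- by move=> x _; rewrite -EFinD lee_fin; exact: ball_binlt_poislt_le.
Qed.

End poisson_limit.

(** * Tonelli on the half-line and the Gamma function *)

Section halfline.
Context {R : realType}.
Local Open Scope ereal_scope.
Local Notation leb1 := (@lebesgue_measure R).

Section fubini.
Context {dT} {T : measurableType dT} (m : {sigma_finite_measure set T -> \bar R}).
Variable g : R -> T -> \bar R.
Hypothesis mg : measurable_fun setT (fun p : measurableTypeR R * T => g p.1 p.2).
Hypothesis g0 : forall v x, 0 <= g v x.

Let G (p : measurableTypeR R * T) := (0 < p.1 :> R)%R%:R%:E * g p.1 p.2.

Let mG : measurable_fun setT G.
Proof.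
apply: emeasurable_funM => //; apply/measurable_EFinP.
apply: measurable_bool_natr.
exact: measurable_fun_ltr.
Qed.

Let G0 p : 0 <= G p. Proof. by rewrite mule_ge0// lee_fin. Qed.

Let integral_G1 v : \int[m]_x G (v, x) =
  (fun v => \int[m]_x g v x) \_ `]0%R, +oo[%classic v.
Proof.
rewrite patchE /G/= mem_setE in_itv/= andbT; case: ifPn => _.
  by apply: eq_integral => x _; rewrite mul1e.
by rewrite integral0_eq// => x _; rewrite mul0e.
Qed.

Let integral_G2 x : \int[leb1]_v G (v, x) = \int[leb1]_(v in `]0%R, +oo[) g v x.
Proof.
rewrite [RHS]integral_mkcond; apply: eq_integral => v _.
by rewrite patchE /G/= mem_setE in_itv/= andbT; case: ifPn => _; rewrite ?mul1e ?mul0e.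
Qed.

Lemma measurable_integral_halfline :
  measurable_fun setT (fun x => \int[leb1]_(v in `]0%R, +oo[) g v x).
Proof.
rewrite -(_ : fubini_G leb1 G = fun x => \int[leb1]_(v in `]0%R, +oo[) g v x).
  exact: measurable_fun_fubini_tonelli_G.
by apply/funext => x; exact: integral_G2.
Qed.

Lemma fubini_halfline : \int[leb1]_(v in `]0%R, +oo[) \int[m]_x g v x =
  \int[m]_x \int[leb1]_(v in `]0%R, +oo[) g v x.
Proof.
transitivity (\int[leb1]_v \int[m]_x G (v, x)).
  by rewrite integral_mkcond; apply: eq_integral => v _; rewrite integral_G1.
transitivity (\int[m]_x \int[leb1]_v G (v, x)).
  exact: (fubini_tonelli (m1 := leb1 : {sigma_finite_measure set (measurableTypeR R) -> \bar R})).
by apply: eq_integral => x _; rewrite integral_G2.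
Qed.

End fubini.

Lemma layer_cake_pos (y : R) : (0 <= y)%R ->
  \int[leb1]_(v in `]0%R, +oo[) (v < y)%R%:R%:E = y%:E.
Proof.
move=> y0; rewrite integral_itv_obnd_cbnd ?layer_cake//.
apply/measurable_EFinP.
apply: measurable_bool_natr.
exact: measurable_fun_ltr.
Qed.

(** For an integer N >= k + a, t^(k + a) is at most 1 + t^N, and both resulting integrals are tails
    of gamma densities of integer shape. *)
Lemma Gammae_lty (k : nat) (a : R) : (0 <= a)%R -> Gammae (k.+1%:R + a) < +oo.
Proof.
move=> a0; pose N := (k + (Num.truncn a).+1)%N.
pose dens (i : nat) (t : R) : R := (t ^+ i / i`!%:R * expR (- t))%R.
have mdens i : measurable_fun setT (fun t => (dens i t)%:E : \bar R).
  apply/measurable_EFinP; apply: continuous_measurable_fun.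
  exact: continuous_poisson_dens.
have dens0 i t : (0 <= t)%R -> (0 <= dens i t)%R.
  by move=> t0; rewrite !mulr_ge0 ?exprn_ge0 ?expR_ge0.
have idens i : \int[leb1]_(t in `]0%R, +oo[) (dens i t)%:E < +oo.
  rewrite integral_itv_obnd_cbnd; last exact: measurable_funTS.
  by rewrite integral_poislt_dens// ltry.
have mN : measurable_fun setT (fun t => N`!%:R%:E * (dens N t)%:E : \bar R).
  exact: measurable_funeM.
have mS : measurable_fun setT (fun t => (dens 0%N t)%:E + N`!%:R%:E * (dens N t)%:E : \bar R).
  exact: emeasurable_funD.
have Nf : (0 < N`!%:R :> R)%R by rewrite ltr0n fact_gt0.
apply: (@le_lt_trans _ _ (\int[leb1]_(t in `]0%R, +oo[)
    ((dens 0%N t)%:E + N`!%:R%:E * (dens N t)%:E))).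
  apply: ge0_le_integral => //.
  - by move=> t _; rewrite lee_fin mulr_ge0 ?powR_ge0 ?expR_ge0.
  - by apply/measurable_EFinP; exact: measurable_powR_expR.
  - exact: measurable_funTS.
  - move=> t; rewrite /= in_itv/= andbT => t0; rewrite -EFinM -EFinD lee_fin.
    have e0 : (0 < expR (- t))%R by exact: expR_gt0.
    have -> : (dens 0%N t + N`!%:R * dens N t = (1 + t ^+ N) * expR (- t))%R.
      by rewrite /dens fact0 expr0 divr1; field; rewrite gt_eqF.
    rewrite ler_pM2r//.
    have -> : (k.+1%:R + a - 1 = k%:R + a)%R by rewrite -natr1; ring.
    have [t1|t1] := leP t 1%R.
      rewrite -[leLHS]addr0 lerD ?exprn_ge0 ?(ltW t0)//.
      rewrite [leRHS](_ : _ = 1 `^ (k%:R + a))%R; last by rewrite powR1.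
      rewrite ge0_ler_powR ?nnegrE ?addr_ge0//; exact: ltW.
    rewrite -[leLHS]add0r lerD//.
    rewrite -powR_mulrn ?(ltW t0)// ler_powR ?(ltW t1)//.
    by rewrite /N natrD lerD2l ltW// truncnS_gt.
rewrite ge0_integralD//; last 4 first.
- by move=> t; rewrite /= in_itv/= andbT => t0; rewrite lee_fin dens0// ltW.
- by apply: measurable_funTS; exact: mdens.
- move=> t; rewrite /= in_itv/= andbT => t0; rewrite mule_ge0 ?lee_fin// dens0//; exact: ltW.
- exact: measurable_funTS.
rewrite lte_add_pinfty// ge0_integralZl//.
- by rewrite lte_mul_pinfty.
- by apply: measurable_funTS; exact: mdens.
- by move=> t; rewrite /= in_itv/= andbT => t0; rewrite lee_fin dens0// ltW.
Qed.

Lemma GammaeE (k : nat) (a : R) : (0 <= a)%R -> Gammae (k.+1%:R + a) = (Gamma (k.+1%:R + a))%:E.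
Proof.
move=> a0; rewrite /Gamma /Rintegral fineK// ge0_fin_numE; first exact: Gammae_lty.
by apply: integral_ge0 => x _; rewrite lee_fin mulr_ge0 ?powR_ge0 ?expR_ge0.
Qed.

Lemma Gamma_ge0 (a : R) : (0 <= Gamma a)%R.
Proof.
rewrite /Gamma /Rintegral fine_ge0// integral_ge0// => t _.
by rewrite lee_fin mulr_ge0 ?powR_ge0 ?expR_ge0.
Qed.

Lemma Gamma_natE (k : nat) : Gamma k.+1%:R = k`!%:R :> R.
Proof.
suff : Gammae (k.+1%:R : R) = k`!%:R%:E by rewrite /Gamma /Rintegral -/(Gammae _) => ->.
have := @integral_poislt_dens R k 0%R (lexx _); rewrite poislt_at0/= => H.
have kf : (0 < k`!%:R :> R)%R by rewrite ltr0n fact_gt0.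
transitivity ((k`!%:R : R)%:E * 1); last by rewrite mule1.
rewrite -H -ge0_integralZl//; last 2 first.
- apply/measurable_EFinP; apply: measurable_funTS; apply: continuous_measurable_fun.
  exact: continuous_poisson_dens.
- by move=> t; rewrite /= in_itv/= andbT => t0; rewrite lee_fin !mulr_ge0 ?exprn_ge0 ?expR_ge0.
rewrite -integral_itv_obnd_cbnd; last first.
  apply: emeasurable_funM => //; apply/measurable_EFinP; apply: measurable_funTS.
  by apply: continuous_measurable_fun; exact: continuous_poisson_dens.
rewrite /Gammae; apply: eq_integral => t; rewrite inE/= in_itv/= andbT => t0.
rewrite -EFinM; congr EFin; rewrite -natr1 addrK powR_mulrn ?ltW//.
by field; rewrite gt_eqF.
Qed.

(* [poislt k.+1 z] is the probability that a gamma variable t with shape k + 1 is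
   at least z, so the left-hand side is the mean of (t / l)^a. *)
Lemma integral_poislt_powR (k : nat) (a l : R) : (0 < a)%R -> (0 < l)%R ->
  \int[leb1]_(v in `]0%R, +oo[) (poislt k.+1 (l * v `^ a^-1))%:E =
  (l `^ (- a) * (Gamma (k.+1%:R + a) / Gamma k.+1%:R))%:E.
Proof.
move=> a0 l0.
pose dens (t : R) : R := (t ^+ k / k`!%:R * expR (- t))%R.
have mdens : measurable_fun setT dens.
  by apply: continuous_measurable_fun; exact: continuous_poisson_dens.
pose g (v t : R) : \bar R := (((l * v `^ a^-1 <= t)%R%:R * dens t)%R)%:E.
have z0 v : (0 <= l * v `^ a^-1)%R by rewrite mulr_ge0 ?powR_ge0// ltW.
have g0 v t : 0 <= g v t.
  rewrite lee_fin; case: (leP (l * v `^ a^-1)%R t) => [|]; rewrite ?mul0r// mul1r => zt.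
  by rewrite !mulr_ge0 ?exprn_ge0 ?expR_ge0//; exact: le_trans zt.
have mg : measurable_fun setT (fun p : measurableTypeR R * measurableTypeR R => g p.1 p.2).
  apply/measurable_EFinP; apply: measurable_funM; last exact: (measurableT_comp mdens).
  apply: measurable_bool_natr.
  apply: measurable_fun_ler => //; apply: measurable_funM => //.
  exact: (measurableT_comp (measurable_powR _)).
transitivity (\int[leb1]_(v in `]0%R, +oo[) \int[leb1]_t g v t).
  apply: eq_integral => v _; rewrite -integral_poislt_dens// integral_mkcond.
  apply: eq_integral => t _; rewrite patchE mem_setE in_itv/= andbT /g.
  by case: ifP => _; rewrite ?mul1r ?mul0r.
rewrite (@fubini_halfline _ (measurableTypeR R) leb1 g)//.
have kf : (0 < k`!%:R :> R)%R by rewrite ltr0n fact_gt0.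
transitivity ((l `^ (- a) / k`!%:R)%:E * Gammae (k.+1%:R + a)); last first.
  rewrite GammaeE ?ltW// -EFinM; congr EFin; rewrite Gamma_natE.
  by field; rewrite gt_eqF.
rewrite /Gammae -ge0_integralZl//; last 3 first.
- by apply/measurable_EFinP; exact: measurable_powR_expR.
- by move=> t _; rewrite lee_fin mulr_ge0 ?powR_ge0 ?expR_ge0.
- by rewrite lee_fin divr_ge0 ?powR_ge0.
rewrite [RHS]integral_mkcond; apply: eq_integral => t _.
rewrite patchE mem_setE in_itv/= andbT; case: ltP => t0; last first.
  rewrite integral0_eq// => v; rewrite /= in_itv/= andbT => v0.
  rewrite /g leNgt (le_lt_trans t0) ?mul0r// mulr_gt0 ?powR_gt0//.
have tl0 : (0 <= t / l)%R by rewrite divr_ge0 ?(ltW t0) ?(ltW l0).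
have y0 : (0 <= (t / l) `^ a)%R by exact: powR_ge0.
transitivity (\int[leb1]_(v in `]0%R, +oo[) ((dens t)%:E * (v <= (t / l) `^ a)%R%:R%:E)).
  apply: eq_integral => v; rewrite inE/= in_itv/= andbT => v0.
  rewrite /g mulrC EFinM; congr (_ * (nat_of_bool _)%:R%:E).
  rewrite mulrC -ler_pdivlMr//.
  by apply: powR_inv_le => //; exact: ltW.
rewrite ge0_integralZl//; last 2 first.
- apply/measurable_EFinP.
  apply: measurable_bool_natr.
  exact: measurable_fun_ler.
- by rewrite lee_fin !mulr_ge0 ?exprn_ge0 ?expR_ge0 ?ltW.
rewrite (_ : \int[leb1]_(v in `]0%R, +oo[) _ = ((t / l) `^ a)%:E); last first.
  transitivity (\int[leb1]_(v in `]0%R, +oo[) (\1_(`]0%R, (t / l) `^ a]%classic) v)%:E).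
    apply: eq_integral => v; rewrite inE/= in_itv/= andbT => v0.
    by rewrite indicE mem_setE in_itv/= v0.
  rewrite integral_indic// setIidl; last first.
    by move=> x /=; rewrite !in_itv/= andbT => /andP[].
  rewrite [LHS]lebesgue_measure_itv/= lte_fin sube0.
  by case: ltgtP y0 => // <-.
rewrite -!EFinM; congr EFin; rewrite /dens powRM ?invr_ge0 ?ltW//.
rewrite -(powR_inv1 (ltW l0)) -powRrM mulN1r.
have -> : (k.+1%:R + a - 1 = k%:R + a)%R by rewrite -natr1; ring.
rewrite powRD ?powR_mulrn ?(ltW t0)//; last by rewrite (gt_eqF t0) implybT.
by ring.
Qed.

End halfline.

(** * The limit F and its integral *)

Section limit_function.
Context {R : realType} {d : nat}.
Local Notation V := (d.+1.-tuple R).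
Local Notation leb := (@lebesgue_tuple R d.+1).
Local Notation D := (d.+1%:R : R).
Variables (f : V -> R) (mu : probability V R) (alpha : R) (k : nat).
Hypothesis mf : measurable_fun setT f.
Hypothesis f0 : forall x, (0 <= f x)%R.
Hypothesis muE : forall B, measurable B -> mu B = (\int[leb]_(x in B) (f x)%:E)%E.
Hypothesis alpha0 : (0 < alpha)%R.
Hypothesis alphaD : (alpha < D)%R.
Local Open Scope ereal_scope.
Let omega : R := unit_ball_volume d.+1.
Let omega0 : (0 < omega)%R. Proof. exact: unit_ball_volume_gt0. Qed.
Let j := k.+1.

(* The limiting probability that (n^(1/d) D)^alpha exceeds v for the jth nearest
   neighbor distance D of a sample point at x, with j = k.+1. *)
Definition poisson_profile (v : R) (x : V) : R :=
  poislt j (omega * (v `^ alpha^-1) ^+ d.+1 * f x).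

Lemma poisson_profile01 v x : (0 <= poisson_profile v x <= 1)%R.
Proof.
have z0 : (0 <= omega * (v `^ alpha^-1) ^+ d.+1 * f x)%R.
  by rewrite mulr_ge0// mulr_ge0 ?exprn_ge0 ?powR_ge0// ltW.
by rewrite /poisson_profile poislt_ge0// poislt_le1.
Qed.

Lemma measurable_poisson_profile :
  measurable_fun setT (fun p : measurableTypeR R * V => (poisson_profile p.1 p.2)%:E).
Proof.
apply/measurable_EFinP; apply: (measurableT_comp (f := poislt j)).
  by apply: continuous_measurable_fun; exact: continuous_poislt.
apply: measurable_funM; last exact: (measurableT_comp mf).
apply: measurable_funM => //; apply: measurable_funX.
exact: (measurableT_comp (measurable_powR _)).
Qed.

Definition exceed_limit (v : R) : R := fine (\int[mu]_x (poisson_profile v x)%:E).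

Lemma measurable_poisson_profile1 v : measurable_fun setT (fun x => (poisson_profile v x)%:E).
Proof. exact: (measurableT_comp measurable_poisson_profile (measurable_pair1 v)). Qed.

Lemma integral_poisson_profile01 v : 0 <= \int[mu]_x (poisson_profile v x)%:E <= 1.
Proof.
apply/andP; split.
  by apply: integral_ge0 => x _; rewrite lee_fin; case/andP: (poisson_profile01 v x).
apply: (@le_trans _ _ (\int[mu]_x cst 1 x)); last first.
  by rewrite integral_cst// mul1e probability_le1.
apply: ge0_le_integral => //.
- by move=> x _; rewrite lee_fin; case/andP: (poisson_profile01 v x).
- exact: measurable_poisson_profile1.
- by move=> x _; rewrite lee_fin; case/andP: (poisson_profile01 v x).
Qed.

Lemma exceed_limitE v : (exceed_limit v)%:E = \int[mu]_x (poisson_profile v x)%:E.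
Proof.
have /andP[h0 h1] := integral_poisson_profile01 v.
by rewrite /exceed_limit fineK// ge0_fin_numE// (le_lt_trans h1)// ltry.
Qed.

Lemma exceed_limit01 v : (0 <= exceed_limit v <= 1)%R.
Proof. by rewrite -!lee_fin exceed_limitE integral_poisson_profile01. Qed.

Lemma measurable_exceed_limit : measurable_fun setT (exceed_limit : measurableTypeR R -> R).
Proof.
apply/measurable_EFinP; rewrite (_ : EFin \o _ = fun v => \int[mu]_x (poisson_profile v x)%:E); last first.
  by apply/funext => v; rewrite /= exceed_limitE.
apply: (@measurable_fun_fubini_tonelli_F _ _ (measurableTypeR R) V R mu
   (fun p => (poisson_profile p.1 p.2)%:E)).
- exact: measurable_poisson_profile.
- by move=> p; rewrite lee_fin; case/andP: (poisson_profile01 p.1 p.2).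
Qed.

Lemma integral_exceed_limit :
  \int[lebesgue_measure]_(v in `]0%R, +oo[) (exceed_limit v)%:E =
  (omega `^ (- (alpha / D)) * (Gamma (j%:R + alpha / D) / Gamma j%:R))%:E *
  Irho (1 - alpha / D) f.
Proof.
under eq_integral do rewrite exceed_limitE.
rewrite (@fubini_halfline R _ V mu (fun v x => (poisson_profile v x)%:E)); last 2 first.
- exact: measurable_poisson_profile.
- by move=> v x; rewrite lee_fin; case/andP: (poisson_profile01 v x).
have a0 : (0 < alpha / D)%R by rewrite divr_gt0.
have G0 : (0 <= Gamma (j%:R + alpha / D) / Gamma j%:R)%R.
  by rewrite divr_ge0 ?Gamma_ge0.
have c0 : (0 <= omega `^ (- (alpha / D)) * (Gamma (j%:R + alpha / D) / Gamma j%:R))%R.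
  by rewrite mulr_ge0 ?powR_ge0.
rewrite (ge0_integral_density mf f0 muE); last 2 first.
- apply: (measurable_integral_halfline measurable_poisson_profile).
  by move=> v x; rewrite lee_fin; case/andP: (poisson_profile01 v x).
- by move=> x; apply: integral_ge0 => v _; rewrite lee_fin; case/andP: (poisson_profile01 v x).
rewrite /Irho -ge0_integralZl//; last 2 first.
- apply/measurable_EFinP; exact: (measurableT_comp (measurable_powR _)).
- by move=> x _; rewrite lee_fin powR_ge0.
apply: eq_integral => x _.
(* Where f vanishes the profile is constantly 1 and its integral in v is infinite, but it is
   multiplied by f x = 0. The right-hand side is 0 there too, because the exponent 1 - alpha / D is
   positive. *)
have [fx0|fx0] := eqVneq (f x) 0%R.
  by rewrite fx0 mule0 powR0 ?mule0// subr_eq0 gt_eqF// ltr_pdivrMr// mul1r.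
have fx : (0 < f x)%R by rewrite lt_neqAle eq_sym fx0 f0.
have -> : \int[lebesgue_measure]_(v in `]0%R, +oo[) (poisson_profile v x)%:E =
   ((omega * f x) `^ (- (alpha / D)) * (Gamma (j%:R + alpha / D) / Gamma j%:R))%:E.
  rewrite -(@integral_poislt_powR _ k _ (omega * f x))//; last by rewrite mulr_gt0.
  apply: eq_integral => v _; congr (poislt _ _)%:E.
  rewrite -powR_mulrn ?powR_ge0// -powRrM invf_div mulrAC.
  by congr (_ * _ `^ _)%R; rewrite mulrC.
rewrite -!EFinM; congr EFin; rewrite powRM ?ltW//.
rewrite powRD; last by rewrite fx0 implybT.
rewrite powRr1 ?ltW//; ring.
Qed.

End limit_function.

(** * The fraction of large nearest neighbor distances *)

Section exceedance_fraction.
Context {R : realType} {d : nat} {dT} {T : measurableType dT}.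
Local Notation V := (d.+1.-tuple R).
Variables (P : probability T R) (X : nat -> {RV P >-> V}).
Variable mu : probability V R.
Hypothesis Xindep : mutually_independent X.
Hypothesis Xmu : forall i (B : set V), measurable B -> P (X i @^-1` B) = mu B.
Hypothesis mu_atomless : forall x, mu [set x] = 0%E.
Variables (j n : nat).
Hypothesis j0 : (0 < j)%N.
Local Open Scope ereal_scope.

Definition sample_knn_dist (i : nat) (w : T) : R :=
  knn_dist j (X i w) (sample (fun k => X k w) n.+1).

Definition exceed_frac (r : R) (w : T) : R :=
  (n.+1%:R^-1 * \sum_(i < n.+1) (r < sample_knn_dist i w)%R%:R)%R.

Lemma integral_bool (b : T -> bool) : measurable [set w | b w] ->
  \int[P]_w (b w)%:R%:E = P [set w | b w].
Proof.
move=> mb; rewrite -[X in P X]setIT -integral_indic//.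
by apply: eq_integral => w _; rewrite indicE; congr ((nat_of_bool _)%:R%:E);
  apply/idP/idP; rewrite inE.
Qed.

Lemma measurable_sample_knn_dist (i : 'I_n.+1) :
  measurable_fun setT (sample_knn_dist i).
Proof.
by apply: (measurable_knn_dist (X := fun k => X k)) => // k; exact: measurable_funPT.
Qed.

Lemma measurable_exceed r (i : 'I_n.+1) :
  measurable [set w | (r < sample_knn_dist i w)%R].
Proof. exact: measurable_knn_gt. Qed.

Lemma exceed_frac01 r w : (0 <= exceed_frac r w <= 1)%R.
Proof.
rewrite /exceed_frac mulr_ge0 ?sumr_ge0//=.
rewrite mulrC ler_pdivrMr// mul1r -[X in (_ <= X%:R)%R]card_ord -sumr_const.
by apply: ler_sum => i _; rewrite lern1 leq_b1.
Qed.

Lemma measurable_exceed_frac r : measurable_fun setT (exceed_frac r).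
Proof.
apply: measurable_funM => //; apply: measurable_sum => i.
apply: measurable_bool_natr.
by apply: measurable_fun_ltr => //; exact: measurable_sample_knn_dist.
Qed.

Lemma integral_exceed_frac r : (j <= n)%N -> (0 <= r)%R ->
  \int[P]_w (exceed_frac r w)%:E = \int[mu]_x (ball_binlt mu n j r x)%:E.
Proof.
move=> jn r0.
pose b (i : 'I_n.+1) w : \bar R := (r < sample_knn_dist i w)%R%:R%:E.
have mb i : measurable_fun setT (b i).
  apply/measurable_EFinP.
  apply: measurable_bool_natr.
  by apply: measurable_fun_ltr => //; exact: measurable_sample_knn_dist.
have b0 i w : 0 <= b i w by rewrite lee_fin.
transitivity (\int[P]_w (n.+1%:R^-1%:E * \sum_(i < n.+1) b i w)).
  by apply: eq_integral => w _; rewrite sumEFin -EFinM.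
rewrite ge0_integralZl//; last 2 first.
- exact: emeasurable_sum.
- by move=> w _; exact: sume_ge0.
rewrite ge0_integral_sum//.
set I := RHS.
have bE i : \int[P]_w b i w = I.
  rewrite /b integral_bool; last exact: measurable_exceed.
  by rewrite /I /sample_knn_dist (prob_knn_gt Xindep Xmu mu_atomless).
under eq_bigr do rewrite bE.
have If : I \is a fin_num by exact: fin_num_integral_ball_binlt.
rewrite -(fineK If) sumEFin -EFinM sumr_const card_ord -[in LHS]mulr_natr; congr EFin.
by field; rewrite nat1r pnatr_eq0.
Qed.

(** The square is an average over pairs of indices. The diagonal pairs contribute at most 1 / (n +
    1) in total, each other pair is bounded by [prob_knn_gt2]. *)
Lemma integral_exceed_frac_sqr r : (j <= n)%N -> (0 <= r)%R ->
  \int[P]_w (exceed_frac r w ^+ 2)%:E <=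
  n.+1%:R^-1%:E + (\int[mu]_x mu (eball x (r + r)) +
    (\int[mu]_x (ball_binlt mu n.-1 j r x)%:E) *
    (\int[mu]_x (ball_binlt mu n.-1 j r x)%:E)).
Proof.
move=> jn r0; set B := _ + _ * _.
have B0 : 0 <= B.
  rewrite /B adde_ge0 ?integral_ge0// mule_ge0// integral_ge0// => x _; rewrite lee_fin;
    by case/andP: (ball_binlt01 mu n.-1 j r x).
have [Bf|] := ltP B +oo; last by rewrite leye_eq => /eqP ->; rewrite addey// leey.
have BE : B = (fine B)%:E by rewrite fineK// ge0_fin_numE.
pose b (i k : 'I_n.+1) w := (r < sample_knn_dist i w)%R && (r < sample_knn_dist k w)%R.
have mb i k : measurable [set w | b i k w].
  rewrite (_ : [set _ | _] = [set w | (r < sample_knn_dist i w)%R] `&`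
     [set w | (r < sample_knn_dist k w)%R]).
    by apply: measurableI; exact: measurable_exceed.
  by apply/seteqP; split => w /=; rewrite /b => /andP.
have mbE i k : measurable_fun setT (fun w => (b i k w)%:R%:E : \bar R).
  apply/measurable_EFinP.
  apply: measurable_bool_natr.
  by apply: measurable_and; apply: measurable_fun_ltr => //; exact: measurable_sample_knn_dist.
rewrite [leLHS](_ : _ = \int[P]_w ((n.+1%:R^-1 ^+ 2)%:E *
    \sum_(i < n.+1) \sum_(k < n.+1) (b i k w)%:R%:E)); last first.
  apply: eq_integral => w _; under eq_bigr do rewrite sumEFin.
  rewrite sumEFin -EFinM; congr EFin; rewrite /exceed_frac exprMn; congr (_ * _)%R.
  rewrite expr2 big_distrlr/=; apply: eq_bigr => i _; apply: eq_bigr => k _.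
  by rewrite /b -natrM mulnb.
rewrite ge0_integralZl//; last 2 first.
- by apply: emeasurable_sum => i; apply: emeasurable_sum => k.
- by move=> w _; apply: sume_ge0 => i _; apply: sume_ge0 => k _; rewrite lee_fin.
rewrite ge0_integral_sum//; last 2 first.
- by move=> i; apply: emeasurable_sum => k.
- by move=> i w _; apply: sume_ge0 => k _; rewrite lee_fin.
have Hik i k : \int[P]_w (b i k w)%:R%:E <= (((i == k)%:R + fine B)%R)%:E.
  rewrite integral_bool//; have [<-|ik] := eqVneq i k.
    by rewrite (le_trans (probability_le1 _ _))// lee_fin lerDl fine_ge0.
  rewrite add0r -BE.
  apply: le_trans (prob_knn_gt2 Xindep Xmu mu_atomless j0 _ (ltn_ord i) (ltn_ord k) _ r0) => //.
  rewrite le_eqVlt; apply/orP; left; apply/eqP; congr (P _).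
  by apply/seteqP; split => w /=; rewrite /b => /andP.
apply: (@le_trans _ _ ((n.+1%:R^-1 ^+ 2)%:E *
    \sum_(i < n.+1) \sum_(k < n.+1) (((i == k)%:R + fine B)%R)%:E)).
  rewrite lee_wpmul2l ?lee_fin ?exprn_ge0//; apply: lee_sum => i _.
  rewrite ge0_integral_sum//.
  by apply: lee_sum => k _.
under eq_bigr do rewrite sumEFin.
rewrite sumEFin -EFinM [in leRHS]BE -EFinD lee_fin.
have E (i : 'I_n.+1) : (\sum_(k < n.+1) ((i == k)%:R + fine B) = 1 + n.+1%:R * fine B)%R.
  rewrite big_split/= sumr_const card_ord mulr_natl; congr (_ + _)%R.
  by rewrite (bigD1 i)//= eqxx big1 ?addr0// => k /negPf; rewrite eq_sym => ->.
under eq_bigr do rewrite E.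
rewrite sumr_const card_ord -[X in (_ * X)%R]mulr_natl.
rewrite [leLHS](_ : _ = n.+1%:R^-1 + fine B)%R//.
by field; rewrite nat1r pnatr_eq0.
Qed.

End exceedance_fraction.

(** * Convergence of the fraction at a fixed level *)

Section exceedance_limit.
Context {R : realType} {d : nat} {dT} {T : measurableType dT}.
Local Notation V := (d.+1.-tuple R).
Local Notation leb := (@lebesgue_tuple R d.+1).
Variables (P : probability T R) (X : nat -> {RV P >-> V}).
Variables (f : V -> R) (mu : probability V R).
Hypothesis Xindep : mutually_independent X.
Hypothesis Xmu : forall i (B : set V), measurable B -> P (X i @^-1` B) = mu B.
Hypothesis mf : measurable_fun setT f.
Hypothesis f0 : forall x, (0 <= f x)%R.
Hypothesis muE : forall B, measurable B -> mu B = (\int[leb]_(x in B) (f x)%:E)%E.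
Variables (k : nat) (alpha : R).
Hypothesis alpha0 : (0 < alpha)%R.
Local Open Scope ereal_scope.
Let j := k.+1.
Let mu0 := density_atomless mf muE.
Local Notation F := (exceed_limit f mu alpha k).

Definition exceed_radius (n : nat) (v : R) : R := knn_radius (d := d) (v `^ alpha^-1) n.

Lemma exceed_radius_ge0 n v : (0 <= exceed_radius n v)%R.
Proof. by rewrite divr_ge0 ?powR_ge0. Qed.

(** The number of trials is left free because the sample has n + 1 points: the mean of the fraction
    uses m = n and its second moment m = n - 1. *)
Lemma cvg_ball_binlt_limit (v : R) (m : nat -> nat) : (0 < v)%R ->
  (forall n, (m n <= n.+1 <= (m n).+2)%N) ->
  fine (\int[mu]_x (ball_binlt mu (m n) j (exceed_radius n v) x)%:E)
    @[n --> \oo] --> F v.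
Proof.
move=> v0 mn.
have s0 : (0 < v `^ alpha^-1)%R by rewrite powR_gt0.
have u0 n : 0 <= \int[mu]_x (`|ball_binlt mu (m n) j (exceed_radius n v) x -
    poisson_profile f alpha k v x|)%:E.
  by apply: integral_ge0 => x _; rewrite lee_fin.
have [/(_ (cvg_integral_ball_binlt mf f0 muE j s0 mn)) H _] := ge0_cvg0P u0.
apply/cvgrPdist_le => e e0; have := H e e0; apply: filterS => n.
move=> Hu; rewrite -lee_fin; apply: le_trans Hu; rewrite distrC -abse_EFin EFinB.
rewrite fineK ?fin_num_integral_ball_binlt// exceed_limitE//.
apply: abse_integralB_le => //.
- exact: measurable_ball_binltR.
- by apply/measurable_EFinP; exact: measurable_poisson_profile1.
- by move=> x; case/andP: (ball_binlt01 mu (m n) j (exceed_radius n v) x).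
- by move=> x; have /andP[] : (0 <= poisson_profile f alpha k v x <= 1)%R by exact: poisson_profile01.
- by rewrite -ge0_fin_numE ?fin_num_integral_ball_binlt// integral_ge0// => x _;
    rewrite lee_fin; case/andP: (ball_binlt01 mu (m n) j (exceed_radius n v) x).
- by rewrite -exceed_limitE// ltry.
Qed.

Lemma cvg_exceed_frac_sqr (v : R) : (0 < v)%R ->
  \int[P]_w (((exceed_frac X j n (exceed_radius n v) w - F v) ^+ 2)%:E)
    @[n --> \oo] --> 0.
Proof.
move=> v0.
pose Z n := exceed_frac X j n (exceed_radius n v).
have mZ n : measurable_fun setT (Z n) by exact: measurable_exceed_frac.
have Z01 n w : (0 <= Z n w <= 1)%R by exact: exceed_frac01.
have /andP[F0 F1] : (0 <= F v <= 1)%R by exact: exceed_limit01.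
pose A (m : nat) n := fine (\int[mu]_x (ball_binlt mu m j (exceed_radius n v) x)%:E).
have AE m n : \int[mu]_x (ball_binlt mu m j (exceed_radius n v) x)%:E = (A m n)%:E.
  by rewrite /A fineK// fin_num_integral_ball_binlt.
have cA : A n n @[n --> \oo] --> F v by apply: cvg_ball_binlt_limit => // n; rewrite !leqnSn.
have cA' : A n.-1 n @[n --> \oo] --> F v.
  apply: cvg_ball_binlt_limit => // -[|n]; rewrite /= ?leqnSn//.
  by rewrite !ltnS ltnW//=.
pose N n := fine (\int[mu]_x mu (eball x (exceed_radius n v + exceed_radius n v))).
have rc : (exceed_radius n v + exceed_radius n v)%R @[n --> \oo] --> (0 : R)%R.
  by rewrite -[X in _ --> X](addr0 (0 : R)%R); apply: cvgD; exact: cvg_knn_radius.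
have /fine_cvgP[Nf cN] := cvg_integral_mu_eball mf muE rc.
have cV : (n.+1%:R^-1 : R)%R @[n --> \oo] --> (0 : R)%R by exact: cvg_harmonic.
have cB : (n.+1%:R^-1 + (N n + A n.-1 n * A n.-1 n) + F v ^+ 2 - 2 * F v * A n n)%R
    @[n --> \oo] --> (0 : R)%R.
  rewrite [X in _ --> X](_ : _ = 0 + (0 + F v * F v) + F v ^+ 2 - 2 * F v * F v)%R; last by ring.
  apply: cvgB; last by apply: cvgM => //; exact: cvg_cst.
  apply: cvgD; last exact: cvg_cst.
  by apply: cvgD => //; apply: cvgD => //; exact: cvgM.
apply/ge0_cvg0P => [n|e e0].
  by apply: integral_ge0 => w _; rewrite lee_fin sqr_ge0.
have : \forall n \near \oo, (j <= n)%N by exact: nbhs_infty_ge.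
move/cvgrPdist_le : cB => /(_ e e0); move: Nf; apply: filterS3 => n Nfn Bn jn.
have {Bn} Be : (n.+1%:R^-1 + (N n + A n.-1 n * A n.-1 n) + F v ^+ 2 - 2 * F v * A n n <= e)%R.
  by apply: le_trans Bn; rewrite sub0r normrN ler_norm.
have r0 := exceed_radius_ge0 n v.
have H1 := integral_exceed_frac Xindep Xmu mu0 (isT : (0 < j)%N) jn r0.
have H2 := integral_exceed_frac_sqr Xindep Xmu mu0 (isT : (0 < j)%N) jn r0.
rewrite -/(Z n) AE in H1; rewrite -/(Z n) AE -(fineK Nfn) -/(N n) -EFinM -!EFinD in H2.
have mZ1 : measurable_fun setT (fun w => (Z n w)%:E) by exact/measurable_EFinP.
have mZ2 : measurable_fun setT (fun w => (Z n w ^+ 2)%:E).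
  by apply/measurable_EFinP; exact: measurable_funX.
have mZF : measurable_fun setT (fun w => ((Z n w - F v) ^+ 2)%:E).
  by apply/measurable_EFinP; apply: measurable_funX; exact: measurable_funB.
(* The expansion of the square, with the cross term moved to the left so that only nonnegative
   functions are integrated. *)
have key : \int[P]_w ((Z n w - F v) ^+ 2)%:E + (2 * F v * A n n)%:E =
    \int[P]_w (Z n w ^+ 2)%:E + (F v ^+ 2)%:E.
  rewrite -[X in _ + X = _](_ : \int[P]_w ((2 * F v)%:E * (Z n w)%:E) = _); last first.
    rewrite ge0_integralZl//; last 2 first.
    - by move=> w _; rewrite lee_fin; case/andP: (Z01 n w).
    - by rewrite lee_fin mulr_ge0.
    by rewrite H1 -EFinM.
  rewrite -[X in _ = _ + X](_ : \int[P]_w cst (F v ^+ 2)%:E w = _); last first.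
    by rewrite integral_cst// [X in _ * X]probability_setT mule1.
  have h1 w : 0 <= ((Z n w - F v) ^+ 2)%:E by rewrite lee_fin sqr_ge0.
  have h2 w : 0 <= (Z n w ^+ 2)%:E by rewrite lee_fin sqr_ge0.
  have h3 w : 0 <= (2 * F v)%:E * (Z n w)%:E.
    have /andP[z0 _] := Z01 n w.
    by apply: mule_ge0; rewrite lee_fin //; exact: mulr_ge0.
  have h4 : measurable_fun setT (fun w => (2 * F v)%:E * (Z n w)%:E) by exact: measurable_funeM.
  have h5 (w : T) : 0 <= cst (F v ^+ 2)%:E w by rewrite lee_fin sqr_ge0.
  rewrite -!ge0_integralD//.
  by apply: eq_integral => w _; rewrite -EFinM -!EFinD; congr EFin; ring.
rewrite -(@leeD2rE _ (2 * F v * A n n)%:E)// key.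
apply: (le_trans (leeD2r _ H2)); rewrite -!EFinD lee_fin.
by rewrite -lerBlDr.
Qed.

Lemma cvg_exceed_frac (v : R) : (0 < v)%R ->
  \int[P]_w (`|exceed_frac X j n (exceed_radius n v) w - F v|%:E)
    @[n --> \oo] --> 0.
Proof.
move=> v0.
have mS n : measurable_fun setT (fun w => exceed_frac X j n (exceed_radius n v) w - F v)%R.
  by apply: measurable_funB => //; exact: measurable_exceed_frac.
apply/ge0_cvg0P => [n|e e0].
  by apply: integral_ge0 => w _; rewrite lee_fin.
have sq0 n : 0 <= \int[P]_w (((exceed_frac X j n (exceed_radius n v) w - F v) ^+ 2)%:E).
  by apply: integral_ge0 => w _; rewrite lee_fin sqr_ge0.
have e2 : (0 < e / 2)%R by rewrite divr_gt0.
have [/(_ (cvg_exceed_frac_sqr v0) _ (mulr_gt0 e2 e2)) + _] := ge0_cvg0P sq0.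
apply: filterS => n Hn.
(* From L2 to L1 by |t| <= c + t^2 / c with c = e / 2; the squared term was made at most c^2 on
   average. *)
apply: (@le_trans _ _ (\int[P]_w ((e / 2)%:E + ((e / 2)^-1)%:E *
   ((exceed_frac X j n (exceed_radius n v) w - F v) ^+ 2)%:E))).
  apply: ge0_le_integral => //.
  - by apply/measurable_EFinP; exact: measurableT_comp.
  - apply: emeasurable_funD => //; apply: emeasurable_funM => //.
    by apply/measurable_EFinP; exact: measurable_funX.
  - move=> w _; rewrite -EFinM -EFinD lee_fin.
    move: (_ - _)%R => t; move: (e / 2)%R e2 => c c0.
    have h : (0 <= (`|t| - c) ^+ 2 / c)%R by rewrite divr_ge0 ?sqr_ge0// ltW.
    have E : ((`|t| - c) ^+ 2 / c = t ^+ 2 / c - 2 * `|t| + c)%R.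
      by rewrite -(real_normK (num_real t)); field; rewrite gt_eqF.
    have : (0 <= `|t|)%R by [].
    by move: h; rewrite E mulrC; lra.
rewrite ge0_integralD//; last 3 first.
- by rewrite lee_fin ltW.
- by move=> w _; rewrite mule_ge0// lee_fin ?sqr_ge0// invr_ge0 ltW.
- by apply: emeasurable_funM => //; apply/measurable_EFinP; exact: measurable_funX.
rewrite integral_cst// [X in _ * X + _]probability_setT mule1 ge0_integralZl//; last 3 first.
- by apply/measurable_EFinP; exact: measurable_funX.
- by move=> w _; rewrite lee_fin sqr_ge0.
- by rewrite lee_fin invr_ge0 ltW.
rewrite [e in leRHS]splitr EFinD leeD2l//.
by rewrite muleC lee_pdivrMr.
Qed.

End exceedance_limit.

(** * Convergence in L1 *)

Section dominating_function.
Context {R : realType}.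
Local Notation leb1 := (@lebesgue_measure R).

Lemma cvg_powRN_pinfty (q : R) : 0 < q -> (v `^ (- q)) @[v --> +oo] --> (0 : R).
Proof.
move=> q0; apply/cvgrPdist_le => e e0; near=> v.
have v0 : 0 < v by near: v; exact: nbhs_pinfty_gt.
have ev : e^-1 `^ q^-1 <= v by near: v; apply: nbhs_pinfty_ge; exact: num_real.
rewrite sub0r normrN ger0_norm ?powR_ge0// powRN invf_ple ?posrE ?powR_gt0//.
by rewrite -powR_inv_le ?invr_ge0 ?(ltW e0) ?(ltW v0).
Unshelve. all: by end_near. Qed.

Lemma integral_powR_tail (p v0 : R) : 1 < p -> 0 < v0 ->
  (\int[leb1]_(v in `[v0, +oo[) (v `^ (- p))%:E < +oo)%E.
Proof.
move=> p1 v00; pose F (v : R) := (1 - p)^-1 * v `^ (1 - p).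
have p0 : 1 - p != 0 by rewrite subr_eq0 lt_eqF.
have dF (v : R) : 0 < v -> is_derive v 1 F (v `^ (- p)).
  move=> vp; have := is_deriveZ (1 - p)^-1 (is_derive1_powR (1 - p) vp).
  rewrite /GRing.scale/= mulrA mulVf// mul1r (_ : 1 - p - 1 = - p)//; ring.
rewrite (@ge0_continuous_FTC2y _ _ F v0 0); first by rewrite -EFinB ltry.
- by move=> v _; exact: powR_ge0.
- apply: continuous_in_subspaceT => v; rewrite inE/= in_itv/= andbT => vv.
  have [+ _] := is_derive1_powR (- p) (lt_le_trans v00 vv).
  by move=> /derivable1_diffP/differentiable_continuous.
- rewrite -(mulr0 (1 - p)^-1); apply: cvgM; first exact: cvg_cst.
  by rewrite -(opprB p); apply: cvg_powRN_pinfty; rewrite subr_gt0.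
- by move=> v vv; have [] := dF v (lt_trans v00 vv).
- apply: cvg_at_right_filter; have [+ _] := dF v0 v00.
  by move=> /derivable1_diffP/differentiable_continuous.
- move=> v; rewrite in_itv/= andbT => vv; rewrite derive1E.
  by have [_ ->] := dF v (lt_trans v00 vv).
Qed.

(** The dominating function in v: constant up to v0, where only the boundedness of the fraction is
    used, then a power integrable at infinity when p > 1. *)
Definition flat_powR (B p v0 v : R) : R :=
  2 * (0 < v <= v0)%R%:R + B * (v `^ (- p) * (v0 <= v)%R%:R).

Lemma measurable_flat_powR B p v0 :
  measurable_fun setT (flat_powR B p v0 : measurableTypeR R -> R).
Proof.
apply: measurable_funD; apply: measurable_funM => //.
  apply: measurable_bool_natr.
  by apply: measurable_and; [exact: measurable_fun_ltr|exact: measurable_fun_ler].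
apply: measurable_funM; first exact: measurable_powR.
apply: measurable_bool_natr.
exact: measurable_fun_ler.
Qed.

Lemma flat_powR_ge0 B p v0 v : 0 <= B -> 0 <= flat_powR B p v0 v.
Proof. by move=> B0; rewrite addr_ge0 ?mulr_ge0 ?powR_ge0. Qed.

Lemma integral_flat_powR_lty B p v0 : 0 <= B -> 1 < p -> 0 < v0 ->
  (\int[leb1]_v (flat_powR B p v0 v)%:E < +oo)%E.
Proof.
move=> B0 p1 v00.
pose g1 (v : R) : \bar R := (\1_(`]0%R, v0]%classic) v)%:E.
pose g2 (v : R) : \bar R := (v `^ (- p) * (v0 <= v)%R%:R)%:E.
have mg1 : measurable_fun setT g1 by apply/measurable_EFinP; exact: measurable_indic.
have mg2 : measurable_fun setT g2.
  apply/measurable_EFinP; apply: measurable_funM; first exact: measurable_powR.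
  apply: measurable_bool_natr.
  exact: measurable_fun_ler.
have g10 v : (0 <= g1 v)%E by rewrite lee_fin.
have g20 v : (0 <= g2 v)%E by rewrite lee_fin mulr_ge0 ?powR_ge0.
rewrite [ltLHS](_ : _ = \int[leb1]_v (2%:E * g1 v + B%:E * g2 v))%E; last first.
  apply: eq_integral => v _; rewrite -!EFinM -EFinD /flat_powR /g1 indicE.
  by rewrite mem_setE in_itv.
rewrite ge0_integralD//; last 4 first.
- by move=> v _; rewrite mule_ge0.
- exact: measurable_funeM.
- by move=> v _; rewrite mule_ge0.
- exact: measurable_funeM.
rewrite !ge0_integralZl//; apply: lte_add_pinfty; apply: lte_mul_pinfty => //.
  by rewrite integral_indic// setIT [ltLHS]lebesgue_measure_itv/= lte_fin v00 ltry.
apply: le_lt_trans (integral_powR_tail p1 v00).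
rewrite [leRHS]integral_mkcond le_eqVlt; apply/orP; left; apply/eqP.
apply: eq_integral => v _; rewrite patchE mem_setE in_itv/= andbT /g2.
by case: ifP => _; rewrite ?mulr1 ?mulr0.
Qed.

End dominating_function.

Section L1_convergence.
Context {R : realType} {d : nat} {dT} {T : measurableType dT}.
Local Notation V := (d.+1.-tuple R).
Local Notation leb := (@lebesgue_tuple R d.+1).
Local Notation leb1 := (@lebesgue_measure R).
Local Notation D := (d.+1%:R : R).
Variables (P : probability T R) (X : nat -> {RV P >-> V}).
Variables (f : V -> R) (mu : probability V R) (beta C : R).
Hypothesis Xindep : mutually_independent X.
Hypothesis Xmu : forall i (B : set V), measurable B -> P (X i @^-1` B) = mu B.
Hypothesis mf : measurable_fun setT f.
Hypothesis f0 : forall x, (0 <= f x)%R.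
Hypothesis muE : forall B, measurable B -> mu B = (\int[leb]_(x in B) (f x)%:E)%E.
Hypothesis C0 : 0 < C.
Hypothesis betaD : D < beta.
Hypothesis f_upper : forall x, C <= enorm x -> f x < C * enorm x `^ (- beta).
Hypothesis f_lower : forall x, C <= enorm x -> C^-1 * enorm x `^ (- beta) < f x.
Variables (k : nat) (alpha : R).
Hypothesis alpha0 : (0 < alpha)%R.
Hypothesis alphaD : (alpha < D)%R.
Hypothesis Ifin : (Irho (1 - alpha / D) f < +oo)%E.
Let j := k.+1.
Let mu0 := density_atomless mf muE.
Local Notation F := (exceed_limit f mu alpha k).
Local Open Scope ereal_scope.

Let Z (n : nat) (v : R) (w : T) : R := exceed_frac X j n (exceed_radius (d := d) alpha n v) w.

Let Z01 n v w : (0 <= Z n v w <= 1)%R. Proof. exact: exceed_frac01. Qed.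
Let F01 v : (0 <= F v <= 1)%R. Proof. exact: exceed_limit01. Qed.

Let mZ n : measurable_fun setT (fun p : measurableTypeR R * T => Z n p.1 p.2).
Proof.
apply: measurable_funM => //; apply: measurable_sum => i.
apply: measurable_bool_natr.
apply: measurable_fun_ltr.
  apply: measurable_funM => //.
  exact: (measurableT_comp (measurable_powR _)).
apply: (measurableT_comp (f := sample_knn_dist X j n i)) => //.
exact: measurable_sample_knn_dist.
Qed.

Let mF : measurable_fun setT (F : measurableTypeR R -> R).
Proof. exact: measurable_exceed_limit. Qed.

Let gap n (v : R) (w : T) : \bar R := `|Z n v w - F v|%:E.

Let mgap n : measurable_fun setT (fun p : measurableTypeR R * T => gap n p.1 p.2).
Proof.
have mFp : measurable_fun setT (fun q : measurableTypeR R * T => F q.1).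
  exact: (measurableT_comp mF).
have := measurable_funB (mZ n) mFp; move=> /(measurableT_comp (@normr_measurable R setT)).
by move=> h; apply/measurable_EFinP.
Qed.

Let gap0 n v w : 0 <= gap n v w. Proof. by rewrite lee_fin. Qed.

Let mean_gap n v := \int[P]_w gap n v w.

Let mean_gap0 n v : 0 <= mean_gap n v. Proof. exact: integral_ge0. Qed.

Let measurable_mean_gap n : measurable_fun setT (mean_gap n : measurableTypeR R -> \bar R).
Proof.
exact: (@measurable_fun_fubini_tonelli_F _ _ (measurableTypeR R) T R P
  (fun p => gap n p.1 p.2)).
Qed.

(** The exponent of s in [integral_ball_binlt_le], with its sign changed and divided by alpha
    because s = v^(1/alpha). *)
Let p := (- ((D * D / beta - D) / alpha))%R.
(** The level at which s^(D / beta) = 2 C; from there on the uniform bound applies. *)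
Let v0 : R := ((2 * C) `^ (alpha * beta / D))%R.
Let B : R := @ball_binlt_const R d beta C j.

Let p_gt1 : (1 < p)%R.
Proof.
have beta0 : (0 < beta)%R by apply: le_lt_trans betaD.
have rho0 : (0 < 1 - alpha / D)%R by rewrite subr_gt0 ltr_pdivrMr// mul1r.
have := exponent_gt mf f0 C0 betaD f_lower rho0 Ifin.
move=> h; rewrite /p -mulNr ltr_pdivlMr// mul1r.
have : (D * D / beta < D - alpha)%R.
  rewrite ltr_pdivrMr// (_ : (D - alpha) * beta = D * (beta * (1 - alpha / D)))%R.
    by rewrite ltr_pM2l.
  by field; rewrite nat1r pnatr_eq0.
by lra.
Qed.

Let v0_gt0 : (0 < v0)%R. Proof. by rewrite powR_gt0// mulr_gt0. Qed.

Let mean_frac_le n v : (j <= n)%N -> (v0 <= v)%R ->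
  \int[mu]_x (ball_binlt mu n j (exceed_radius (d := d) alpha n v) x)%:E <= (B * v `^ (- p))%:E.
Proof.
move=> jn vv; have vp : (0 < v)%R by exact: lt_le_trans vv.
have beta0 : (0 < beta)%R by apply: le_lt_trans betaD.
have s0 : (0 < v `^ alpha^-1)%R by rewrite powR_gt0.
have -> : (v `^ (- p) = (v `^ alpha^-1) `^ (D * D / beta - D))%R.
  by rewrite -powRrM /p opprK mulrC.
apply: (integral_ball_binlt_le mf f0 muE C0 betaD f_upper jn s0).
have C20 : (0 <= 2 * C)%R by rewrite mulr_ge0// ltW.
have <- : (v0 `^ (alpha^-1 * (D / beta)) = 2 * C)%R.
  rewrite /v0 -powRrM (_ : alpha * beta / D * (alpha^-1 * (D / beta)) = 1)%R ?powRr1//.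
  by field; rewrite nat1r pnatr_eq0/= !gt_eqF.
by rewrite -powRrM ge0_ler_powR ?nnegrE ?(ltW v0_gt0) ?(ltW vp)// mulr_ge0 ?invr_ge0 ?divr_ge0 ?ltW.
Qed.

Let B0 : (0 <= B)%R.
Proof.
have e1 : (0 <= (2 * D + 1) ^+ d.+1 * j%:R)%R by rewrite mulr_ge0// exprn_ge0// addr_ge0// mulr_ge0.
have e2 : (0 <= j.+1%:R * @tail_const R d beta C)%R by rewrite mulr_ge0// ltW// tail_const_gt0.
by rewrite /B /ball_binlt_const addr_ge0// mulr_ge0// powR_ge0.
Qed.

(** The bound on the mean of Z does not depend on n, so it passes to the limit. *)
Let exceed_limit_le v : (v0 <= v)%R -> (F v <= B * v `^ (- p))%R.
Proof.
move=> vv; have vp : (0 < v)%R by exact: lt_le_trans vv.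
have mn n : (n <= n.+1 <= n.+2)%N by rewrite !leqnSn.
have H := cvg_ball_binlt_limit (k := k) (alpha := alpha) (m := fun n => n) mf f0 muE vp mn.
apply: (cvgr_to_le H).
have : \forall n \near \oo, (j <= n)%N by exact: nbhs_infty_ge.
apply: filterS => n jn; rewrite -lee_fin fineK ?fin_num_integral_ball_binlt//.
exact: mean_frac_le.
Qed.

(** Beyond v0 one uses |Z - F| <= Z + F; both means obey the same bound, hence [2 * B]. *)
Let mean_gap_le n v : (j <= n)%N -> (0 < v)%R ->
  mean_gap n v <= (flat_powR (2 * B) p v0 v)%:E.
Proof.
move=> jn vp; rewrite /flat_powR vp/=.
have mz : measurable_fun setT (fun w => (Z n v w)%:E).
  by apply/measurable_EFinP; exact: measurable_exceed_frac.
have mg : measurable_fun setT (gap n v).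
  exact: (measurableT_comp (mgap n) (measurable_pair1 v)).
have [vv|vv] := leP v v0.
  rewrite mulr1; apply: (@le_trans _ _ 2%:E); last first.
    by rewrite lee_fin lerDl mulr_ge0 ?mulr_ge0 ?powR_ge0.
  apply: (@le_trans _ _ (\int[P]_w (cst 2%:E w))); last first.
    by rewrite integral_cst// [X in _ * X]probability_setT mule1.
  apply: ge0_le_integral => // w _; rewrite lee_fin.
  have /andP[z0 z1] := Z01 n v w; have /andP[F0 F1] := F01 v.
  by rewrite ler_norml; apply/andP; split; lra.
rewrite (ltW vv) mulr0 add0r mulr1.
apply: (@le_trans _ _ (\int[P]_w ((Z n v w)%:E + cst (F v)%:E w))).
  apply: ge0_le_integral => //.
  - exact: emeasurable_funD.
  - move=> w _; rewrite lee_fin.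
    have /andP[z0 z1] := Z01 n v w; have /andP[F0 F1] := F01 v.
    by rewrite ler_norml; apply/andP; split; lra.
rewrite ge0_integralD//; last 2 first.
- by move=> w _; rewrite lee_fin; case/andP: (Z01 n v w).
- by move=> w _; rewrite lee_fin; case/andP: (F01 v).
rewrite integral_cst// [X in _ + _ * X]probability_setT mule1.
rewrite (integral_exceed_frac Xindep Xmu mu0)//; last exact: exceed_radius_ge0.
apply: (le_trans (leeD (mean_frac_le jn (ltW vv)) (_ : _ <= (B * v `^ (- p))%:E))).
  by rewrite lee_fin exceed_limit_le// ltW.
by rewrite -EFinD lee_fin; lra.
Qed.

Let total_gap n := \int[leb1]_(v in `]0%R, +oo[) mean_gap n v.

Let total_gap_lty n : (j <= n)%N -> total_gap n < +oo.
Proof.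
move=> jn; apply: (@le_lt_trans _ _ (\int[leb1]_v (flat_powR (2 * B) p v0 v)%:E)).
  apply: (@le_trans _ _ (\int[leb1]_(v in `]0%R, +oo[) (flat_powR (2 * B) p v0 v)%:E)).
    apply: ge0_le_integral => //.
    - by apply: measurable_funTS; exact: measurable_mean_gap.
    - by apply: measurable_funTS; apply/measurable_EFinP; exact: measurable_flat_powR.
    - by move=> v; rewrite /= in_itv/= andbT => vp; exact: mean_gap_le.
  apply: ge0_subset_integral => //.
  - by apply/measurable_EFinP; exact: measurable_flat_powR.
  - by move=> v _; rewrite lee_fin flat_powR_ge0// mulr_ge0.
by apply: integral_flat_powR_lty => //; rewrite mulr_ge0.
Qed.

(** Dominated convergence in v. The index is shifted by j because the dominating function is valid
    only for samples of more than j points. *)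
Let cvg_total_gap : total_gap (n + j)%N @[n --> \oo] --> 0.
Proof.
pose g n (v : measurableTypeR R) : \bar R := (0 < v :> R)%R%:R%:E * mean_gap (n + j) v.
have gE n : total_gap (n + j)%N = \int[leb1]_v g n v.
  rewrite /total_gap integral_mkcond; apply: eq_integral => v _.
  by rewrite patchE /g mem_setE in_itv/= andbT; case: ifP => _; rewrite ?mul1e ?mul0e.
rewrite (eq_cvg _ _ gE).
apply: (@ge0_dominated_cvg0 _ _ R leb1 g (fun v => (flat_powR (2 * B) p v0 v)%:E)).
- move=> n; apply: emeasurable_funM => //; apply/measurable_EFinP.
  apply: measurable_bool_natr.
  exact: measurable_fun_ltr.
- by move=> n v; rewrite mule_ge0// lee_fin.
- by apply/measurable_EFinP; exact: measurable_flat_powR.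
- move=> n v; rewrite /g; case: ltP => vp; last by rewrite mul0e lee_fin flat_powR_ge0// mulr_ge0.
  by rewrite mul1e mean_gap_le// leq_addl.
- by apply: integral_flat_powR_lty => //; rewrite mulr_ge0.
apply: aeW => v _; rewrite /g; case: ltP => vp.
  under eq_cvg do rewrite mul1e.
  have := cvg_exceed_frac Xindep Xmu mf f0 muE k alpha vp.
  by rewrite -(cvg_shiftn j).
rewrite (_ : (fun n => _) = cst 0); first exact: cvg_cst.
by apply/funext => n; rewrite mul0e.
Qed.

Definition mean_power (n : nat) (w : T) : R :=
  (n%:R^-1 * knn_power_sum j alpha (fun i => X i w) n)%R.

Lemma measurable_mean_power n : measurable_fun setT (mean_power n).
Proof.
case: n => [|n].
  rewrite (_ : mean_power 0 = cst 0%R)//.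
  by apply/funext => w; rewrite /mean_power invr0 mul0r.
apply: measurable_funM => //; apply: measurable_sum => i.
apply: (measurableT_comp (measurable_powR alpha)); apply: measurable_funM => //.
exact: (measurable_sample_knn_dist X (isT : (0 < j)%N) i).
Qed.

Let exceed_radius_lt n v y : (0 < v)%R -> (0 <= y)%R ->
  (v < (n.+1%:R `^ D^-1 * y) `^ alpha)%R = (exceed_radius (d := d) alpha n v < y)%R.
Proof.
move=> vp y0; rewrite /exceed_radius /knn_radius ltr_pdivrMr ?powR_gt0// [(y * _)%R]mulrC.
set t := (_ * y)%R; have t0 : (0 <= t)%R by rewrite mulr_ge0 ?powR_ge0.
rewrite !ltNge -(@powR_inv_le _ alpha^-1) ?invr_gt0 ?invrK//; exact: ltW.
Qed.

Let mean_power_layers n w :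
  \int[leb1]_(v in `]0%R, +oo[) (Z n v w)%:E = (mean_power n.+1 w)%:E.
Proof.
pose y (i : 'I_n.+1) : R := ((n.+1%:R `^ D^-1 * sample_knn_dist X j n i w) `^ alpha)%R.
have mb (i : 'I_n.+1) : measurable_fun setT (fun v : R => (v < y i)%R%:R%:E : \bar R).
  apply/measurable_EFinP.
  apply: measurable_bool_natr.
  exact: measurable_fun_ltr.
transitivity (\int[leb1]_(v in `]0%R, +oo[) (n.+1%:R^-1%:E * \sum_(i < n.+1) (v < y i)%R%:R%:E)).
  apply: eq_integral => v; rewrite inE/= in_itv/= andbT => vp.
  rewrite sumEFin -EFinM; congr (_ * _)%:E; apply: eq_bigr => i _.
  congr ((nat_of_bool _)%:R).
  by rewrite /y exceed_radius_lt//; exact: knn_dist_ge0.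
rewrite ge0_integralZl//; last 2 first.
- by apply: measurable_funTS; apply: emeasurable_sum => i; exact: mb.
- by move=> v _; apply: sume_ge0 => i _; rewrite lee_fin.
rewrite ge0_integral_sum//; last by move=> i; apply: measurable_funTS; exact: mb.
rewrite (eq_bigr (fun i => (y i)%:E)); last by move=> i _; rewrite layer_cake_pos// powR_ge0.
by rewrite sumEFin -EFinM.
Qed.

Let c : R := (unit_ball_volume d.+1 `^ (- (alpha / D)) *
  (Gamma (j%:R + alpha / D) / Gamma j%:R) * fine (Irho (1 - alpha / D) f))%R.

Let integral_F : \int[leb1]_(v in `]0%R, +oo[) (F v)%:E = c%:E.
Proof.
have If : Irho (1 - alpha / D) f \is a fin_num.
  by rewrite ge0_fin_numE// integral_ge0// => x _; rewrite lee_fin powR_ge0.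
by rewrite integral_exceed_limit// -{1}(fineK If) -EFinM.
Qed.

(** The average and its limit are both integrals over v, of Z and of F. The absolute value goes
    inside the integral and Tonelli exchanges v and w. *)
Let abs_mean_power_le n : \int[P]_w (`|mean_power n.+1 w - c|)%:E <= total_gap n.
Proof.
have mZw w : measurable_fun setT (fun v : measurableTypeR R => Z n v w).
  exact: (measurableT_comp (mZ n) (measurable_pair2 w)).
rewrite /total_gap (@fubini_halfline R _ T P (gap n))//.
apply: ge0_le_integral => //.
- apply/measurable_EFinP; apply: measurableT_comp => //; apply: measurable_funB => //.
  exact: measurable_mean_power.
- exact: (measurable_integral_halfline (mgap n)).
move=> w _; rewrite -abse_EFin EFinB -mean_power_layers -integral_F.
apply: (@abse_integralB_le _ (measurableTypeR R)) => //.
- exact: measurable_funTS.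
- exact: measurable_funTS.
- by move=> v; case/andP: (Z01 n v w).
- by move=> v; case/andP: (F01 v).
- by rewrite mean_power_layers ltry.
- by rewrite integral_F ltry.
Qed.

Let integrable_mean_power n : P.-integrable setT (EFin \o mean_power n).
Proof.
apply/integrableP; split; first by apply/measurable_EFinP; exact: measurable_mean_power.
(* With at most j sample points every distance takes its default value 0, and 0 to a positive power
   is 0. For larger samples integrability follows from the finite distance to the constant c. *)
have [nj|jn] := leqP n j.
  rewrite integral0_eq ?ltry// => w _ /=.
  rewrite /mean_power /knn_power_sum big1 ?mulr0 ?normr0// => i _.
  rewrite /knn_dist ltnNge (leq_trans _ nj) ?mulr0 ?powR0 ?gt_eqF//.
  by rewrite card_sample (leq_trans (size_undup _))// size_map size_iota.
case: n jn => // n jn.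
have mc : measurable_fun setT (fun w => mean_power n.+1 w - c)%R.
  by apply: measurable_funB => //; exact: measurable_mean_power.
apply: (@le_lt_trans _ _ (\int[P]_w ((`|mean_power n.+1 w - c|)%:E + cst `|c|%:E w))).
  apply: ge0_le_integral => //.
  - apply/measurable_EFinP; apply: measurableT_comp => //; exact: measurable_mean_power.
  - by apply: emeasurable_funD => //; apply/measurable_EFinP; exact: measurableT_comp.
  - move=> w _; rewrite /= lee_fin.
    by rewrite -[X in (`|X| <= _)%R](subrK c) ler_normD.
rewrite ge0_integralD//; last 2 first.
- by apply/measurable_EFinP; exact: measurableT_comp.
- by move=> w _; rewrite lee_fin.
rewrite integral_cst// [X in _ + _ * X]probability_setT mule1 lte_add_pinfty ?ltry//.
exact: le_lt_trans (abs_mean_power_le n) (total_gap_lty jn).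
Qed.

Theorem cvg_in_L1_mean_power : cvg_in_L1 P mean_power (fun=> c).
Proof.
split.
- by move=> n; apply/Lfun1_integrable; exact: integrable_mean_power.
- exact: Lfun_cst.
(* The shift is j + 1 rather than j since [total_gap n] concerns the sample of size n + 1. *)
rewrite unlock -(cvg_shiftn j.+1).
apply: ge0_le_cvg0 cvg_total_gap => n.
  by apply: integral_ge0 => w _; rewrite lee_fin.
by rewrite addnS; exact: abs_mean_power_le.
Qed.

End L1_convergence.

Theorem corollary1 (R : realType) (d j : nat) (d_gt0 : (0 < d)%N)
    (j_gt0 : (0 < j)%N) (f : d.-tuple R -> R) (f_density : is_density f)
    (f_tail : exists beta : R, d%:R < beta /\
      exists C : R, 0 < C /\
        forall x : d.-tuple R, C <= enorm x ->
          C^-1 * enorm x `^ (- beta) < f x /\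
          f x < C * enorm x `^ (- beta))
    (alpha : R) (alpha_gt0 : 0 < alpha) (alpha_ltd : alpha < d%:R)
    (I_fin : (Irho (1 - alpha / d%:R) f < +oo)%E)
    (dT : measure_display) (T : measurableType dT) (P : probability T R)
    (X : nat -> {RV P >-> d.-tuple R})
    (X_indep : mutually_independent X)
    (X_density : forall i : nat, has_density (X i) f) :
  cvg_in_L1 P
    (fun n w => n%:R^-1 * knn_power_sum j alpha (fun i => X i w) n)
    (fun=> unit_ball_volume d `^ (- (alpha / d%:R)) *
           (Gamma (j%:R + alpha / d%:R) / Gamma j%:R) *
           fine (Irho (1 - alpha / d%:R) f)).

Proof.
case: d d_gt0 f f_density f_tail alpha_ltd I_fin X X_indep X_density => // d _ f
  [mf f0 f1] [beta [betaD [C [C0 f_tail]]]] alphaD I_fin X X_indep X_density.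
case: j j_gt0 => // k _.
(* The common law is taken to be that of the first point; the others share it because they have the
   same density. *)
pose mu : probability (d.+1.-tuple R) R := distribution P (X 0%N).
have muE B : measurable B -> mu B = (\int[@lebesgue_tuple R d.+1]_(x in B) (f x)%:E)%E.
  exact: X_density.
have Xmu i B : measurable B -> P (X i @^-1` B) = mu B.
  by move=> mB; rewrite muE// -(X_density i B mB).
apply: (cvg_in_L1_mean_power X_indep Xmu mf f0 muE C0 betaD) => // x xC.
- by have [] := f_tail x xC.
- by have [] := f_tail x xC.
Qed.
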